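(* Assume (H). Let $Y_0=(Y_0^1,\dots,Y_0^d)$ with $Y_0^i$ i.i.d. $N(0,1)$, and let $\eta\sim\mu_0$ be independent of $Y_0$ with $\sup_\omega\|\eta(\omega)\|_q\le K<\infty$ for some $q\in[1,\infty]$. Then there is a unique solution $(Y_t)_{t\in[0,T)}$ of the ODE $$\frac{dY_t}{dt}=b^{\mu_0}_t(Y_t),\quad t\in[0,T),\qquad Y_t|_{t=0}=Y_0.$$ Moreover, for each $t\in[0,T)$ the law $\mu_t$ of $Y_t$ has density $\phi_t$, and: (i) for every $p\ge1$, $\mathcal W_{q,p}(\mu_t,\mu_0)\le\big[K+(\mathbb E\|Y_0\|_q^p)^{1/p}\big]\sigma_t$ for $t\in[0,T)$; (ii) for all $t\in[0,T)$ and $z\in\mathbb R^d$, $\|Y_t-\beta_tz\|_q\le\sigma_t\|Y_0\|_q+\beta_t\sup_\omega\|\eta(\omega)-z\|_q$; (iii) for every $M>0$ and $t\in[0,T)$, $$\mathbb P\Big(\|Y_t\|_\infty\ge\beta_t\sup_\omega\|\eta(\omega)\|_\infty+\sigma_tM\Big)\le1-\big(1-\mathrm{erfc}(M/\sqrt2)\big)^d,$$ where $\mathrm{erfc}(r):=\frac{2}{\sqrt\pi}\int_r^\infty e^{-x^2}dx$.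
   Context: Fix $d\in\mathbb N$ and $T\in(0,\infty]$. $\|x\|_q$ is the $\ell^q$-norm on $\mathbb R^d$, $q\in[1,\infty]$. Assumption (H): $\sigma:[0,T)\to(0,\infty)$ is continuous, strictly decreasing and differentiable with derivative $\sigma'_t$ bounded on $[0,t_0]$ for every $t_0<T$, $\sigma_0=1$, $\lim_{t\uparrow T}\sigma_t=0$; and $\beta_t:=1-\sigma_t$. For $\sigma>0$, $\rho_\sigma(x):=(2\pi\sigma^2)^{-d/2}e^{-\|x\|_2^2/(2\sigma^2)}$. $\Gamma_t(x,y):=\|x-\beta_ty\|_2^2/(2\sigma_t^2)$; $\phi_t(x):=\int\rho_{\sigma_t}(x-\beta_ty)\mu_0(dy)$; $\mathcal D^{\mu_0}_t(x):=\mathbb E[\eta e^{-\Gamma_t(x,\eta)}]/\mathbb E[e^{-\Gamma_t(x,\eta)}]$ with the expectation taken over $\eta\sim\mu_0$ only; $b^{\mu_0}_t(x):=\frac{\sigma'_t}{\sigma_t}(x-\mathcal D^{\mu_0}_t(x))$. $\sup_\omega$ denotes the supremum over the (essential) range of $\eta$. $\mathcal W_{q,p}(\nu,\mu):=\inf(\mathbb E\|\xi-\zeta\|_q^p)^{1/p}$ over all couplings $\mathrm{Law}(\xi)=\nu$, $\mathrm{Law}(\zeta)=\mu$. *)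

(* Defs.v *)
From HB Require Import structures.
From mathcomp Require Import all_boot all_order all_algebra.
From mathcomp Require Import all_classical all_reals all_analysis.
From mathcomp Require Import ess_sup_inf.
Set Implicit Arguments.
Unset Strict Implicit.
Unset Printing Implicit Defensive.
Import Order.TTheory GRing.Theory Num.Theory.
Import numFieldNormedType.Exports.
Local Open Scope classical_set_scope.
Local Open Scope ring_scope.

Section Defs.
Variable R : realType.

Definition lqnorm (d : nat) (q : \bar R) (x : 'rV[R]_d) : R :=
  match q with
  | +oo%E => \big[Num.max/0]_(i < d) `|x ord0 i|
  | EFin r => (\sum_(i < d) `|x ord0 i| `^ r) `^ r^-1
  | -oo%E => 0
  end.

(* conversions between row vectors and tuples (tuples carry the product
   (Borel) sigma-algebra of R^d) *)
Definition rv2t (d : nat) (x : 'rV[R]_d) : d.-tuple R := [tuple x ord0 i | i < d].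
Definition t2rv (d : nat) (x : d.-tuple R) : 'rV[R]_d := \row_(i < d) tnth x i.

Definition has_deriv_within (V : normedModType R) (A : set R) (f : R -> V)
  (t : R) (l : V) : Prop :=
  (fun h : R => h^-1 *: (f (h + t) - f t))
    @ within [set h : R | h != 0 /\ A (h + t)] (nbhs (0 : R)) --> l.

Definition I0T (T : \bar R) : set R := [set t | 0 <= t /\ (t%:E < T)%E].

Definition assumption_H (T : \bar R) (sigma sigma' : R -> R) : Prop :=
  {within I0T T, continuous sigma} /\
      (forall t, I0T T t -> 0 < sigma t) /\
      (forall s t, I0T T s -> I0T T t -> s < t -> sigma t < sigma s) /\
      (forall t, I0T T t -> has_deriv_within (I0T T) sigma t (sigma' t)) /\
      (forall t0, I0T T t0 -> exists C : R,
          forall t, 0 <= t <= t0 -> `|sigma' t| <= C) /\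
      sigma 0 = 1 /\
      (forall eps : R, 0 < eps -> exists t1, I0T T t1 /\
          forall t, I0T T t -> t1 <= t -> `|sigma t| < eps).

Definition beta (sigma : R -> R) (t : R) : R := 1 - sigma t.

Definition sqnorm2 (d : nat) (x : 'rV[R]_d) : R := \sum_(i < d) x ord0 i ^+ 2.

Definition rho (d : nat) (s : R) (x : 'rV[R]_d) : R :=
  (2 * pi * s ^+ 2) `^ (- (d%:R / 2)) * expR (- sqnorm2 x / (2 * s ^+ 2)).

Section Prob.
Context {dO : measure_display} {Om : measurableType dO} (P : probability Om R).

Definition Gamma (d : nat) (sigma : R -> R) (t : R) (x y : 'rV[R]_d) : R :=
  sqnorm2 (x - beta sigma t *: y) / (2 * sigma t ^+ 2).

Definition Dmu (d : nat) (eta : Om -> 'rV[R]_d) (sigma : R -> R) (t : R)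
  (x : 'rV[R]_d) : 'rV[R]_d :=
  \row_(i < d)
    (Rintegral P setT (fun w => eta w ord0 i * expR (- Gamma sigma t x (eta w)))
     / Rintegral P setT (fun w => expR (- Gamma sigma t x (eta w)))).

Definition drift (d : nat) (eta : Om -> 'rV[R]_d) (sigma sigma' : R -> R)
  (t : R) (x : 'rV[R]_d) : 'rV[R]_d :=
  (sigma' t / sigma t) *: (x - Dmu eta sigma t x).

Definition phi (d : nat) (eta : Om -> 'rV[R]_d) (sigma : R -> R) (t : R)
  (x : 'rV[R]_d) : \bar R :=
  (\int[P]_w (rho (sigma t) (x - beta sigma t *: eta w))%:E)%E.

Definition law (d : nat) (X : Om -> 'rV[R]_d) : set (d.-tuple R) -> \bar R :=
  fun A => P ((@rv2t d \o X) @^-1` A).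

Definition ode_solution (d : nat) (T : \bar R)
  (b : R -> 'rV[R]_d -> 'rV[R]_d) (Y0 : Om -> 'rV[R]_d)
  (Y : R -> Om -> 'rV[R]_d) : Prop :=
  forall w, Y 0 w = Y0 w /\
    forall t, I0T T t -> has_deriv_within (I0T T) (fun s => Y s w) t (b t (Y t w)).
End Prob.

(* iterated Lebesgue integral over R^n (= integral w.r.t. Lebesgue measure
   on R^n for nonnegative measurable integrands, by Tonelli) *)
Fixpoint iint (n : nat) : (n.-tuple R -> \bar R) -> \bar R :=
  match n return (n.-tuple R -> \bar R) -> \bar R with
  | 0 => fun f => f [tuple]
  | n'.+1 => fun f =>
      (\int[lebesgue_measure]_x iint (fun t : n'.-tuple R => f [tuple of x :: t]))%E
  end.

Definition coupling (d : nat) (mu nu : set (d.-tuple R) -> \bar R)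
  (pi : probability (d.-tuple R * d.-tuple R)%type R) : Prop :=
  (forall A, measurable A -> pi (A `*` setT) = mu A) /\
  (forall B, measurable B -> pi (setT `*` B) = nu B).

Definition wasserstein (d : nat) (q : \bar R) (p : R)
  (mu nu : set (d.-tuple R) -> \bar R) : \bar R :=
  ereal_inf [set ((\int[pi]_z (lqnorm q (t2rv z.1 - t2rv z.2) `^ p)%:E) `^ p^-1)%E
            | pi in [set pi : probability (d.-tuple R * d.-tuple R)%type R
                     | coupling mu nu pi]].

Definition erfc (r : R) : R :=
  2 / Num.sqrt pi * fine (\int[lebesgue_measure]_(x in `[r, +oo[) (expR (- x ^+ 2))%:E)%E.

End Defs.

(* Main.v *)
Require Import Defs.
From HB Require Import structures.
From mathcomp Require Import all_boot all_order all_algebra.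
From mathcomp Require Import all_classical all_reals all_analysis.
From mathcomp Require Import measurable_realfun ess_sup_inf ring lra.
Set Implicit Arguments.
Unset Strict Implicit.
Unset Printing Implicit Defensive.
Import Order.TTheory GRing.Theory Num.Theory.
Import numFieldNormedType.Exports.
Local Open Scope classical_set_scope.
Local Open Scope ring_scope.

(* Put s = beta_t / sigma_t and u = Y / sigma_t.  The ODE becomes u' = v(s, u),
   where v(s, x) is the mean of eta under the law of eta tilted by
   exp(s <x, eta> - s^2 |eta|^2 / 2), i.e. the posterior mean of eta given
   Y_0 + s eta = x.  Since eta is bounded, v is bounded and Lipschitz in x,
   locally uniformly in s: Picard iteration gives existence, Gronwall uniqueness.

   To see that u(s) has the law of Y_0 + s eta, let a Markov chain move, in a time
   step h, from x to x + h eta' with eta' drawn from the posterior at (s, x).  By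
   the Cameron-Martin formula it carries the law of Y_0 + s eta exactly to that of
   Y_0 + (s + h) eta.  One step has mean x + h v(s, x) and variance O(h^2), so the
   mean square distance between the chain and the flow u is multiplied by at most
   1 + C h and increased by O(h^2); letting h tend to 0, the chain started at Y_0
   converges to the flow, and the two laws agree.

   (ii) v is an average of eta and the norm is convex, so u - s z grows in norm at
   rate at most sup |eta - z|.  (i) couples sigma_t Y_0 + beta_t eta with eta, and
   (iii) combines (ii) for z = 0 with the independence of the coordinates of Y_0. *)

(** Since [sigma'] is bounded but not assumed continuous, Picard iteration does not apply to the
    original equation; in the rescaled variables [sigma'] disappears, and it returns only through
    the chain rule and the Gronwall bound. The flow is built for each outcome separately, so nothing
    is known beforehand about its measurability in the outcome. The chain settles measurability and
    law together: its transition operators act on measurable functions with values in [0,1], and the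
    functions of Y_0 that they produce converge pointwise to f(u) for each Lipschitz f. Lipschitz
    test functions are linear in the error, while one step of the chain is controlled in mean
    square. The inequality |a| <= (eps + a^2 / eps) / 2 passes from one to the other and leaves a
    quadratic bound that can be iterated; eps is fixed before the step size tends to 0. All bounds
    in the norm of order q come from supporting hyperplanes, because they must hold for averages of
    a vector whose norm is bounded only almost surely. *)

Lemma normr_expRB (R : realType) (a b : R) :
  `|expR a - expR b| <= `|a - b| * (expR a + expR b).
Proof.
wlog ab : a b / b <= a.
  move=> H; have [|/ltW ba] := leP b a; first exact: H.
  by rewrite distrC (distrC a) (addrC (expR a)); exact: H.
rewrite !ger0_norm ?subr_ge0 ?ler_expR//.
have := expR_ge1Dx (b - a).
rewrite expRD expRN => h.
have ea := expR_gt0 a.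
have : (1 + (b - a)) * expR a <= expR b.
  by rewrite -(ler_pdivlMr _ _ ea).
have : 0 <= (a - b) * expR b by rewrite mulr_ge0 ?subr_ge0 ?expR_ge0.
nra.
Qed.

(** * Exponentially tilted means *)

Section Tilt.
Context (R : realType) (dO : measure_display) (Om : measurableType dO).
Variable P : probability Om R.

(** A class closed under sums, products and the exponential, so that integrability follows from
    closure alone. The bound holds everywhere, which is why [eta] is later replaced by a clamped
    version. *)
Definition bounded_mfun (f : Om -> R) :=
  measurable_fun setT f /\ exists M, forall w, `|f w| <= M.

Lemma bounded_mfun_cst c : bounded_mfun (cst c).
Proof. by split; [exact: measurable_cst | exists `|c|]. Qed.

Lemma bounded_mfunD f g : bounded_mfun f -> bounded_mfun g ->
  bounded_mfun (fun w => f w + g w).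
Proof.
move=> [mf [M fM]] [mg [N gN]]; split; first exact: measurable_funD.
by exists (M + N) => w; apply: le_trans (ler_normD _ _) _; exact: lerD.
Qed.

Lemma bounded_mfunM f g : bounded_mfun f -> bounded_mfun g ->
  bounded_mfun (fun w => f w * g w).
Proof.
move=> [mf [M fM]] [mg [N gN]]; split; first exact: measurable_funM.
by exists (M * N) => w; rewrite normrM; exact: ler_pM.
Qed.

Lemma bounded_mfunZ c f : bounded_mfun f -> bounded_mfun (fun w => c * f w).
Proof. by move=> ?; apply: bounded_mfunM => //; exact: bounded_mfun_cst. Qed.

Lemma bounded_mfunB f g : bounded_mfun f -> bounded_mfun g ->
  bounded_mfun (fun w => f w - g w).
Proof.
move=> bf bg; apply: bounded_mfunD => //.
rewrite (_ : (fun w => - g w) = (fun w => -1 * g w)); first exact: bounded_mfunZ.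
by apply/funext => w; rewrite mulN1r.
Qed.

Lemma bounded_mfun_sum (I : finType) (f : I -> Om -> R) :
  (forall i, bounded_mfun (f i)) -> bounded_mfun (fun w => \sum_i f i w).
Proof.
move=> bf; have : forall s : seq I, bounded_mfun (fun w => \sum_(i <- s) f i w).
  elim=> [|i s IH].
    under [X in bounded_mfun X]funext do rewrite big_nil.
    exact: bounded_mfun_cst.
  under [X in bounded_mfun X]funext do rewrite big_cons.
  exact: bounded_mfunD.
exact.
Qed.

Lemma bounded_mfun_exp f : bounded_mfun f -> bounded_mfun (fun w => expR (f w)).
Proof.
move=> [mf [M fM]]; split; first exact: measurableT_comp.
exists (expR M) => w; rewrite ger0_norm ?expR_ge0// ler_expR.
by apply: le_trans (fM w); exact: ler_norm.
Qed.

Lemma bounded_mfun_integrable f : bounded_mfun f ->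
  P.-integrable setT (EFin \o f).
Proof.
move=> [mf [M fM]]; apply: measurable_bounded_integrable => //.
  by rewrite -ge0_fin_numE//; exact: fin_num_measure.
exists M; split; first by rewrite num_real.
by move=> x Mx w _; apply: le_trans (fM w) _; exact: ltW.
Qed.

Definition tilt_mass (a : Om -> R) := Rintegral P setT (fun w => expR (a w)).
(** The expectation of [g] under the Gibbs measure with density proportional to exp a with respect
    to [P]. *)
Definition tilt (a g : Om -> R) :=
  Rintegral P setT (fun w => g w * expR (a w)) / tilt_mass a.

Lemma tilt_mass_gt0 a : bounded_mfun a -> 0 < tilt_mass a.
Proof.
move=> ba; have [ma [M aM]] := ba.
apply: lt_le_trans (expR_gt0 (- M)) _.
have -> : expR (- M) = Rintegral P setT (fun=> expR (- M)).
  by rewrite Rintegral_cst// [X in fine X](probability_setT P) mulr1.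
apply: le_Rintegral => //.
- exact: (bounded_mfun_integrable (bounded_mfun_cst _)).
- exact: (bounded_mfun_integrable (bounded_mfun_exp ba)).
- move=> w _; rewrite ler_expR.
  by have := aM w; rewrite ler_norml => /andP[].
Qed.

Lemma tilt_mass_neq0 a : bounded_mfun a -> tilt_mass a != 0.
Proof. by move=> /tilt_mass_gt0; rewrite lt0r => /andP[]. Qed.

Section Fixed.
Variable a : Om -> R.
Hypothesis ba : bounded_mfun a.
Let be := bounded_mfun_exp ba.

Lemma tilt_integrable g : bounded_mfun g ->
  P.-integrable setT (EFin \o (fun w => g w * expR (a w))).
Proof. by move=> bg; apply: bounded_mfun_integrable; exact: bounded_mfunM. Qed.

Lemma tiltD f g : bounded_mfun f -> bounded_mfun g ->
  tilt a (fun w => f w + g w) = tilt a f + tilt a g.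
Proof.
move=> bf bg; rewrite /tilt -mulrDl -RintegralD//; try exact: tilt_integrable.
by congr (_ / _); apply: eq_Rintegral => w _; rewrite mulrDl.
Qed.

Lemma tiltZ c f : bounded_mfun f -> tilt a (fun w => c * f w) = c * tilt a f.
Proof.
move=> bf; rewrite /tilt mulrA -RintegralZl//; last exact: tilt_integrable.
by congr (_ / _); apply: eq_Rintegral => w _; rewrite mulrA.
Qed.

Lemma tiltB f g : bounded_mfun f -> bounded_mfun g ->
  tilt a (fun w => f w - g w) = tilt a f - tilt a g.
Proof.
move=> bf bg; rewrite /tilt -mulrBl -RintegralB//; try exact: tilt_integrable.
by congr (_ / _); apply: eq_Rintegral => w _; rewrite mulrBl.
Qed.

Lemma tilt_cst c : tilt a (cst c) = c.
Proof.
rewrite /tilt /=; under eq_Rintegral do rewrite mulrC.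
rewrite RintegralZr//; last exact: bounded_mfun_integrable.
by rewrite mulrC mulKf// tilt_mass_neq0.
Qed.

Lemma tilt_sum (I : finType) (f : I -> Om -> R) :
  (forall i, bounded_mfun (f i)) ->
  tilt a (fun w => \sum_i f i w) = \sum_i tilt a (f i).
Proof.
move=> bf.
suff H s : bounded_mfun (fun w => \sum_(i <- s) f i w) /\
    tilt a (fun w => \sum_(i <- s) f i w) = \sum_(i <- s) tilt a (f i).
  by have [] := H (index_enum I).
elim: s => [|i s [IH1 IH2]].
  rewrite big_nil.
  under [X in bounded_mfun X]funext do rewrite big_nil.
  under [X in tilt a X]funext do rewrite big_nil.
  by split; [exact: bounded_mfun_cst|exact: (tilt_cst 0)].
under [X in bounded_mfun X]funext do rewrite big_cons.
under [X in tilt a X]funext do rewrite big_cons.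
by rewrite big_cons tiltD// IH2; split => //; exact: bounded_mfunD.
Qed.

Lemma ler_tilt f g : bounded_mfun f -> bounded_mfun g ->
  (forall w, f w <= g w) -> tilt a f <= tilt a g.
Proof.
move=> bf bg fg; rewrite /tilt ler_pM2r ?invr_gt0 ?tilt_mass_gt0//.
apply: le_Rintegral => //; try exact: tilt_integrable.
by move=> w _; rewrite ler_wpM2r ?expR_ge0.
Qed.

Lemma tilt_norm_le f M : bounded_mfun f -> (forall w, `|f w| <= M) ->
  `|tilt a f| <= M.
Proof.
move=> bf fM; rewrite ler_norml; apply/andP; split.
  rewrite -(tilt_cst (- M)); apply: ler_tilt => //; first exact: bounded_mfun_cst.
  by move=> w; have := fM w; rewrite ler_norml => /andP[].
rewrite -(tilt_cst M); apply: ler_tilt => //; first exact: bounded_mfun_cst.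
by move=> w; apply: le_trans (fM w); exact: ler_norm.
Qed.

(** Otherwise f < c almost surely, so (c - f) exp a is positive almost surely with nonpositive
    integral, which a measure of mass 1 forbids. This turns a bound on a mean into a point where it
    holds, chosen inside an almost sure event. *)
Lemma tilt_witness f c (Q : set Om) : bounded_mfun f -> c <= tilt a f ->
  {ae P, forall w, Q w} -> exists w, Q w /\ c <= f w.
Proof.
move=> bf cf aeQ; apply: contrapT => /forallNP H.
have aelt : {ae P, forall w, f w < c}.
  apply: filterS aeQ => w Qw; rewrite ltNge; apply/negP => cw.
  by apply: (H w).
have bg : bounded_mfun (fun w => (c - f w) * expR (a w)).
  apply: bounded_mfunM => //; apply: bounded_mfunB => //.
  exact: bounded_mfun_cst.
have g0 : {ae P, forall w, setT w -> (0 <= ((c - f w) * expR (a w))%:E)%E}.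
  apply: filterS aelt => w fw _; rewrite lee_fin mulr_ge0 ?expR_ge0//.
  by rewrite subr_ge0 ltW.
have I0 : (\int[P]_w ((c - f w) * expR (a w))%:E <= 0)%E.
  have fi := integrable_fin_num measurableT (bounded_mfun_integrable bg).
  rewrite -(fineK fi) lee_fin.
  have : tilt a (fun w => c - f w) <= 0.
    by rewrite (tiltB (bounded_mfun_cst c) bf) (tilt_cst c) subr_le0.
  by rewrite /tilt pmulr_lle0 // invr_gt0 tilt_mass_gt0.
have Ia : (\int[P]_w `|((c - f w) * expR (a w))%:E| = 0)%E.
  apply/eqP; rewrite eq_le integral_ge0// andbT.
  apply: le_trans I0; rewrite le_eqVlt; apply/orP; left; apply/eqP.
  apply: ae_eq_integral => //.
  - by apply/measurable_EFinP; apply: measurableT_comp => //; case: bg.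
  - by apply/measurable_EFinP; case: bg.
  - apply: filterS g0 => w H0 Tw; have := H0 Tw; rewrite lee_fin => h.
    by rewrite abse_EFin ger0_norm.
have mg : measurable_fun setT (EFin \o (fun w => (c - f w) * expR (a w))).
  by apply/measurable_EFinP; case: bg.
have Hz := (ae_eq_integral_abs P measurableT mg).1 Ia.
have : {ae P, forall w : Om, False}.
  apply: filterS2 aelt Hz => w fw /(_ I) /= [] /eqP.
  by rewrite mulf_eq0 gt_eqF ?subr_gt0//= gt_eqF ?expR_gt0.
move=> [N [mN N0 sN]].
have : P setT = 0%E by apply: (subset_measure0 _ mN _ N0) => // w _; apply: sN => /=.
by rewrite [LHS](probability_setT P) => /eqP; rewrite onee_eq0.
Qed.

End Fixed.

(** Centre g at m = [tilt b g]: the integral of (g - m) exp b vanishes and can be subtracted for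
    free, leaving (g - m)(exp a - exp b) with |g - m| <= 2 G. By [normr_expRB] the integral is at
    most 2 G delta times the sum of the two masses, and division by the larger mass gives the
    constant 4. *)
Lemma tilt_dist a b g G delta : bounded_mfun a -> bounded_mfun b ->
  bounded_mfun g -> (forall w, `|g w| <= G) ->
  (forall w, `|a w - b w| <= delta) ->
  `|tilt a g - tilt b g| <= 4 * G * delta.
Proof.
move=> ba bb bg gG abd.
wlog Zab : a b ba bb abd / tilt_mass b <= tilt_mass a.
  move=> H; have [|/ltW Zba] := leP (tilt_mass b) (tilt_mass a); first exact: H.
  by rewrite distrC; apply: H => // w; rewrite distrC.
have Za := tilt_mass_gt0 ba.
set m := tilt b g.
have mG : `|m| <= G by exact: tilt_norm_le.
have bgm : bounded_mfun (fun w => g w - m).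
  by apply: bounded_mfunB => //; exact: bounded_mfun_cst.
have -> : tilt a g - m = tilt a (fun w => g w - m).
  by rewrite (tiltB ba bg (bounded_mfun_cst m)) (tilt_cst ba m).
have b0 : Rintegral P setT (fun w => (g w - m) * expR (b w)) = 0.
  have : tilt b (fun w => g w - m) = 0.
    by rewrite (tiltB bb bg (bounded_mfun_cst m)) (tilt_cst bb m) subrr.
  by rewrite /tilt => /eqP; rewrite mulf_eq0 invr_eq0 (negbTE (tilt_mass_neq0 bb)) orbF => /eqP.
rewrite /tilt normrM normfV (gtr0_norm Za) ler_pdivrMr//.
rewrite -[X in `|X|]subr0 -{1}b0 -RintegralB//; try exact: tilt_integrable.
have bea := bounded_mfun_exp ba; have beb := bounded_mfun_exp bb.
have bd : bounded_mfun (fun w => (g w - m) * expR (a w) - (g w - m) * expR (b w)).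
  by apply: bounded_mfunB; apply: bounded_mfunM.
apply: le_trans (le_normr_Rintegral measurableT (bounded_mfun_integrable bd)) _.
have G0 : 0 <= G by exact: le_trans mG.
have bS : bounded_mfun (fun w => 2 * G * delta * (expR (a w) + expR (b w))).
  by apply: bounded_mfunZ; apply: bounded_mfunD.
apply: (@le_trans _ _ (Rintegral P setT (fun w => 2 * G * delta * (expR (a w) + expR (b w))))).
  apply: le_Rintegral => //; last first.
  - move=> w _; rewrite -mulrBr normrM -mulrA; apply: ler_pM => //.
      apply: le_trans (ler_normB _ _) _; have := gG w; lra.
    apply: le_trans (normr_expRB _ _) _.
    by rewrite ler_wpM2r// addr_ge0 ?expR_ge0.
  - exact: bounded_mfun_integrable.
  - case: bd => mbd [N bN]; apply: bounded_mfun_integrable; split.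
      exact: measurableT_comp.
    by exists N => w; rewrite normr_id.
rewrite RintegralZl//; last by apply: bounded_mfun_integrable; exact: bounded_mfunD.
rewrite RintegralD//; try exact: bounded_mfun_integrable.
rewrite -/(tilt_mass a) -/(tilt_mass b).
(* [delta] bounds an absolute value at some point; a point exists because [P] has mass 1. *)
have d0 : 0 <= delta.
  have [w _] : exists w : Om, True.
    apply: contrapT => /forallNP h.
    have : @setT Om = set0 by apply/seteqP; split => // w; have := h w.
    move=> T0; have := @probability_setT _ _ _ P; rewrite T0 measure0 => /eqP.
    by rewrite eq_sym onee_eq0.
  exact: le_trans (abd w).
have : 0 <= G * delta by rewrite mulr_ge0.
nra.
Qed.

End Tilt.

(** * Comparison of derivatives and primitives on the line *)

Section RealDerivatives.
Variable R : realType.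
Implicit Types (f g df dg : R -> R) (a b : R).

Lemma derive_ge0_le f df a b : a <= b ->
  (forall x, a < x < b -> is_derive x 1 f (df x)) ->
  {within `[a, b], continuous f} ->
  (forall x, a < x < b -> 0 <= df x) -> f a <= f b.
Proof.
rewrite le_eqVlt => /predU1P[->//|ab] dfx cf df0.
have dfx' x : x \in `]a, b[%R -> is_derive x 1 f (df x).
  by rewrite in_itv/=; exact: dfx.
have [c + E] := MVT ab dfx' cf.
rewrite in_itv/= => /df0 dc0; rewrite -subr_ge0 E mulr_ge0//.
by rewrite subr_ge0 ltW.
Qed.

Lemma derive_le_le f df g dg a b : a <= b ->
  (forall x, a < x < b -> is_derive x 1 f (df x)) ->
  (forall x, a < x < b -> is_derive x 1 g (dg x)) ->
  {within `[a, b], continuous f} -> {within `[a, b], continuous g} ->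
  (forall x, a < x < b -> df x <= dg x) -> f b - f a <= g b - g a.
Proof.
move=> ab dfx dgx cf cg dfg.
suff : (g \- f) a <= (g \- f) b by rewrite /=; lra.
apply: (@derive_ge0_le _ (dg \- df)) => //.
- by move=> x xab; apply: is_deriveB; [exact: dgx|exact: dfx].
- by move=> x; apply: continuousB; [exact: cg|exact: cf].
- by move=> x /dfg; rewrite /= subr_ge0.
Qed.

Lemma derive_norm_le f df g dg a b : a <= b ->
  (forall x, a < x < b -> is_derive x 1 f (df x)) ->
  (forall x, a < x < b -> is_derive x 1 g (dg x)) ->
  {within `[a, b], continuous f} -> {within `[a, b], continuous g} ->
  (forall x, a < x < b -> `|df x| <= dg x) -> `|f b - f a| <= g b - g a.
Proof.
move=> ab dfx dgx cf cg dfg; rewrite ler_norml; apply/andP; split.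
  suff : (\- f) b - (\- f) a <= g b - g a by rewrite /=; lra.
  apply: (@derive_le_le _ (\- df) _ dg) => //.
  - by move=> x xab; apply: is_deriveN; exact: dfx.
  - by move=> x; apply: continuousN; exact: cf.
  - by move=> x /dfg; rewrite /= ler_norml => /andP[]; lra.
apply: (@derive_le_le _ df _ dg) => // x /dfg.
by rewrite ler_norml => /andP[].
Qed.

Lemma is_derive_within f df a b :
  (forall x, a <= x <= b -> is_derive x 1 f (df x)) ->
  {within `[a, b], continuous f}.
Proof.
move=> dfx; apply: derivable_within_continuous => x; rewrite in_itv/= => xab.
by have [] := dfx _ xab.
Qed.

(** Integrals from -N give primitives to the right of -N only. Normalised to vanish at 0, two of
    them agree wherever both are primitives, so N may depend on the point, here N = |x| + 1. *)
Lemma antiderivative f : continuous f ->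
  exists F : R -> R, F 0 = 0 /\ forall x : R, is_derive x 1 F (f x).
Proof.
move=> cf.
pose A (N x : R) := Rintegral lebesgue_measure `[- N, x] f
  - Rintegral lebesgue_measure `[- N, 0] f.
have dA (N x : R) : - N < x -> is_derive x 1 (A N) (f x).
  move=> Nx.
  have [] := @continuous_FTC1_closed _ f (- N) x (x + 1) _ _ Nx (cf x).
  - by rewrite ltrDl.
  - apply: continuous_compact_integrable; first exact: segment_compact.
    exact: continuous_subspaceT.
  move=> dF F'.
  rewrite -[f x]subr0 /A; apply: is_deriveB.
  by rewrite -F' derive1E; exact: DeriveDef.
have AA (N M x : R) : 0 < N -> 0 < M -> - N < x -> - M < x -> A N x = A M x.
  move=> N0 M0 Nx Mx.
  have key (u v : R) : - N < u -> - M < u -> u <= v -> A N v - A N u = A M v - A M u.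
    move=> Nu Mu uv.
    have h (K y : R) : - K < u -> u <= y <= v -> is_derive y 1 (A K) (f y).
      by move=> Ku /andP[uy _]; apply: dA; exact: lt_le_trans uy.
    have hc (K : R) : - K < u -> {within `[u, v], continuous (A K)}.
      by move=> Ku; apply: (@is_derive_within _ f) => y; exact: h.
    have hh (K y : R) : - K < u -> u < y < v -> is_derive y 1 (A K) (f y).
      by move=> Ku /andP[uy yv]; apply: h; rewrite ?ltW.
    apply/eqP; rewrite eq_le; apply/andP; split.
      by apply: (@derive_le_le _ f _ f) => //; [move=> y; exact: hh|move=> y; exact: hh|exact: hc|exact: hc].
    by apply: (@derive_le_le _ f _ f) => //; [move=> y; exact: hh|move=> y; exact: hh|exact: hc|exact: hc].
  have A0 K : A K 0 = 0 by rewrite /A subrr.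
  have [x0|/ltW x0] := leP 0 x.
    have := key 0 x; rewrite !A0 !subr0; apply => //; rewrite oppr_lt0//.
  by have := key x 0 Nx Mx x0; rewrite !A0 !sub0r => /oppr_inj.
exists (fun x => A (`|x| + 1) x); split; first by rewrite /A subrr.
move=> x.
have NB (y : R) : - (`|y| + 1) < y.
  by rewrite ltrNl; apply: le_lt_trans (ler_norm _) _; rewrite normrN ltrDl.
have P0 (y : R) : 0 < `|y| + 1 by rewrite ltr_wpDl.
(* The base point varies with the argument; the fixed one -(|x| + 2) serves all arguments within
   distance 1 of x. *)
apply: (@near_eq_is_derive _ _ _ (A (`|x| + 2))).
2: by apply: dA; apply: lt_trans (NB x); lra.
near=> y; apply: AA => //.
have : `|x - y| < 1 by near: y; apply: nbhsx_ballx.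
have := ler_normB x (x - y); rewrite opprB addrC subrK => h1 h2.
by have := ler_norm (- y); rewrite normrN; lra.
Unshelve. all: by end_near.
Qed.

End RealDerivatives.

(** * Existence for the rescaled equation *)

Section Picard.
Variables (R : realType) (d : nat).
Implicit Types (x y : 'I_d -> R).

Lemma is_derive_mull (c s : R) : is_derive s 1 ( *%R c) c.
Proof.
have := @is_deriveZ _ _ _ id c s 1 1 (is_derive_id s 1).
by rewrite [c *: 1]mulr1.
Qed.

Lemma dyadic_cauchy (a : R^nat) (C : R) :
  (forall n, `|a n.+1 - a n| <= C * 2^-1 ^+ n) ->
  forall n, `|limn a - a n| <= 2 * C * 2^-1 ^+ n.
Proof.
move=> aC n.
have C0 : 0 <= C by have := aC 0%N; rewrite expr0 mulr1; exact: le_trans.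
(* The factor 1 - 2^-m is that of the exact partial geometric sum; without it the induction would
   not close. *)
have tail m : `|a (n + m)%N - a n| <= 2 * C * 2^-1 ^+ n * (1 - 2^-1 ^+ m).
  elim: m => [|m IH]; first by rewrite addn0 expr0 !subrr normr0 mulr0.
  have := ler_distD (a (n + m)%N) (a (n + m).+1) (a n).
  have := aC (n + m)%N; rewrite addnS exprD exprS; nra.
have ca : cvgn a.
  rewrite (_ : a = (fun n => a 0%N + series (telescope a) n)); last first.
    by apply/funext => k; rewrite -eq_sum_telescope.
  apply: is_cvgD; first exact: is_cvg_cst.
  apply: normed_cvg; apply: (@series_le_cvg _ _ (geometric C 2^-1)) => //.
  - by move=> k; rewrite /=.
  - by move=> k; rewrite /= mulr_ge0// exprn_ge0.
  - by apply: is_cvg_geometric_series; rewrite ger0_norm// invf_lt1// ltr1n.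
have tail' m : (n <= m)%N -> `|a m - a n| <= 2 * C * 2^-1 ^+ n.
  move=> nm; rewrite -(subnKC nm); apply: le_trans (tail _) _.
  have p0 : 0 <= 2^-1 ^+ (m - n) :> R by exact: exprn_ge0.
  have : 0 <= 2 * C * 2^-1 ^+ n by rewrite !mulr_ge0.
  nra.
rewrite ler_distl; apply/andP; split.
  apply: limr_ge => //; near=> m.
  have /tail' : (n <= m)%N by near: m; exact: nbhs_infty_ge.
  by rewrite ler_distl => /andP[].
apply: limr_le => //; near=> m.
have /tail' : (n <= m)%N by near: m; exact: nbhs_infty_ge.
by rewrite ler_distl => /andP[].
Unshelve. all: by end_near.
Qed.

Lemma dyadic_le (x y C : R) : (forall n, x <= y + C * 2^-1 ^+ n) -> x <= y.
Proof.
move=> h; have c : geometric C 2^-1 n @[n --> \oo] --> (0 : R).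
  by apply: cvg_geometric; rewrite ger0_norm// invf_lt1// ltr1n.
have c2 : y + geometric C 2^-1 n @[n --> \oo] --> y + 0.
  by apply: cvgD => //; exact: cvg_cst.
rewrite -[y]addr0 -(cvg_lim _ c2)//.
by apply: limr_ge; [apply/cvg_ex; eexists; exact: c2|apply: nearW].
Qed.

Lemma lipschitz_continuous (f : R -> R) (K : R) :
  (forall s s', `|f s - f s'| <= K * `|s - s'|) -> continuous f.
Proof.
move=> fK x; apply/cvgrPdist_le => e e0.
have K0 : 0 < `|K| + 1 by rewrite ltr_wpDl.
have d0 : 0 < e / (`|K| + 1) by rewrite divr_gt0.
near=> y; apply: le_trans (fK _ _) _.
apply: (@le_trans _ _ ((`|K| + 1) * `|x - y|)).
  by apply: ler_wpM2r => //; rewrite ler_wpDr// ler_norm.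
rewrite mulrC -ler_pdivlMr//; apply: ltW.

Unshelve. all: by end_near.
Qed.

Variables (F : R -> ('I_d -> R) -> 'I_d -> R) (K : R) (x0 : 'I_d -> R).
Hypothesis FK : forall s x i, `|F s x i| <= K.
Hypothesis FL : forall S : R, 0 <= S -> exists2 L : R, 0 <= L &
  forall (s : R) x y i, 0 <= s <= S -> `|F s x i - F s y i| <= L * \sum_j `|x j - y j|.
Hypothesis Fc : forall v : 'I_d -> R -> R, (forall j, continuous (v j)) ->
  forall i, continuous (fun s => F s (v ^~ s) i).

(* The field is frozen at its time 0 value for negative times, so that the
   iterates are functions on the whole line. *)
Let mx (s : R) : R := Num.max 0 s.

Let mx_id (s : R) : 0 <= s -> mx s = s.
Proof. by move=> s0; exact/max_idPr. Qed.

Let mx_ge0 s : 0 <= mx s.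
Proof. by rewrite le_max lexx. Qed.

Let mx_lip s s' : `|mx s - mx s'| <= 1 * `|s - s'|.
Proof.
have h1 := ler_norm (s - s'); have h2 := ler_norm (- (s - s')).
rewrite normrN in h2; rewrite mul1r /mx /Order.max ler_norml.
by case: (ltP 0 s) (ltP 0 s') => ? [] ?; apply/andP; split; lra.
Qed.

Let mx_cont : continuous mx.
Proof. exact: lipschitz_continuous mx_lip. Qed.

(** A total choice of primitive, so that [step] takes no proof of continuity as an argument; on a
    discontinuous function the value is arbitrary. *)
Let anti (f : R -> R) : {G : R -> R | continuous f ->
  G 0 = 0 /\ forall x : R, is_derive x 1 G (f x)}.
Proof.
apply: cid; have [cf|ncf] := pselect (continuous f).
  by have [G] := antiderivative cf; exists G.
by exists f => /ncf.
Qed.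

Let field (v : 'I_d -> R -> R) i (s : R) := F (mx s) (v ^~ (mx s)) i.

Let step (v : 'I_d -> R -> R) i (s : R) : R := x0 i + projT1 (anti (field v i)) s.

Let field_cont (v : 'I_d -> R -> R) : (forall j, continuous (v j)) -> forall i, continuous (field v i).
Proof.
move=> cv i s; rewrite /field.
apply: (@continuous_comp _ _ _ mx (fun s => F s (v ^~ s) i)); first exact: mx_cont.
exact: Fc.
Qed.

Let stepP (v : 'I_d -> R -> R) : (forall j, continuous (v j)) ->
  (forall i, step v i 0 = x0 i) /\
  forall i (s : R), is_derive s 1 (step v i) (field v i s).
Proof.
move=> cv; split=> i; rewrite /step; case: anti => G /= /(_ (@field_cont v cv i)) [G0 dG].
  by rewrite G0 addr0.
by move=> s; rewrite -[X in is_derive _ _ _ X]add0r; apply: is_deriveD.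
Qed.

Let step_lip (v : 'I_d -> R -> R) : (forall j, continuous (v j)) ->
  forall i (s s' : R), `|step v i s - step v i s'| <= K * `|s - s'|.
Proof.
move=> cv i s s'; have [_ dv] := stepP cv.
wlog ss : s s' / s' <= s.
  move=> H; have [|/ltW] := leP s' s; first exact: H.
  by move=> /H; rewrite distrC (distrC s').
rewrite (ger0_norm (_ : 0 <= s - s')) ?subr_ge0// mulrBr.
apply: (@derive_norm_le R (step v i) (field v i) (fun r => K * r) (fun=> K) s' s) => //.
- by move=> x _; exact: is_derive_mull.
- by apply: (@is_derive_within _ _ (field v i)).
- by apply: continuous_subspaceT => x; apply: cvgM; [exact: cvg_cst|exact: cvg_id].
- by move=> r _; exact: FK.
Qed.

Let step_cont (v : 'I_d -> R -> R) : (forall j, continuous (v j)) -> forall i, continuous (step v i).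
Proof. by move=> cv i; apply: lipschitz_continuous (@step_lip v cv i). Qed.

Let u := fix u n : 'I_d -> R -> R :=
  if n is m.+1 then step (u m) else fun i _ => x0 i.

Let u_cont n i : continuous (u n i).
Proof.
elim: n i => [|n IH] i; last exact: step_cont.
by move=> s; exact: cvg_cst.
Qed.

(** Picard's map is a contraction for the sup norm weighted by exp(- c s): integrating L exp(c s)
    gains a factor L / c per coordinate, hence d L / c <= 1/2 after summation. The weight makes this
    work on all of [0, S] at once, with no gluing of short intervals. *)
Let step_dist (S L B c : R) n (v w : 'I_d -> R -> R) : 0 <= L -> 0 < c ->
  (forall (s : R) x y i, 0 <= s <= S -> `|F s x i - F s y i| <= L * \sum_j `|x j - y j|) ->
  (forall j, continuous (v j)) -> (forall j, continuous (w j)) ->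
  2 * (d%:R * L) <= c ->
  (forall (s : R), 0 <= s <= S -> \sum_j `|v j s - w j s| <= B * 2^-1 ^+ n * expR (c * s)) ->
  forall (s : R), 0 <= s <= S ->
  \sum_j `|step v j s - step w j s| <= B * 2^-1 ^+ n.+1 * expR (c * s).
Proof.
move=> L0 c0 FL' cv cw Lc H s /andP[s0 sS].
have [v0 dv] := stepP cv; have [w0 dw] := stepP cw.
have E0 : 0 <= B * 2^-1 ^+ n.
  have := H 0; rewrite lexx (le_trans s0 sS) mulr0 expR0 mulr1 => /(_ isT).
  by apply: le_trans; exact: sumr_ge0.
pose A := L * (B * 2^-1 ^+ n) / c.
have A0 : 0 <= A by rewrite /A divr_ge0 ?(ltW c0)//; exact: mulr_ge0.
have key j : `|step v j s - step w j s| <= A * expR (c * s).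
  have := @derive_norm_le _ (step v j \- step w j) (field v j \- field w j)
    (fun s => A * expR (c * s)) (fun s => A * (c * expR (c * s))) 0 s s0.
  rewrite /= v0 w0 subrr subr0 mulr0 expR0 mulr1 => h.
  apply: le_trans (h _ _ _ _ _) _; last by rewrite gerBl.
  - move=> x _.
    have de := is_derive_mull c x.
    apply: (@is_deriveZ _ _ _ (fun s => expR (c * s))).
    rewrite mulrC; apply: (@is_derive1_comp _ expR (fun s => c * s)).
  - move=> x; apply: continuousB.
      exact: (@is_derive_within _ _ (field v j)).
    exact: (@is_derive_within _ _ (field w j)).
  - apply: continuous_subspaceT => x; apply: cvgM; first exact: cvg_cst.
    apply: (cvg_comp (fun r => c * r) expR); last exact: continuous_expR.
    by apply: cvgM; [exact: cvg_cst|exact: cvg_id].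
  - move=> x /andP[x0' xs]; rewrite /field mx_id ?(ltW x0')//.
    have xS : 0 <= x <= S by rewrite ltW//= (le_trans _ sS)// ltW.
    apply: le_trans (FL' _ _ _ _ xS) _.
    apply: le_trans (ler_wpM2l L0 (H _ xS)) _.
    rewrite /A le_eqVlt; apply/orP; left; apply/eqP.
    by field; rewrite gt_eqF.
apply: le_trans (ler_sum _ (fun j _ => key j)) _.
rewrite sumr_const card_ord -[leLHS]mulr_natl mulrA ler_wpM2r ?expR_ge0//.
rewrite exprSr mulrA /A !mulrA ler_pdivrMr//.
have : 0 <= (B * 2^-1 ^+ n) * (c - 2 * (d%:R * L)) by rewrite mulr_ge0// subr_ge0.
nra.
Qed.

Let u_dyadic (S : R) : 0 <= S -> exists C : R, forall n j (s : R), 0 <= s <= S ->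
  `|u n.+1 j s - u n j s| <= C * 2^-1 ^+ n.
Proof.
move=> S0; have [L L0 FL'] := FL S0.
(* The added 1 keeps [c] positive when d L = 0. *)
pose c := 2 * (d%:R * L) + 1.
have c0 : 0 < c by rewrite /c ltr_wpDl// !mulr_ge0.
(* In dimension 0 the hypothesis [FK] is vacuous and says nothing about the sign of [K]. *)
have K0 : (0 < d)%N -> 0 <= K by move=> d0; apply: le_trans (FK 0 x0 (Ordinal d0)).
have H n : forall (s : R), 0 <= s <= S ->
    \sum_j `|u n.+1 j s - u n j s| <= d%:R * K * S * 2^-1 ^+ n * expR (c * s).
  elim: n => [|n IH] s sS.
    rewrite expr0 mulr1 -!mulrA mulr_natl -[in leRHS](card_ord d) -sumr_const.
    apply: ler_sum => j _.
    have [u0 _] := stepP (@u_cont 0%N).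
    have := step_lip (@u_cont 0%N) j s 0; rewrite u0 subr0 => h.
    apply: le_trans h _; have [s0 ss] := andP sS.
    have K1 : 0 <= K by apply: K0; exact: leq_ltn_trans (ltn_ord j).
    rewrite (ger0_norm s0) ler_wpM2l//.
    have : 1 <= expR (c * s) by rewrite -expR0 ler_expR mulr_ge0// ltW.
    nra.
  by apply: (step_dist L0 c0 FL' _ _ _ IH) => //; rewrite /c lerDl.
exists (`|d%:R * K * S| * expR (c * S)) => n j s sS.
apply: (@le_trans _ _ (\sum_j `|u n.+1 j s - u n j s|)).
  by rewrite (bigD1 j)//= lerDl sumr_ge0.
apply: le_trans (H n s sS) _; rewrite -!mulrA.
rewrite (mulrC (expR _)) !mulrA; apply: ler_pM; rewrite ?expR_ge0//.
- have : (0 < d)%N by exact: leq_ltn_trans (ltn_ord j).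
  by move=> /K0 k0; rewrite !mulr_ge0.
- by rewrite -!mulrA !mulrA ler_wpM2r// ler_norm.
- by rewrite ler_expR ler_wpM2l ?(ltW c0)//; case/andP: sS.
Qed.

(** The limit [l] of the iterates inherits their Lipschitz constant [K], so it is continuous and
    [step l] is a genuine primitive. Both [l] and [step l] are within O(2^-n) of the iterate n + 1,
    hence equal at nonnegative times, and [step l] solves the equation. *)
Lemma picard : exists v : 'I_d -> R -> R,
  (forall i, v i 0 = x0 i) /\
  forall i (s : R), 0 <= s -> is_derive s 1 (v i) (F s (v ^~ s) i).
Proof.
(* Composing with [mx] extends the limit to negative times by its value at 0; the dyadic estimate
   covers nonnegative times only. *)
pose l j s := limn (fun n => u n j (mx s)).
have lC (S : R) : 0 <= S -> exists C : R, forall n j (s : R), 0 <= s <= S ->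
    `|l j s - u n j s| <= C * 2^-1 ^+ n.
  move=> S0; have [C HC] := u_dyadic S0; exists (2 * C) => n j s sS.
  have s0 : 0 <= s by case/andP: sS.
  by have := @dyadic_cauchy (fun n => u n j s) C (fun n => HC n j s sS) n; rewrite /l mx_id.
have l_cont j : continuous (l j).
  apply: (@lipschitz_continuous _ K) => s s'.
  have [C HC] := lC _ (addr_ge0 (mx_ge0 s) (mx_ge0 s')).
  have lmx t : l j t = l j (mx t) by rewrite /l [in RHS]mx_id.
  apply: (@dyadic_le _ _ (C + C)) => n.
  rewrite (lmx s) (lmx s').
  have := HC n.+1 j (mx s); rewrite mx_ge0 lerDl mx_ge0 => /(_ isT) h1.
  have := HC n.+1 j (mx s'); rewrite mx_ge0 lerDr mx_ge0 => /(_ isT) h2.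
  have h3 := @step_lip (u n) (@u_cont n) j (mx s) (mx s').
  have K0 : 0 <= K by apply: le_trans (FK 0 x0 j).
  have h4 := ler_wpM2l K0 (mx_lip s s').
  have h5 := ler_distD (u n.+1 j (mx s)) (l j (mx s)) (l j (mx s')).
  have h6 := ler_distD (u n.+1 j (mx s')) (u n.+1 j (mx s)) (l j (mx s')).
  rewrite (distrC (u n.+1 j (mx s'))) in h6.
  have h7 := normr_ge0 (l j (mx s) - u n.+1 j (mx s)).
  have h8 := normr_ge0 (l j (mx s') - u n.+1 j (mx s')).
  move: h1 h2 h3 h4 h5 h6 h7 h8; rewrite exprS mul1r /=.
  set p := 2^-1 ^+ n; lra.
have [v0 dv] := stepP l_cont.
have vl j (s : R) : 0 <= s -> step l j s = l j s.
  move=> s0; apply/eqP; rewrite -subr_eq0 -normr_le0.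
  have [C HC] := lC _ s0; have [L L0 FL'] := FL s0.
  apply: (@dyadic_le _ _ (L * (d%:R * C) * s + C)) => n.
  have [w0 dw] := stepP (@u_cont n).
  pose B := L * (d%:R * (C * 2^-1 ^+ n)).
  have h1 : `|step l j s - u n.+1 j s| <= B * s.
    have := @derive_norm_le _ (step l j \- u n.+1 j) (field l j \- field (u n) j)
      ( *%R B) (fun=> B) 0 s s0.
    rewrite /= v0 w0 subrr subr0 mulr0 subr0; apply.
    - by move=> y _; exact: is_derive_mull.
    - move=> y; apply: continuousB.
        exact: (@is_derive_within _ _ (field l j)).
      exact: (@is_derive_within _ _ (field (u n) j)).
    - by apply: (@is_derive_within _ _ (fun=> B)) => y _; exact: is_derive_mull.
    - move=> y /andP[y0 ys]; rewrite /field mx_id ?(ltW y0)//.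
      have yS : 0 <= y <= s by rewrite !ltW.
      apply: le_trans (FL' _ _ _ _ yS) _; rewrite /B ler_wpM2l//.
      rewrite mulr_natl -[in leRHS](card_ord d) -sumr_const.
      by apply: ler_sum => k _; exact: HC.
  have h2 := HC n.+1 j s; rewrite s0 lexx in h2.
  have h3 := ler_distD (u n.+1 j s) (step l j s) (l j s).
  rewrite (distrC (u n.+1 j s)) in h3.
  have h4 := normr_ge0 (l j s - u n.+1 j s).
  move: (h2 isT) h1 h3 h4; rewrite exprS /B.
  set p := 2^-1 ^+ n; lra.
exists (step l); split => // i s s0.
have := dv i s; rewrite /field mx_id//.
rewrite (_ : l ^~ s = (step l) ^~ s)//; apply/funext => j; by rewrite vl.
Qed.

End Picard.

Lemma cvg_sumr (R : realType) (I : finType) (T : Type) (F : set_system T)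
    (f : I -> T -> R) (l : I -> R) : Filter F ->
  (forall i, f i x @[x --> F] --> l i) ->
  \sum_i f i x @[x --> F] --> \sum_i l i.
Proof.
move=> FF fl; elim: (index_enum I) => [|i s IH].
  by rewrite big_nil; under eq_fun do rewrite big_nil; exact: cvg_cst.
by rewrite big_cons; under eq_fun do rewrite big_cons; exact: cvgD.
Qed.

(** * The velocity field: bounds, regularity and flow *)

Section Velocity.
Context (R : realType) (dO : measure_display) (Om : measurableType dO).
Variables (P : probability Om R) (d : nat) (e : 'I_d -> Om -> R) (K : R).
Implicit Types (x y : 'I_d -> R).
Hypothesis me : forall i, measurable_fun setT (e i).
Hypothesis K0 : 0 <= K.
Hypothesis eK : forall i w, `|e i w| <= K.

(** The log-likelihood ratio at x of the Gaussian law centred at s e(w) against the centred one. *)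
Definition tilt_exponent (s : R) x (w : Om) : R :=
  s * (\sum_i x i * e i w) - s ^+ 2 / 2 * (\sum_i e i w ^+ 2).

Definition velocity (s : R) x i : R := tilt P (tilt_exponent s x) (e i).

Lemma bounded_mfun_coord i : bounded_mfun (e i).
Proof. by split; [exact: me | exists K]. Qed.

Lemma bounded_mfun_exponent s x : bounded_mfun (tilt_exponent s x).
Proof.
apply: bounded_mfunB; apply: bounded_mfunZ; apply: bounded_mfun_sum => i.
  exact/bounded_mfunZ/bounded_mfun_coord.
under [X in bounded_mfun X]funext do rewrite expr2.
exact: bounded_mfunM (bounded_mfun_coord i) (bounded_mfun_coord i).
Qed.

Lemma velocity_norm_le s x i : `|velocity s x i| <= K.
Proof.
apply: tilt_norm_le => //; [exact: bounded_mfun_exponent|exact: bounded_mfun_coord].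
Qed.

(** The difference is s (X - Y) + (s - s') (Y - (s + s') Q / 2), where X and Y are the inner
    products with e and Q = |e|^2. With s = s' it yields the Lipschitz bound in space, with both
    varying the continuity in time. *)
Lemma tilt_exponent_dist s s' x y w :
  `|tilt_exponent s x w - tilt_exponent s' y w| <=
  `|s| * (K * \sum_i `|x i - y i|) +
  `|s - s'| * (K * \sum_i `|y i| + (`|s| + `|s'|) * (d%:R * K ^+ 2)).
Proof.
rewrite /tilt_exponent.
set Q := \sum_i e i w ^+ 2.
have Q0 : 0 <= Q by apply: sumr_ge0 => i _; exact: sqr_ge0.
have QK : Q <= d%:R * K ^+ 2.
  rewrite mulr_natl -[in leRHS](card_ord d) -sumr_const; apply: ler_sum => i _.
  by rewrite -real_normK ?num_real// lerXn2r// nnegrE.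
have h1 : `|\sum_i x i * e i w - \sum_i y i * e i w| <= K * \sum_i `|x i - y i|.
  rewrite -sumrB mulr_sumr; apply: le_trans (ler_norm_sum _ _ _) _.
  apply: ler_sum => i _; rewrite -mulrBl normrM mulrC.
  exact: ler_wpM2r.
have h2 : `|\sum_i y i * e i w| <= K * \sum_i `|y i|.
  rewrite mulr_sumr; apply: le_trans (ler_norm_sum _ _ _) _.
  by apply: ler_sum => i _; rewrite normrM mulrC; exact: ler_wpM2r.
set X := \sum_i x i * e i w in h1 *; set Y := \sum_i y i * e i w in h1 h2 *.
have -> : s * X - s ^+ 2 / 2 * Q - (s' * Y - s' ^+ 2 / 2 * Q) =
  s * (X - Y) + (s - s') * (Y - (s + s') / 2 * Q) by field.
apply: le_trans (ler_normD _ _) _; rewrite !normrM; apply: lerD.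
  exact: ler_wpM2l.
apply: ler_wpM2l => //; apply: le_trans (ler_normB _ _) _; apply: lerD => //.
rewrite !normrM (ger0_norm Q0) (ger0_norm (_ : 0 <= 2^-1 :> R))//.
have := ler_normD s s' => h; apply: ler_pM => //.
have := normr_ge0 (s + s'); lra.
Qed.

Lemma velocity_dist s s' x y i :
  `|velocity s x i - velocity s' y i| <= 4 * K *
  (`|s| * (K * \sum_i `|x i - y i|) +
  `|s - s'| * (K * \sum_i `|y i| + (`|s| + `|s'|) * (d%:R * K ^+ 2))).
Proof.
apply: tilt_dist => //; try exact: bounded_mfun_exponent.
  exact: bounded_mfun_coord.
by move=> w; exact: tilt_exponent_dist.
Qed.

Lemma velocity_lipschitz s x y i :
  `|velocity s x i - velocity s y i| <= 4 * K ^+ 2 * `|s| * \sum_i `|x i - y i|.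
Proof.
apply: le_trans (velocity_dist _ _ _ _ _) _.
rewrite subrr normr0 mul0r addr0 le_eqVlt; apply/orP; left; apply/eqP; ring.
Qed.

Lemma velocity_continuous (v : 'I_d -> R -> R) : (forall j, continuous (v j)) ->
  forall i, continuous (fun s => velocity s (v ^~ s) i).
Proof.
move=> cv i s.
apply/cvgrPdist_le => eps eps0.
pose g (r : R) := 4 * K *
  (`|r| * (K * \sum_i `|v i r - v i s|) +
  `|r - s| * (K * \sum_i `|v i s| + (`|r| + `|s|) * (d%:R * K ^+ 2))).
have g0 : g r @[r --> s] --> (0 : R).
  have -> : 0 = 4 * K * (`|s| * (K * \sum_(i < d) 0) +
    0 * (K * \sum_i `|v i s| + (`|s| + `|s|) * (d%:R * K ^+ 2))).
    by rewrite big1// !(mulr0,mul0r,addr0).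
  have cn : `|r| @[r --> s] --> `|s| by exact: norm_continuous.
  have dist0 (f : R -> R) : f r @[r --> s] --> f s ->
      `|f r - f s| @[r --> s] --> (0 : R).
    move=> cf; have H : (f r - f s) @[r --> s] --> f s - f s.
      by apply: cvgB => //; exact: cvg_cst.
    by have := cvg_norm H; rewrite subrr normr0; exact.
  apply: cvgM; first exact: cvg_cst.
  apply: cvgD.
    apply: cvgM => //; apply: cvgM; first exact: cvg_cst.
    apply: cvg_sumr => j; exact: dist0 (cv j s).
  apply: cvgM; first exact: dist0 cvg_id.
  apply: cvgD; first exact: cvg_cst.
  apply: cvgM; last exact: cvg_cst.
  by apply: cvgD => //; exact: cvg_cst.
near=> r; rewrite distrC; apply: le_trans (velocity_dist _ _ _ _ _) _.
rewrite -/(g r); apply: le_trans (ler_norm _) _.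
near: r; exact: (cvgr0Pnorm_le _).1 g0 _ eps0.
Unshelve. all: by end_near.
Qed.

Lemma velocity_flow x0 : exists v : 'I_d -> R -> R,
  (forall i, v i 0 = x0 i) /\
  forall i (s : R), 0 <= s -> is_derive s 1 (v i) (velocity s (v ^~ s) i).
Proof.
apply: (@picard _ _ velocity K).
- by move=> s x i; exact: velocity_norm_le.
- move=> S S0; exists (4 * K ^+ 2 * S).
    by rewrite !mulr_ge0// exprn_ge0.
  move=> s x y i /andP[s0 sS]; apply: le_trans (velocity_lipschitz _ _ _ _) _.
  apply: ler_wpM2r; first by rewrite sumr_ge0.
  by apply: ler_wpM2l; rewrite ?(ger0_norm s0)// mulr_ge0// exprn_ge0.
- exact: velocity_continuous.
Qed.

End Velocity.

(** * Integration against a measure given by a density *)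

Section Density.
Context d (T : measurableType d) (R : realType).
Variables (m mu : {measure set T -> \bar R}) (g : T -> R).
Hypothesis mg : measurable_fun setT g.
Hypothesis g0 : forall x, 0 <= g x.
Hypothesis mE : forall A, measurable A -> m A = (\int[mu]_(x in A) (g x)%:E)%E.
Import HBNNSimple.
Local Open Scope ereal_scope.

Lemma ge0_integral_density (f : T -> \bar R) :
  measurable_fun setT f -> (forall x, 0 <= f x) ->
  \int[m]_x f x = \int[mu]_x (f x * (g x)%:E).
Proof.
move=> mf f0.
pose f_ := nnsfun_approx measurableT mf.
have mgE : measurable_fun setT (fun x => (g x)%:E) by exact/measurable_EFinP.
transitivity (limn (fun n => \int[m]_x (f_ n x)%:E)).
  rewrite -monotone_convergence//.
  - apply: eq_integral => y _; apply/esym/cvg_lim => //.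
    by apply: cvg_nnsfun_approx => // *; apply: f0.
  - by move=> n; exact/measurable_EFinP.
  - by move=> n y _; rewrite lee_fin.
  - by move=> y _ a b ab; rewrite lee_fin; exact/lefP/nd_nnsfun_approx.
transitivity (limn (fun n => \int[mu]_x ((f_ n x)%:E * (g x)%:E))); last first.
  rewrite -monotone_convergence//.
  - apply: eq_integral => y _; apply/cvg_lim => //.
    apply: cvgeZr => //; apply: cvg_nnsfun_approx => // *; exact: f0.
  - by move=> n; apply: emeasurable_funM => //; exact/measurable_EFinP.
  - by move=> n y _; rewrite mule_ge0 ?lee_fin.
  - move=> y _ a b ab; rewrite lee_wpmul2r ?lee_fin//.
    exact/lefP/nd_nnsfun_approx.
congr (limn _); apply/funext => n.
under eq_integral do rewrite fimfunE -fsumEFin//.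
rewrite ge0_integral_fsum//; last 2 first.
- by move=> r; exact/measurable_EFinP/measurableT_comp.
- by move=> k x _; rewrite EFinM nnfun_muleindic_ge0.
under [RHS]eq_integral.
  move=> x _; rewrite fimfunE -fsumEFin// ge0_mule_fsuml; last first.
    by move=> r; rewrite EFinM nnfun_muleindic_ge0.
  over.
rewrite [RHS]ge0_integral_fsum//; last 2 first.
- move=> r; apply: emeasurable_funM => //.
  by apply/measurable_EFinP; exact/measurableT_comp.
- by move=> k x _; rewrite mule_ge0 ?lee_fin// -lee_fin EFinM nnfun_muleindic_ge0.
apply: eq_fsbigr => r rf.
have r0 : (0 <= r)%R.
  by move: rf; rewrite inE => -[x _ <-].
under [RHS]eq_integral do rewrite EFinM -muleA.
have mI : measurable (f_ n @^-1` [set r]) by [].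
rewrite integralZl_indic_nnsfun// integral_indic// setIT mE//.
rewrite ge0_integralZl//.
- congr (_ * _); rewrite integral_mkcond; apply: eq_integral => x _.
  by rewrite patchE indicE; case: ifP => _; rewrite ?mul1e ?mul0e.
- by apply: emeasurable_funM => //; exact/measurable_EFinP.
- by move=> x _; rewrite mule_ge0 ?lee_fin.
Qed.

End Density.

(** * Gaussian integrals *)

Section LebesgueAffine.
Variable R : realType.
Local Notation mu := (@lebesgue_measure R).
Local Open Scope ereal_scope.

(** Lebesgue measure equals s times its image under x -> s x + a, since the two agree on half-open
    intervals; the change of variables is then integration against an image measure. *)
Lemma ge0_integral_affine (s a : R) (f : R -> \bar R) : (0 < s)%R ->
  measurable_fun setT f -> (forall x, 0 <= f x) ->
  \int[mu]_x f (s * x + a)%R = (s^-1)%:E * \int[mu]_x f x.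
Proof.
move=> s0 mf f0.
pose phi (x : R) : measurableTypeR R := (s * x + a)%R.
have mphi : measurable_fun setT phi.
  by apply: measurable_funD => //; exact: measurable_funM.
pose si : {nonneg R} := NngNum (ltW s0).
have H A : measurable A -> mu A = mscale si (pushforward mu phi) A.
  move=> mA; apply: lebesgue_measure_unique => //= _ [[u v]] _ <-.
  have E : phi @^-1` [set` `]u, v]] = [set` `](u - a) / s, (v - a) / s]]%R.
    by apply/seteqP; split => x /=; rewrite !in_itv/= /phi
      ltr_pdivrMr// ler_pdivlMr// mulrC ltrBlDr lerBrDr.
  have -> : mscale si (pushforward mu phi) `]u, v]%classic =
      s%:E * mu `]((u - a) / s)%R, ((v - a) / s)%R]%classic.
    by rewrite -E.
  rewrite !lebesgue_measure_itv/= !lte_fin ltr_pM2r ?invr_gt0// ltrBDr subrK.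
  case: ifP => _; last by rewrite mule0.
  by rewrite -!EFinB -EFinM; congr EFin; field; rewrite gt_eqF.
rewrite [in RHS](eq_measure_integral (mscale si (pushforward mu phi))) => [|A mA _]; last exact: H.
rewrite ge0_integral_mscale// ge0_integral_pushforward//.
by rewrite muleA -EFinM mulVf ?gt_eqF// mul1e preimage_setT.
Qed.

End LebesgueAffine.

Section Normal.
Variable R : realType.
Local Notation mu := (@lebesgue_measure R).
Local Notation N01 := (normal_prob (0 : R) 1).
Local Notation p := (normal_pdf (0 : R) 1).

Lemma measurable_addr (b : R) : measurable_fun [set: R] (fun x : R => x + b).
Proof. exact: measurable_funD. Qed.

Lemma std_normal_pdfE (x : R) : p x = normal_peak 1 * expR (- (x ^+ 2 / 2)).
Proof.
rewrite normal_pdfE ?oner_neq0// /normal_fun subr0 expr1n mulNr; congr (_ * expR (- (_ / _))).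
Qed.

Lemma std_normal_pdf_translate (a x : R) : p (x - a) = p x * expR (a * x - a ^+ 2 / 2).
Proof.
rewrite !std_normal_pdfE -[RHS]mulrA -expRD; congr (_ * expR _); by field.
Qed.

Lemma ge0_integral_std_normal (f : R -> \bar R) :
  measurable_fun setT f -> (forall x, 0 <= f x)%E ->
  (\int[N01]_x f x = \int[mu]_x (f x * (p x)%:E))%E.
Proof.
move=> mf f0; apply: (@ge0_integral_density _ (measurableTypeR R) R N01 mu) => //.
- exact: measurable_normal_pdf.
- exact: normal_pdf_ge0.
Qed.

(** Cameron-Martin in dimension 1: translate the Lebesgue integral, then factor p(x - a) into p(x)
    and the exponential weight. *)
Lemma std_normal_translate (a : R) (f : R -> \bar R) :
  measurable_fun setT f -> (forall x, 0 <= f x)%E ->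
  (\int[N01]_x f (x + a)%R =
   \int[N01]_x (f x * (expR (a * x - a ^+ 2 / 2))%:E))%E.
Proof.
move=> mf f0.
have me : measurable_fun [set: R] (fun x : R => expR (a * x - a ^+ 2 / 2)).
  by apply: measurableT_comp => //; apply: measurable_funB => //.
have mp : measurable_fun [set: R] (fun x : R => (p x)%:E).
  apply/measurable_EFinP; exact: measurable_normal_pdf.
have mp' (b : R) : measurable_fun [set: R] (fun x : R => (p (x + b))%:E).
  apply/measurable_EFinP.
  exact: (measurableT_comp (measurable_normal_pdf 0 1) (measurable_addr b)).
rewrite ge0_integral_std_normal//; last first.
  exact: (measurableT_comp mf (measurable_addr a)).
rewrite ge0_integral_std_normal//; last 2 first.
- by apply: emeasurable_funM => //; exact/measurable_EFinP.
- by move=> x; rewrite mule_ge0// lee_fin expR_ge0.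
pose h (x : R) : \bar R := (f x * (p (x - a))%:E)%E.
have := @ge0_integral_affine R 1 a h ltr01; rewrite invr1 mul1e => H.
transitivity (\int[mu]_x h (1 * x + a)%R)%E.
  by apply: eq_integral => x _; rewrite /h mul1r addrK.
rewrite H; last 2 first.
- exact: emeasurable_funM.
- by move=> x; apply: mule_ge0; [exact: f0|rewrite lee_fin normal_pdf_ge0].
apply: eq_integral => x _; rewrite /h std_normal_pdf_translate EFinM.
by rewrite muleA muleAC.
Qed.

Lemma std_normal_scale (s : R) (f : R -> \bar R) : 0 < s ->
  measurable_fun setT f -> (forall x, 0 <= f x)%E ->
  (\int[N01]_x f (s * x)%R =
   \int[mu]_x (f x * (s^-1 * p (x / s))%:E))%E.
Proof.
move=> s0 mf f0.
have mp' (b : R) : measurable_fun [set: R] (fun x : R => (p (x / b))%:E).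
  apply/measurable_EFinP.
  apply: (measurableT_comp (measurable_normal_pdf 0 1)).
  exact: measurable_funM.
rewrite ge0_integral_std_normal//; last first.
  by apply: (measurableT_comp mf); exact: measurable_funM.
pose h (x : R) : \bar R := (f x * (p (x / s))%:E)%E.
have mh : measurable_fun [set: R] h by exact: emeasurable_funM.
have h0 x : (0 <= h x)%E by rewrite mule_ge0// lee_fin normal_pdf_ge0.
transitivity (\int[mu]_x h (s * x + 0)%R)%E.
  apply: eq_integral => x _; rewrite /h addr0.
  by rewrite [(s * x / s)%R]mulrAC divff ?gt_eqF// mul1r.
rewrite ge0_integral_affine// -ge0_integralZl//; last by rewrite lee_fin invr_ge0 ltW.
by apply: eq_integral => x _; rewrite /h EFinM muleCA.
Qed.

End Normal.

Section Gauss.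
Variable R : realType.
Local Notation N01 := (normal_prob (0 : R) 1).

Definition gauss_cons n (z : measurableTypeR R * n.-tuple R) : n.+1.-tuple R :=
  [the n.+1.-tuple R of z.1 :: z.2].

Lemma measurable_gauss_cons n : measurable_fun setT (@gauss_cons n).
Proof. exact: measurable_cons. Qed.

Lemma measurable_gauss_cons_section n (x : R) :
  measurable_fun setT (fun t : n.-tuple R => gauss_cons (x, t)).
Proof. exact: (measurable_cons (measurable_cst x) (@measurable_id _ _ setT)). Qed.

HB.instance Definition _ n :=
  isMeasurableFun.Build _ _ _ _ (@gauss_cons n) (@measurable_gauss_cons n).

(** The standard Gaussian law on tuples, built one leading coordinate at a time like [iint], so that
    the two are compared by induction on the dimension. *)
Fixpoint gauss n : probability (n.-tuple R) R :=
  match n with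
  | 0 => \d_([tuple] : 0.-tuple R)
  | m.+1 => distribution (N01 \x gauss m)%E (@gauss_cons m)
  end.

Lemma gauss_cons_eta n (t : n.+1.-tuple R) :
  t = gauss_cons (tnth t ord0, [tuple tnth t (lift ord0 i) | i < n]).
Proof.
apply: eq_from_tnth => i; case: (unliftP ord0 i) => [j ->|->].
  by rewrite tnthS tnth_mktuple.
by rewrite tnth0.
Qed.

Lemma ge0_integral_gauss0 (F : 0.-tuple R -> \bar R) :
  (\int[gauss 0]_x F x = F [tuple])%E.
Proof.
rewrite (_ : F = cst (F [tuple])); last by apply/funext => x; rewrite [x]tuple0.
by rewrite /= integral_dirac//; rewrite diracE mem_set// mul1e.
Qed.

Lemma ge0_integral_gaussS n (F : n.+1.-tuple R -> \bar R) :
  measurable_fun setT F -> (forall x, 0 <= F x)%E ->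
  (\int[gauss n.+1]_x F x =
   \int[N01]_x \int[gauss n]_t F (gauss_cons (x, t)))%E.
Proof.
move=> mF F0; rewrite [gauss n.+1]/= ge0_integral_distribution//.
have mFc : measurable_fun setT (F \o @gauss_cons n).
  exact: (measurableT_comp mF (@measurable_gauss_cons n)).
by rewrite fubini_tonelli1 => [//|//|z]; exact: F0.
Qed.

Lemma measurable_box n (A : 'I_n -> set R) : (forall i, measurable (A i)) ->
  measurable [set t : n.-tuple R | forall i, A i (tnth t i)].
Proof.
move=> mA.
rewrite (_ : [set t | _] = \bigcap_(i in [set: 'I_n]) ((fun t : n.-tuple R => tnth t i) @^-1` A i)).
  apply: fin_bigcap_measurable => // i _.
  by rewrite -[X in measurable X]setTI; exact: measurable_tnth.
by apply/seteqP; split => t /=; [move=> At i _; exact: At|move=> At i; exact: At].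
Qed.

Lemma gauss_box n (A : 'I_n -> set R) : (forall i, measurable (A i)) ->
  gauss n [set t | forall i, A i (tnth t i)] = (\prod_(i < n) N01 (A i))%E.
Proof.
elim: n A => [|n IH] A mA.
  rewrite big_ord0 /= diracE mem_set//=; by case.
rewrite big_ord_recl -IH//.
have mB := measurable_box (fun i => mA (lift ord0 i)).
rewrite -[RHS](product_measure1E N01 (gauss n) (mA ord0) mB).
rewrite /= /distribution /pushforward; congr ((N01 \x gauss n)%E _).
apply/seteqP; split => -[x t] /= H.
  split; first by have := H ord0; rewrite tnth0.
  by move=> i; have := H (lift ord0 i); rewrite tnthS.
by case: H => H0 H i; case: (unliftP ord0 i) => [j ->|->]; rewrite ?tnthS ?tnth0.
Qed.

Lemma measurable_tuple_map m (T : measurableType m) n (f : 'I_n -> T -> R) :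
  (forall i, measurable_fun setT (f i)) ->
  measurable_fun setT (fun x => [tuple f i x | i < n]).
Proof.
move=> mf; apply/measurable_fun_tnthP => i.
by rewrite (_ : _ \o _ = f i)//; apply/funext => x /=; rewrite tnth_mktuple.
Qed.

Lemma measurable_gauss_weight n (a : 'I_n -> R) : measurable_fun setT
  (fun t : n.-tuple R => expR (\sum_i a i * tnth t i - 2^-1 * \sum_i a i ^+ 2)).
Proof.
apply: measurableT_comp => //; apply: measurable_funB => //.
apply: measurable_sum => i; apply: measurable_funM => //; exact: measurable_tnth.
Qed.

(** The n-dimensional Cameron-Martin formula: the induction hypothesis translates the tail inside
    the integral over the head, and the one-dimensional case then translates the head. *)
Lemma gauss_translate n (a : 'I_n -> R) (F : n.-tuple R -> \bar R) :
  measurable_fun setT F -> (forall x, 0 <= F x)%E ->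
  (\int[gauss n]_x F [tuple (tnth x i + a i)%R | i < n] =
   \int[gauss n]_x (F x *
     (expR (\sum_i a i * tnth x i - 2^-1 * \sum_i a i ^+ 2))%:E))%E.
Proof.
elim: n a F => [|n IH] a F mF F0.
  rewrite !ge0_integral_gauss0 !big_ord0 mulr0 subr0 expR0 mule1; congr F.
  exact: tuple0.
pose a' i := a (lift ord0 i).
pose E (t : n.-tuple R) := expR (\sum_i a' i * tnth t i - 2^-1 * \sum_i a' i ^+ 2).
have mE : measurable_fun setT E by exact: measurable_gauss_weight.
pose g (x : R) := (\int[gauss n]_t (F (gauss_cons (x, t)) * (E t)%:E))%E.
have mFE : measurable_fun setT (fun z : measurableTypeR R * n.-tuple R =>
    F (gauss_cons z) * (E z.2)%:E)%E.
  apply: emeasurable_funM; first exact: (measurableT_comp mF (@measurable_gauss_cons n)).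
  by apply/measurable_EFinP; exact: (measurableT_comp mE measurable_snd).
have mg : measurable_fun setT g.
  apply: (measurable_fun_fubini_tonelli_F (m2 := gauss n) _ mFE) => z.
  by rewrite mule_ge0// lee_fin expR_ge0.
have g0 x : (0 <= g x)%E.
  by apply: integral_ge0 => t _; rewrite mule_ge0// lee_fin expR_ge0.
rewrite ge0_integral_gaussS//; last first.
  apply: (measurableT_comp mF); apply: measurable_tuple_map => i.
  apply: measurable_funD => //; exact: measurable_tnth.
transitivity (\int[N01]_x g (x + a ord0)%R)%E.
  apply: eq_integral => x _; rewrite /g.
  rewrite -(IH a' (fun t => F (gauss_cons (x + a ord0, t))))//.
  - apply: eq_integral => t _; congr F; rewrite [LHS]gauss_cons_eta; congr gauss_cons.
    congr pair; first by rewrite tnth_mktuple tnth0.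
    by apply: eq_from_tnth => i; rewrite !tnth_mktuple tnthS.
  - exact: (measurableT_comp mF (measurable_gauss_cons_section _)).
rewrite std_normal_translate// ge0_integral_gaussS//; last 2 first.
- apply: emeasurable_funM => //; apply/measurable_EFinP.
  exact: measurable_gauss_weight.
- by move=> x; rewrite mule_ge0// lee_fin expR_ge0.
apply: eq_integral => x _; rewrite /g -ge0_integralZr//.
- apply: eq_integral => t _; rewrite -muleA -EFinM; congr (_ * (_)%:E)%E.
  rewrite /E -expRD; congr expR; rewrite !big_ord_recl tnth0 /a' /=.
  under [in RHS]eq_bigr do rewrite tnthS.
  by field.
- apply: emeasurable_funM; last exact/measurable_EFinP.
  exact: (measurableT_comp mF (measurable_gauss_cons_section _)).
- by move=> t _; rewrite mule_ge0// lee_fin expR_ge0.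
Qed.

End Gauss.
Arguments gauss_cons {R n} z.

(** * A class of boxes that determines finite measures on tuples *)

Section TupleMeasure.
Variables (R : realType) (n : nat).

(** These boxes form a generating pi-system, and each indicator is a limit of Lipschitz functions,
    which is all that the chain argument can test against. *)
Definition upper_box (c : 'I_n -> R) : set (n.-tuple R) :=
  [set t | forall i, c i <= tnth t i].

Definition upper_boxes : set (set (n.-tuple R)) := range upper_box.

Lemma measurable_upper_box c : measurable (upper_box c).
Proof.
rewrite (_ : upper_box c = [set t | forall i, `[c i, +oo[%classic (tnth t i)]).
  by apply: (@measurable_box R n (fun i => `[c i, +oo[%classic)) => i; exact: measurable_itv.
by apply/seteqP; split => t H i; have := H i; rewrite /= in_itv/= andbT.
Qed.

Lemma ex_nat_lower (x : 'I_n -> R) : exists k : nat, forall i, - k%:R <= x i.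
Proof.
exists (\max_i Num.truncn `|x i|).+1 => i.
rewrite lerNl; apply: le_trans (ler_norm _) _; rewrite normrN ltW//.
apply: lt_le_trans (truncnS_gt _) _.
by rewrite ler_nat ltnS; exact: (leq_bigmax i).
Qed.

Lemma upper_box_cover :
  \bigcup_k upper_box (fun=> - (k%:R : R)) = [set: n.-tuple R].
Proof.
apply/seteqP; split => // t _.
by have [k Hk] := ex_nat_lower (tnth t); exists k.
Qed.

Lemma measurable_tuple_upper_boxes :
  (@measurable _ (n.-tuple R)) = <<s upper_boxes >>.
Proof.
apply/seteqP; split; last first.
  apply: smallest_sub; first exact: sigma_algebra_measurable.
  by move=> _ [c _ <-]; exact: measurable_upper_box.
apply: smallest_sub; first exact: smallest_sigma_algebra.
move=> B; rewrite -bigcup_seq => -[i _ [A mA <-]]; rewrite setTI.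
pose T := g_sigma_algebraType upper_boxes.
have mi : measurable_fun [set: T] ((fun t => tnth t i) : T -> measurableTypeR R).
  apply: (@measurability _ _ T (measurableTypeR R) setT (fun t => tnth t i) _ (RGenCInfty.measurableE R)).
  move=> _ [_ [x ->] <-]; rewrite setTI.
  (* A half-line condition on coordinate i alone is a countable union of boxes whose other bounds go
     down to minus infinity. *)
  rewrite (_ : _ @^-1` _ =
      \bigcup_(k : nat) upper_box (fun j => if j == i then x else - k%:R)).
    apply: bigcupT_measurable => k; apply: sub_sigma_algebra.
    by eexists.
  apply/seteqP; split => t /=.
    rewrite in_itv/= andbT => xt.
    have [k Hk] := ex_nat_lower (tnth t); exists k => // j /=.
    by case: eqP => [->|].
  by move=> [k _ /(_ i)]; rewrite eqxx in_itv/= andbT.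
by rewrite -[X in _ X]setTI; exact: mi.
Qed.

(** Two boxes meet in the box whose corner is the coordinatewise maximum, and the boxes with all
    bounds equal to -k exhaust the space. *)
Lemma tuple_measure_unique (m1 m2 : {measure set (n.-tuple R) -> \bar R}) :
  (m1 setT < +oo)%E -> (forall c, m1 (upper_box c) = m2 (upper_box c)) ->
  forall A, measurable A -> m1 A = m2 A.
Proof.
move=> moo H A mA.
apply: (measure_unique upper_boxes (fun k => upper_box (fun=> - k%:R))) => //.
- exact: measurable_tuple_upper_boxes.
- move=> _ _ [c _ <-] [c' _ <-]; exists (fun i => Num.max (c i) (c' i)) => //.
  apply/seteqP; split => t /=.
    by move=> ct; split => i; have := ct i; rewrite ge_max => /andP[].
  by move=> [h1 h2] i; rewrite ge_max h1 h2.
- by move=> k; exists (fun=> - k%:R).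
- exact: upper_box_cover.
- by move=> _ [c _ <-]; exact: H.
- move=> k; apply: le_lt_trans moo; apply: le_measure => //; rewrite inE//.
  exact: measurable_upper_box.
Qed.

End TupleMeasure.

Section GaussScale.
Variable R : realType.
Local Notation N01 := (normal_prob (0 : R) 1).
Local Notation p := (normal_pdf (0 : R) 1).

Lemma gauss_scale n (s : R) (F : n.-tuple R -> \bar R) : 0 < s ->
  measurable_fun setT F -> (forall x, 0 <= F x)%E ->
  (\int[gauss R n]_x F [tuple (s * tnth x i)%R | i < n] =
   iint (fun x => F x * (\prod_i (s^-1 * p (tnth x i / s)))%:E))%E.
Proof.
move=> s0; elim: n F => [|n IH] F mF F0.
  rewrite ge0_integral_gauss0 /= big_ord0 mule1; congr F; exact: tuple0.
have ms : measurable_fun setT (fun t : n.-tuple R => [tuple s * tnth t i | i < n]).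
  apply: measurable_tuple_map => i; apply: measurable_funM => //.
  exact: measurable_tnth.
pose g (x : R) := (\int[gauss R n]_t F (gauss_cons (x, [tuple (s * tnth t i)%R | i < n])))%E.
have mg : measurable_fun setT g.
  apply: (measurable_fun_fubini_tonelli_F (m2 := gauss R n)
    (fun z : measurableTypeR R * n.-tuple R =>
     F (gauss_cons (z.1, [tuple (s * tnth z.2 i)%R | i < n])))) => //.
  have mz : measurable_fun setT (fun z : measurableTypeR R * n.-tuple R =>
      (z.1, [tuple s * tnth z.2 i | i < n])).
    exact: (measurable_fun_pair measurable_fst (measurableT_comp ms measurable_snd)).
  exact: (measurableT_comp mF (measurableT_comp (@measurable_gauss_cons R n) mz)).
have g0 x : (0 <= g x)%E by apply: integral_ge0.
rewrite ge0_integral_gaussS//; last first.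
  apply: (measurableT_comp mF); apply: measurable_tuple_map => i.
  apply: measurable_funM => //; exact: measurable_tnth.
transitivity (\int[N01]_x g (s * x)%R)%E.
  apply: eq_integral => x _; apply: eq_integral => t _; congr F.
  rewrite [LHS]gauss_cons_eta; congr gauss_cons; congr pair.
    by rewrite tnth_mktuple tnth0.
  by apply: eq_from_tnth => i; rewrite !tnth_mktuple tnthS.
rewrite std_normal_scale//=; apply: eq_integral => x _.
rewrite /g -ge0_integralZr//; last 2 first.
- by apply: (measurableT_comp mF); apply: (measurableT_comp (measurable_gauss_cons_section x)).
- by rewrite lee_fin mulr_ge0 ?normal_pdf_ge0 ?invr_ge0// ltW.
have c0 : 0 <= s^-1 * p (x / s) by rewrite mulr_ge0 ?normal_pdf_ge0 ?invr_ge0// ltW.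
(* The density of the head is constant in the tail, so it is absorbed into the integrand before the
   induction hypothesis is used. *)
rewrite (IH (fun t => F (gauss_cons (x, t)) * (s^-1 * p (x / s))%:E)%E).
- congr iint; apply/funext => t; rewrite -muleA -EFinM; congr (_ * (_)%:E)%E.
  by rewrite big_ord_recl tnth0; congr (_ * _); apply: eq_bigr => i _; rewrite tnthS.
- apply: emeasurable_funM; last exact: measurable_cst.
  exact: (measurableT_comp mF (measurable_gauss_cons_section x)).
- by move=> t; rewrite mule_ge0.
Qed.

End GaussScale.

(** * The joint law of Y_0 and eta, and the law of their combinations *)

Section Joint.
Context (R : realType) (dO : measure_display) (Om : measurableType dO).
Variables (P : probability Om R) (d : nat) (X E : Om -> d.-tuple R).
Hypothesis mX : measurable_fun setT X.
Hypothesis mE : measurable_fun setT E.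
Local Notation N01 := (normal_prob (0 : R) 1).
Hypothesis XE_indep : forall (A : 'I_d -> set R) (B : set (d.-tuple R)),
  (forall i, measurable (A i)) -> measurable B ->
  P ([set w | forall i, A i (tnth (X w) i)] `&` E @^-1` B) =
  ((\prod_(i < d) N01 (A i)) * P (E @^-1` B))%E.

(** Independence is assumed for boxes in the first variable. For fixed B both sides are finite
    measures in A that agree on upper boxes, hence everywhere. *)
Lemma joint_rectangle A B : measurable A -> measurable B ->
  P (X @^-1` A `&` E @^-1` B) = (gauss R d A * P (E @^-1` B))%E.
Proof.
move=> mA mB.
have mEB : measurable (E @^-1` B) by rewrite -[X in measurable X]setTI; exact: mE.
have fb : P (E @^-1` B) \is a fin_num by exact: fin_num_measure.
pose b : {nonneg R} := NngNum (fine_ge0 (measure_ge0 P (E @^-1` B))).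
have bE : P (E @^-1` B) = b%:num%:E by rewrite /= fineK.
have := @tuple_measure_unique R d (pushforward (mrestr P mEB) X) (mscale b (gauss R d)).
move=> /(_ mX) H.
rewrite bE muleC -[RHS]/(mscale b (gauss R d) A) -H//.
- apply: le_lt_trans (ltry 1); rewrite -[leLHS]/(P (setT `&` E @^-1` B)) setTI.
  exact: probability_le1.
- move=> c; rewrite -[LHS]/(P (X @^-1` upper_box c `&` E @^-1` B)).
  rewrite -[RHS]/(b%:num%:E * gauss R d (upper_box c))%E -bE muleC.
  have -> : upper_box c = [set t | forall i, `[c i, +oo[%classic (tnth t i)].
    by apply/seteqP; split => t ct i; have := ct i; rewrite /= in_itv/= andbT.
  rewrite (@gauss_box R d (fun i => `[c i, +oo[%classic)); last first.
    by move=> i; exact: measurable_itv.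
  rewrite -XE_indep//.
Qed.

(** Rectangles determine the law of the pair, which is therefore a product measure, and Tonelli
    applies. *)
Lemma ge0_integral_joint (F : d.-tuple R * d.-tuple R -> \bar R) :
  measurable_fun setT F -> (forall z, 0 <= F z)%E ->
  (\int[P]_w F (X w, E w) = \int[P]_w \int[gauss R d]_x F (x, E w))%E.
Proof.
move=> mF F0.
have mXE : measurable_fun setT (fun w => (X w, E w)) by exact: measurable_fun_pair.
pose XE : {mfun Om >-> (d.-tuple R * d.-tuple R)%type} :=
  HB.pack (fun w => (X w, E w)) (isMeasurableFun.Build _ _ _ _ _ mXE).
pose E' : {mfun Om >-> d.-tuple R} := HB.pack E (isMeasurableFun.Build _ _ _ _ _ mE).
rewrite -[LHS](@ge0_integral_distribution _ _ _ _ _ P XE F)//.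
rewrite (eq_measure_integral (gauss R d \x distribution P E')%E); last first.
  move=> A mA _; apply/esym.
  apply: (@product_measure_unique _ _ _ _ R (gauss R d) (distribution P E')) => //.
  by move=> U V mU mV; rewrite -[RHS](joint_rectangle mU mV).
rewrite fubini_tonelli2//.
rewrite (@ge0_integral_distribution _ _ _ _ _ P E')//.
  exact: measurable_fun_fubini_tonelli_G.
by move=> y; exact: integral_ge0.
Qed.

Let e (i : 'I_d) (w : Om) : R := tnth (E w) i.

Let me i : measurable_fun setT (e i).
Proof. exact: (measurableT_comp (measurable_tnth i) mE). Qed.

Definition shift_tuple (h : R) (x y : d.-tuple R) : d.-tuple R :=
  [tuple tnth x i + h * tnth y i | i < d].

Lemma shift_tupleD s h x y : shift_tuple h (shift_tuple s x y) y = shift_tuple (s + h) x y.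
Proof. by apply: eq_from_tnth => i; rewrite !tnth_mktuple; ring. Qed.

Lemma measurable_shift_tuple m (T : measurableType m) (h : R) (f g : T -> d.-tuple R) :
  measurable_fun setT f -> measurable_fun setT g ->
  measurable_fun setT (fun x => shift_tuple h (f x) (g x)).
Proof.
move=> mf mg; apply: measurable_tuple_map => i; apply: measurable_funD.
  exact: (measurableT_comp (measurable_tnth i) mf).
apply: measurable_funM => //; exact: (measurableT_comp (measurable_tnth i) mg).
Qed.

Lemma measurable_tilt_exponent (s : R) : measurable_fun setT
  (fun z : d.-tuple R * Om => tilt_exponent e s (tnth z.1) z.2).
Proof.
have m1 i : measurable_fun setT (fun z : d.-tuple R * Om => tnth z.1 i).
  exact: (measurableT_comp (measurable_tnth i) measurable_fst).
have m2 i : measurable_fun setT (fun z : d.-tuple R * Om => e i z.2).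
  exact: (measurableT_comp (me i) measurable_snd).
apply: measurable_funB; apply: measurable_funM => //; apply: measurable_sum => i.
  exact: measurable_funM.
exact: measurable_funX.
Qed.

Lemma gauss_shift (s : R) (w : Om) (F : d.-tuple R -> \bar R) :
  measurable_fun setT F -> (forall x, 0 <= F x)%E ->
  (\int[gauss R d]_x F (shift_tuple s x (E w)) =
   \int[gauss R d]_x (F x * (expR (tilt_exponent e s (tnth x) w))%:E))%E.
Proof.
move=> mF F0.
have -> := gauss_translate (fun i => s * tnth (E w) i) mF F0.
apply: eq_integral => x _; congr (_ * (expR _)%:E)%E.
rewrite /tilt_exponent !mulr_sumr; congr (_ - _); apply: eq_bigr => i _; rewrite /e; by field.
Qed.

(** The density of X + s E with respect to the Gaussian law is the mass of the tilt, that is, the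
    normalising constant of the posterior at x. *)
Lemma ge0_integral_shift (s : R) (F : d.-tuple R -> \bar R) :
  measurable_fun setT F -> (forall x, 0 <= F x)%E ->
  (\int[P]_w F (shift_tuple s (X w) (E w)) =
   \int[gauss R d]_x (F x * \int[P]_w (expR (tilt_exponent e s (tnth x) w))%:E))%E.
Proof.
move=> mF F0.
have mexp : measurable_fun setT (fun z : d.-tuple R * Om =>
    (expR (tilt_exponent e s (tnth z.1) z.2))%:E).
  by apply/measurable_EFinP; apply: measurableT_comp => //; exact: measurable_tilt_exponent.
rewrite (@ge0_integral_joint (fun z => F (shift_tuple s z.1 z.2)))//; last first.
  by apply: (measurableT_comp mF); apply: measurable_shift_tuple.
under eq_integral do rewrite gauss_shift//.
rewrite -(fubini_tonelli (m1 := gauss R d) (m2 := P)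
  (fun z => F z.1 * (expR (tilt_exponent e s (tnth z.1) z.2))%:E)%E).
- apply: eq_integral => x _; rewrite -ge0_integralZl//.
  exact: (measurable_fun_pair2 x mexp).
- apply: emeasurable_funM => //.
  exact: (measurableT_comp mF measurable_fst).
- by move=> z; rewrite mule_ge0// lee_fin expR_ge0.
Qed.

End Joint.

(** * The law of the rescaled flow *)

Section Chain.
Context (R : realType) (dO : measure_display) (Om : measurableType dO).
Variables (P : probability Om R) (d : nat) (X E : Om -> d.-tuple R) (K : R).
Hypothesis mX : measurable_fun setT X.
Hypothesis mE : measurable_fun setT E.
Hypothesis K0 : 0 <= K.
Local Notation N01 := (normal_prob (0 : R) 1).
Hypothesis XE_indep : forall (A : 'I_d -> set R) (B : set (d.-tuple R)),
  (forall i, measurable (A i)) -> measurable B ->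
  P ([set w | forall i, A i (tnth (X w) i)] `&` E @^-1` B) =
  ((\prod_(i < d) N01 (A i)) * P (E @^-1` B))%E.

Let e (i : 'I_d) (w : Om) : R := tnth (E w) i.
Hypothesis eK : forall i w, `|tnth (E w) i| <= K.

Let me i : measurable_fun setT (e i).
Proof. exact: (measurableT_comp (measurable_tnth i) mE). Qed.

Let bexp s x : bounded_mfun (tilt_exponent e s x).
Proof. exact: bounded_mfun_exponent eK _ _. Qed.

(* Transition operator of the chain that moves from [x] to [x + h * eta], with
   [eta] drawn from its posterior law given [Y0 + s * eta = x]. *)
Definition posterior_step (s h : R) (f : d.-tuple R -> R) (x : d.-tuple R) : R :=
  tilt P (tilt_exponent (fun i w => tnth (E w) i) s (tnth x)) (fun w => f (shift_tuple h x (E w))).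

(** Values in [0,1] are preserved by a Markov operator, nonnegative for Tonelli and bounded for
    dominated convergence. *)
Definition unit_mfun (f : d.-tuple R -> R) :=
  measurable_fun setT f /\ forall x, 0 <= f x <= 1.

Let bshift h x f : unit_mfun f -> bounded_mfun (fun w => f (shift_tuple h x (E w))).
Proof.
move=> [mf f01]; split.
  by apply: (measurableT_comp mf); apply: measurable_shift_tuple.
by exists 1 => w; have /andP[f0 f1] := f01 (shift_tuple h x (E w)); rewrite ger0_norm.
Qed.

Let mexp s : measurable_fun setT (fun z : d.-tuple R * Om =>
    expR (tilt_exponent e s (tnth z.1) z.2)).
Proof. by apply: measurableT_comp => //; exact: measurable_tilt_exponent. Qed.

Let mshift f h : unit_mfun f -> measurable_fun setT (fun z : d.-tuple R * Om =>
  f (shift_tuple h z.1 (E z.2))).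
Proof.
move=> [mf _]; apply: (measurableT_comp mf); apply: measurable_shift_tuple => //.
exact: (measurableT_comp mE measurable_snd).
Qed.

Lemma measurable_param_Rintegral (G : d.-tuple R * Om -> R) :
  measurable_fun setT G -> (forall z, 0 <= G z) ->
  measurable_fun setT (fun x => Rintegral P setT (fun w => G (x, w))).
Proof.
move=> mG G0; apply: (@measurableT_comp _ _ _ _ _ _ (@fine R)) => //.
by apply: (measurable_fun_fubini_tonelli_F (m2 := P) (EFin \o G)) => //=; exact/measurable_EFinP.
Qed.

Lemma unit_mfun_posterior_step s h f : unit_mfun f -> unit_mfun (posterior_step s h f).
Proof.
move=> uf; split.
  apply: measurable_funM.
    apply: (@measurable_param_Rintegral (fun z =>
      f (shift_tuple h z.1 (E z.2)) * expR (tilt_exponent e s (tnth z.1) z.2))).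
      by apply: measurable_funM => //; exact: mshift.
    by move=> z; rewrite mulr_ge0 ?expR_ge0//; case: uf => _ /(_ (shift_tuple h z.1 (E z.2)))/andP[].
  have -> : (fun x => (tilt_mass P (tilt_exponent e s (tnth x)))^-1) =
      (fun x => (tilt_mass P (tilt_exponent e s (tnth x))) `^ (-1)).
    by apply/funext => x; rewrite powR_inv1// ltW// tilt_mass_gt0.
  apply: (measurableT_comp (measurable_powR (-1))).
  apply: (@measurable_param_Rintegral (fun z => expR (tilt_exponent e s (tnth z.1) z.2))) => //.
move=> x; have [_ f01] := uf; have bs := bshift h x uf.
apply/andP; split.
  rewrite -(tilt_cst P (bexp s (tnth x)) 0); apply: ler_tilt => //.
    exact: bounded_mfun_cst.
  by move=> w; case/andP: (f01 (shift_tuple h x (E w))).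
rewrite -(tilt_cst P (bexp s (tnth x)) 1); apply: ler_tilt => //.
  exact: bounded_mfun_cst.
by move=> w; case/andP: (f01 (shift_tuple h x (E w))).
Qed.

(** The density of X + s E cancels the normalising constant in the posterior. What remains is a
    double integral of f(x + h E) weighted by the Cameron-Martin density for the shift s E; undoing
    that shift turns x + h E into x + (s + h) E. *)
Lemma integral_posterior_step s h f : unit_mfun f ->
  (\int[P]_w (posterior_step s h f (shift_tuple s (X w) (E w)))%:E =
   \int[P]_w (f (shift_tuple (s + h) (X w) (E w)))%:E)%E.
Proof.
move=> uf; have [mf f01] := uf; have [mQ Q01] := unit_mfun_posterior_step s h uf.
have f0 x : 0 <= f x by case/andP: (f01 x).
have Q0 x : 0 <= posterior_step s h f x by case/andP: (Q01 x).
rewrite (@ge0_integral_shift _ _ _ P d X E mX mE XE_indep s (EFin \o posterior_step s h f))//;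
  last exact/measurable_EFinP.
have -> : (\int[P]_w (f (shift_tuple (s + h) (X w) (E w)))%:E =
    \int[P]_w \int[gauss R d]_x (f (shift_tuple (s + h) x (E w)))%:E)%E.
  apply: (@ge0_integral_joint _ _ _ P d X E mX mE XE_indep
    (fun z => (f (shift_tuple (s + h) z.1 z.2))%:E)).
    apply/measurable_EFinP; apply: (measurableT_comp mf).
    by apply: measurable_shift_tuple.
  by move=> z; rewrite lee_fin.
under [RHS]eq_integral => w _.
  under eq_integral do rewrite -shift_tupleD.
  rewrite (@gauss_shift _ _ _ d E s w (fun x => (f (shift_tuple h x (E w)))%:E)); last 2 first.
  - apply/measurable_EFinP; apply: (measurableT_comp mf).
    by apply: measurable_shift_tuple.
  - by move=> x; rewrite lee_fin.
  over.
rewrite -(fubini_tonelli (m1 := gauss R d) (m2 := P)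
  (fun z => ((f (shift_tuple h z.1 (E z.2)))%:E * (expR (tilt_exponent e s (tnth z.1) z.2))%:E)%E)).
- apply: eq_integral => x _ /=.
  have be := bounded_mfun_exp (bexp s (tnth x)).
  have ie := integrable_fin_num measurableT (bounded_mfun_integrable P be).
  rewrite -(fineK ie) -EFinM /posterior_step /tilt.
  rewrite -[fine _]/(tilt_mass P (tilt_exponent e s (tnth x))).
  rewrite divfK ?tilt_mass_neq0//.
  have bfe := bounded_mfunM (bshift h x uf) be.
  rewrite /Rintegral fineK; last exact: (integrable_fin_num measurableT (bounded_mfun_integrable P bfe)).
  by apply: eq_integral => w _; rewrite EFinM.
- apply: emeasurable_funM; apply/measurable_EFinP => //; exact: mshift.
- by move=> z; rewrite mule_ge0// lee_fin// expR_ge0.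
Qed.

(** Backward form of the chain: at x, the expected value of [f] after [m] steps of length [h]
    started from x at time [s]. The outermost operator is the earliest step. *)
Fixpoint chain (h : R) (m : nat) (s : R) (f : d.-tuple R -> R) : d.-tuple R -> R :=
  if m is m'.+1 then posterior_step s h (chain h m' (s + h) f) else f.

Lemma unit_mfun_chain h m s f : unit_mfun f -> unit_mfun (chain h m s f).
Proof. by move=> uf; elim: m s => [|m IH] s //=; exact: unit_mfun_posterior_step. Qed.

Lemma integral_chain h m s f : unit_mfun f ->
  (\int[P]_w (chain h m s f (shift_tuple s (X w) (E w)))%:E =
   \int[P]_w (f (shift_tuple (s + h *+ m) (X w) (E w)))%:E)%E.
Proof.
move=> uf; elim: m s => [|m IH] s; first by rewrite mulr0n addr0.
rewrite [chain _ _ _ _]/= integral_posterior_step ?IH; last exact: unit_mfun_chain.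
by rewrite mulrS addrA.
Qed.

End Chain.

Lemma sqr_sum_le (R : realType) d (a : 'I_d -> R) :
  (\sum_i a i) ^+ 2 <= d%:R * \sum_i a i ^+ 2.
Proof.
have H : \sum_(i < d) \sum_(j < d) (a i * a j) <=
    \sum_(i < d) \sum_(j < d) ((a i ^+ 2 + a j ^+ 2) / 2).
  apply: ler_sum => i _; apply: ler_sum => j _.
  have := sqr_ge0 (a i - a j); nra.
rewrite expr2 big_distrlr /=; apply: le_trans H _.
pose Q := \sum_i a i ^+ 2.
have E i : \sum_(j < d) ((a i ^+ 2 + a j ^+ 2) / 2) = (d%:R * a i ^+ 2 + Q) / 2.
  by rewrite -mulr_suml big_split/= sumr_const card_ord -[X in X + _]mulr_natl.
rewrite (eq_bigr _ (fun i _ => E i)) -mulr_suml big_split/= -mulr_sumr.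
rewrite sumr_const card_ord -[X in _ + X]mulr_natl -/Q; lra.
Qed.

Lemma sumr_cst (R : realType) d (a : R) : \sum_(i < d) a = d%:R * a.
Proof. by rewrite sumr_const card_ord mulr_natl. Qed.

(** * Error of one chain step along a trajectory of the flow *)

Section Trajectory.
Context (R : realType) (dO : measure_display) (Om : measurableType dO).
Variables (P : probability Om R) (d : nat) (e : 'I_d -> Om -> R) (K : R).
Hypothesis me : forall i, measurable_fun setT (e i).
Hypothesis K0 : 0 <= K.
Hypothesis eK : forall i w, `|e i w| <= K.
Variable u : 'I_d -> R -> R.
Hypothesis du : forall i (s : R), 0 <= s -> is_derive s 1 (u i) (velocity P e s (u ^~ s) i).

Let bexp s x : bounded_mfun (tilt_exponent e s x).
Proof. exact: bounded_mfun_exponent eK _ _. Qed.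

Lemma flow_lipschitz i (s t : R) : 0 <= s -> s <= t -> `|u i t - u i s| <= K * (t - s).
Proof.
move=> s0 st; rewrite mulrBr.
apply: (@derive_norm_le _ (u i) (fun s => velocity P e s (u ^~ s) i) ( *%R K) (fun=> K)) => //.
- by move=> x /andP[sx _]; apply: du; rewrite (le_trans s0)// ltW.
- by move=> x _; exact: is_derive_mull.
- apply: (@is_derive_within _ _ (fun s => velocity P e s (u ^~ s) i)) => x /andP[sx _].
  exact: du (le_trans s0 sx).
- by apply: (@is_derive_within _ _ (fun=> K)) => x _; exact: is_derive_mull.
- by move=> x _; exact: velocity_norm_le.
Qed.

(** A second-order Taylor bound without a second derivative: along the trajectory the velocity is
    Lipschitz in time, so r -> u(r) - r v(s) has derivative at most C h on [s, s + h]. *)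
Lemma flow_residual (S : R) : 0 <= S -> exists2 C : R, 0 <= C &
  forall i (s h : R), 0 <= s -> 0 <= h -> s + h <= S ->
  `|u i (s + h) - u i s - h * velocity P e s (u ^~ s) i| <= C * h * h.
Proof.
move=> S0.
(* [U] bounds the sum of the |u j| on [0, S], as every coordinate moves at speed at most [K]. *)
pose U := \sum_j `|u j 0| + d%:R * (K * S).
have U0 : 0 <= U by rewrite addr_ge0 ?sumr_ge0// !mulr_ge0.
pose C := 4 * K * (S * (K * (d%:R * K)) + (K * U + (S + S) * (d%:R * K ^+ 2))).
have C0 : 0 <= C by rewrite /C; do ![done|exact: exprn_ge0|apply: mulr_ge0|apply: addr_ge0].
exists C => // i s h s0 h0 shS.
pose v0 := velocity P e s (u ^~ s) i.
have UB : \sum_j `|u j s| <= U.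
  rewrite /U -(sumr_cst d) -big_split/=.
  apply: ler_sum => j _; have := flow_lipschitz j (lexx 0) s0.
  rewrite subr0 => h1; have := ler_normD (u j 0) (u j s - u j 0).
  rewrite [u j 0 + _]addrC subrK => h2; apply: le_trans h2 _; rewrite lerD2l.
  by apply: le_trans h1 _; rewrite ler_wpM2l//; lra.
have := @derive_norm_le _ (u i \- ( *%R v0)) (fun r => velocity P e r (u ^~ r) i - v0)
  ( *%R (C * h)) (fun=> C * h) s (s + h).
rewrite lerDl => /(_ h0) H.
have -> : u i (s + h) - u i s - h * velocity P e s (u^~ s) i =
    (u i \- *%R v0) (s + h) - (u i \- *%R v0) s by rewrite /= -/v0; ring.
have -> : C * h * h = C * h * (s + h) - C * h * s by ring.
apply: H.
- move=> x /andP[sx _]; apply: is_deriveB; last exact: is_derive_mull.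
  by apply: du; rewrite (le_trans s0)// ltW.
- by move=> x _; exact: is_derive_mull.
- move=> x; apply: continuousB.
    apply: (@is_derive_within _ _ (fun s => velocity P e s (u ^~ s) i)) => y /andP[sy _].
    exact: du (le_trans s0 sy).
  by apply: (@is_derive_within _ _ (fun=> v0)) => y _; exact: is_derive_mull.
- by apply: (@is_derive_within _ _ (fun=> C * h)) => x _; exact: is_derive_mull.
move=> x /andP[sx xsh].
have x0 : 0 <= x by rewrite (le_trans s0)// ltW.
apply: le_trans (velocity_dist P me K0 eK x s (u ^~ x) (u ^~ s) i) _.
rewrite (ger0_norm x0) (ger0_norm s0) (ger0_norm (_ : 0 <= x - s)); last by rewrite subr_ge0 ltW.
have h1 : \sum_j `|u j x - u j s| <= d%:R * K * h.
  rewrite -mulrA -(sumr_cst d).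
  apply: ler_sum => j _; apply: le_trans (flow_lipschitz j s0 (ltW sx)) _.
  by rewrite ler_wpM2l//; lra.
rewrite /C -!mulrA; do 2 (apply: ler_wpM2l => //).
rewrite [leRHS]mulrDl; apply: lerD.
  rewrite -!mulrA; apply: ler_pM; rewrite ?mulr_ge0 ?sumr_ge0//; first by lra.
  by apply: ler_wpM2l => //; rewrite mulrA.
rewrite [leRHS]mulrC; apply: ler_pM; rewrite ?subr_ge0 ?(ltW sx)//.
- by rewrite addr_ge0 ?mulr_ge0 ?sumr_ge0// ?addr_ge0// exprn_ge0.
- by lra.
- apply: lerD; first exact: ler_wpM2l.
  by apply: ler_wpM2r; [rewrite mulr_ge0// exprn_ge0|lra].
Qed.

(* The increment [h * e] has conditional mean [h * velocity], so its deviation from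
   the flow is of first order only through a centred term: the quadratic mean
   error per step is of order [h ^+ 2]. *)
Lemma one_step (S : R) : 0 <= S -> exists C B : R, 0 <= C /\ 0 <= B /\
  forall (s h : R) (x : 'I_d -> R), 0 <= s -> 0 <= h -> h <= 1 -> s + h <= S ->
  tilt P (tilt_exponent e s x) (fun w => \sum_i (x i + h * e i w - u i (s + h)) ^+ 2)
  <= (1 + C * h) * (\sum_i (x i - u i s) ^+ 2) + B * h ^+ 2.
Proof.
move=> S0; have [Cr Cr0 HCr] := flow_residual S0.
pose L := 4 * K ^+ 2 * S.
have L0 : 0 <= L by rewrite /L !mulr_ge0// exprn_ge0.
(* The 1 comes from Young's inequality on the cross term. One factor [d] in [d ^+ 2] comes from
   summing over coordinates, the other from D^2 <= d times the sum of squares. In the second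
   constant [Cr] is the Taylor error of the flow and [K ^+ 2] bounds the variance. *)
exists (1 + 4 * L ^+ 2 * d%:R ^+ 2), (d%:R * (4 * Cr ^+ 2 + K ^+ 2)).
split; first by rewrite addr_ge0// !mulr_ge0// exprn_ge0.
split; first by rewrite mulr_ge0// addr_ge0 ?mulr_ge0// exprn_ge0.
move=> s h x s0 h0 h1 shS.
pose c i := x i - u i (s + h).
pose vx i := velocity P e s x i.
pose vu i := velocity P e s (u ^~ s) i.
pose dl i := x i - u i s.
pose D := \sum_i `|dl i|.
have be i : bounded_mfun (e i) by exact: bounded_mfun_coord.
(* In the expanded square the linear term in e has mean [vx i] and the quadratic one is at most h^2
   K^2; completing the square only adds the nonnegative (h vx)^2. *)
have E2 i : tilt P (tilt_exponent e s x) (fun w => (x i + h * e i w - u i (s + h)) ^+ 2) <=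
    (c i + h * vx i) ^+ 2 + h ^+ 2 * K ^+ 2.
  have b2 : bounded_mfun (fun w => 2 * h * c i * e i w) by exact: bounded_mfunZ.
  apply: (@le_trans _ _ (tilt P (tilt_exponent e s x)
      (fun w => (c i ^+ 2 + h ^+ 2 * K ^+ 2) + 2 * h * c i * e i w))).
    apply: ler_tilt => //.
    - under [X in bounded_mfun X]funext do rewrite expr2.
      have bb : bounded_mfun (fun w => x i + h * e i w - u i (s + h)).
        apply: bounded_mfunB; last exact: bounded_mfun_cst.
        apply: bounded_mfunD; [exact: bounded_mfun_cst|exact: bounded_mfunZ].
      exact: bounded_mfunM.
    - by apply: bounded_mfunD => //; exact: bounded_mfun_cst.
    - move=> w.
      have : e i w ^+ 2 <= K ^+ 2.
        by rewrite -real_normK ?num_real// lerXn2r// nnegrE.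
      have := sqr_ge0 h; rewrite /c; nra.
  rewrite (tiltD P (bexp s x) (bounded_mfun_cst _ _) b2) (tilt_cst P (bexp s x)).
  rewrite (tiltZ P (bexp s x) _ (be i)) -/(velocity P e s x i) -/(vx i).
  rewrite -[X in X + _ <= _]/(c i ^+ 2 + h ^+ 2 * K ^+ 2).
  have := sqr_ge0 (h * vx i); nra.
rewrite (tilt_sum P (bexp s x) (f := fun i w => (x i + h * e i w - u i (s + h)) ^+ 2)); last first.
  move=> i; under [X in bounded_mfun X]funext do rewrite expr2.
  have bb : bounded_mfun (fun w => x i + h * e i w - u i (s + h)).
    apply: bounded_mfunB; last exact: bounded_mfun_cst.
    apply: bounded_mfunD; [exact: bounded_mfun_cst|exact: bounded_mfunZ].
  exact: bounded_mfunM.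
apply: le_trans (ler_sum _ (fun i _ => E2 i)) _.
have D2 : D ^+ 2 <= d%:R * \sum_i dl i ^+ 2.
  apply: le_trans (sqr_sum_le _) _; rewrite ler_wpM2l//.
  by apply: ler_sum => i _; rewrite real_normK ?num_real.
have key i : (c i + h * vx i) ^+ 2 + h ^+ 2 * K ^+ 2 <=
    (1 + h) * dl i ^+ 2 + 4 * Cr ^+ 2 * h ^+ 2 + 4 * h * L ^+ 2 * D ^+ 2 + h ^+ 2 * K ^+ 2.
  rewrite lerD2r.
  pose r := u i (s + h) - u i s - h * vu i.
  have hr : `|r| <= Cr * h * h by exact: HCr.
  have hv : `|vx i - vu i| <= L * D.
    apply: le_trans (velocity_lipschitz P me K0 eK _ _ _ _) _.
    rewrite (ger0_norm s0) ler_wpM2r ?sumr_ge0// /L ler_wpM2l ?mulr_ge0 ?exprn_ge0//; lra.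
  (* [q] is the change of the error [dl i] over the step. Young's inequality 2 h |dl| m <= h (dl^2 +
     m^2) handles the cross term, and h <= 1 gives (h m)^2 <= h m^2. *)
  pose q := h * (vx i - vu i) - r.
  have -> : c i + h * vx i = dl i + q by rewrite /c /dl /q /r; ring.
  have D0 : 0 <= D by exact: sumr_ge0.
  have hq : `|q| <= h * (L * D + Cr * h).
    apply: le_trans (ler_normB _ _) _; rewrite normrM (ger0_norm h0).
    have := ler_wpM2l h0 hv; lra.
  pose m := L * D + Cr * h.
  have m0 : 0 <= m by rewrite /m addr_ge0// mulr_ge0.
  have a1 : dl i * q <= `|dl i| * (h * m).
    by apply: le_trans (ler_norm _) _; rewrite normrM ler_wpM2l.
  have a2 : 2 * (`|dl i| * m) <= dl i ^+ 2 + m ^+ 2.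
    have := sqr_ge0 (`|dl i| - m); rewrite -(real_normK (num_real (dl i))); nra.
  have a3 : q ^+ 2 <= (h * m) ^+ 2.
    by rewrite -real_normK ?num_real// lerXn2r// nnegrE ?mulr_ge0.
  have a4 : m ^+ 2 <= 2 * L ^+ 2 * D ^+ 2 + 2 * Cr ^+ 2 * h ^+ 2.
    have := sqr_ge0 (L * D - Cr * h); rewrite /m; nra.
  have a5 : (h * m) ^+ 2 <= h * m ^+ 2.
    by rewrite exprMn ler_wpM2r ?sqr_ge0// expr2 ler_piMr.
  have a6 := ler_wpM2l h0 a2.
  have a7 := ler_wpM2l h0 a4.
  have a8 : h * (Cr ^+ 2 * h ^+ 2) <= Cr ^+ 2 * h ^+ 2.
    by rewrite ler_piMl// mulr_ge0 ?sqr_ge0.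
  move: a1 a3 a5 a6 a7 a8; clear; lra.
apply: le_trans (ler_sum _ (fun i _ => key i)) _.
have -> : \sum_(i < d) ((1 + h) * dl i ^+ 2 + 4 * Cr ^+ 2 * h ^+ 2 +
    4 * h * L ^+ 2 * D ^+ 2 + h ^+ 2 * K ^+ 2) = (1 + h) * (\sum_i dl i ^+ 2) +
    d%:R * (4 * Cr ^+ 2 * h ^+ 2 + 4 * h * L ^+ 2 * D ^+ 2 + h ^+ 2 * K ^+ 2).
  rewrite mulr_sumr -(sumr_cst d) -big_split/=.
  by apply: eq_bigr => i _; rewrite !addrA.
have b0 : 0 <= d%:R * (4 * h * L ^+ 2).
  by rewrite !mulr_ge0// exprn_ge0.
have := ler_wpM2l b0 D2; rewrite -/(dl _) /dl.
set Q := \sum_i _; clear; lra.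
Qed.

End Trajectory.

Section FlowLaw.
Context (R : realType) (dO : measure_display) (Om : measurableType dO).
Variables (P : probability Om R) (d : nat) (X E : Om -> d.-tuple R) (K : R).
Hypothesis mX : measurable_fun setT X.
Hypothesis mE : measurable_fun setT E.
Hypothesis K0 : 0 <= K.
Local Notation N01 := (normal_prob (0 : R) 1).
Hypothesis XE_indep : forall (A : 'I_d -> set R) (B : set (d.-tuple R)),
  (forall i, measurable (A i)) -> measurable B ->
  P ([set w | forall i, A i (tnth (X w) i)] `&` E @^-1` B) =
  ((\prod_(i < d) N01 (A i)) * P (E @^-1` B))%E.
Hypothesis eK : forall i w, `|tnth (E w) i| <= K.

Let e (i : 'I_d) (w : Om) : R := tnth (E w) i.

Let me i : measurable_fun setT (e i).
Proof. exact: (measurableT_comp (measurable_tnth i) mE). Qed.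

Let bexp s x : bounded_mfun (tilt_exponent e s x).
Proof. exact: bounded_mfun_exponent eK _ _. Qed.

Lemma tilt_norm_ler a f g : bounded_mfun a -> bounded_mfun f -> bounded_mfun g ->
  (forall w, `|f w| <= g w) -> `|tilt P a f| <= tilt P a g.
Proof.
move=> ba bf bg fg; rewrite ler_norml; apply/andP; split; last first.
  by apply: ler_tilt => // w; apply: le_trans (ler_norm _) (fg w).
rewrite lerNl -mulN1r -(tiltZ P ba (-1) bf); apply: ler_tilt => //.
  exact: bounded_mfunZ.
by move=> w; rewrite mulN1r; apply: le_trans (ler_norm _) _; rewrite normrN.
Qed.

(** With no step left, L |a| <= (L / 2)(eps + a^2 / eps) replaces the Lipschitz bound by a
    quadratic. Each step averages the quadratic bound of the remaining steps, and [one_step] returns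
    a quadratic of the same shape, with a factor 1 + C h and an extra B h^2. *)
Lemma chain_bound (u : 'I_d -> R -> R) (S : R) :
  (forall i (s : R), 0 <= s -> is_derive s 1 (u i) (velocity P e s (u ^~ s) i)) ->
  0 <= S -> exists C B : R, 0 <= C /\ 0 <= B /\
  forall (f : d.-tuple R -> R) (L eps : R), unit_mfun f -> 0 <= L -> 0 < eps ->
  (forall x y, `|f x - f y| <= L * \sum_i `|tnth x i - tnth y i|) ->
  forall m (s h : R) x, 0 <= s -> 0 <= h -> h <= 1 -> s + h *+ m <= S ->
  `|chain P E h m s f x - f [tuple u i (s + h *+ m) | i < d]| <=
  L / 2 * (d%:R * eps + (1 + C * h) ^+ m *
    (\sum_i (tnth x i - u i s) ^+ 2 + m%:R * (B * h ^+ 2)) / eps).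
Proof.
move=> du S0; have [C [B [C0 [B0 HCB]]]] := one_step me K0 eK du S0.
exists C, B; split => //; split => // f L eps uf L0 eps0 fL.
elim=> [|m IH] s h x s0 h0 h1 shS.
  rewrite /= mulr0n addr0 expr0 mul1r mul0r addr0.
  apply: le_trans (fL _ _) _.
  rewrite -mulrA ler_wpM2l// mulrC ler_pdivlMr// mulr_suml.
  rewrite mulr_suml -(sumr_cst d) -big_split /=; apply: ler_sum => i _.
  rewrite tnth_mktuple; set a := tnth x i - u i s.
  rewrite -(real_normK (num_real a)).
  have : `|a| ^+ 2 / eps * eps = `|a| ^+ 2 by rewrite divfK// gt_eqF.
  have := sqr_ge0 (`|a| - eps); set t := `|a| ^+ 2 / eps; nra.
rewrite /=.
have -> : s + h *+ m.+1 = (s + h) + h *+ m by rewrite mulrS addrA.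
set c := f _; pose g := chain P E h m (s + h) f.
have [mg g01] : unit_mfun g by exact: (unit_mfun_chain P mE eK).
have shm : s + h <= S.
  apply: le_trans shS; rewrite mulrS addrA lerDl mulrn_wge0//.
have b1 i : bounded_mfun (fun w => (tnth x i + h * e i w - u i (s + h)) ^+ 2).
  under [X in bounded_mfun X]funext do rewrite expr2.
  have bb : bounded_mfun (fun w => tnth x i + h * e i w - u i (s + h)).
    apply: bounded_mfunB; last exact: bounded_mfun_cst.
    apply: bounded_mfunD; first exact: bounded_mfun_cst.
    apply: bounded_mfunZ; exact: bounded_mfun_coord eK _.
  exact: bounded_mfunM.
have bS : bounded_mfun (fun w => \sum_i (tnth x i + h * e i w - u i (s + h)) ^+ 2).
  exact: bounded_mfun_sum.
pose p := (1 + C * h) ^+ m.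
have p0 : 0 <= p by rewrite exprn_ge0// addr_ge0// mulr_ge0.
(* The induction hypothesis, split into its constant part [k0] and the coefficient [k1] of the
   quadratic, so that the tilted mean acts on the quadratic only. *)
pose k0 := L / 2 * (d%:R * eps + p * (m%:R * (B * h ^+ 2)) / eps).
pose k1 := L / 2 * (p / eps).
have k10 : 0 <= k1 by rewrite /k1 mulr_ge0 ?divr_ge0// ltW.
have bgc : bounded_mfun (fun w => g (shift_tuple h x (E w))).
  split; first by apply: (measurableT_comp mg); apply: measurable_shift_tuple.
  by exists 1 => w; have /andP[f0 f1] := g01 (shift_tuple h x (E w)); rewrite ger0_norm.
have -> : posterior_step P E s h g x - c =
    tilt P (tilt_exponent e s (tnth x)) (fun w => g (shift_tuple h x (E w)) - c).
  rewrite (tiltB P (bexp s (tnth x)) bgc (bounded_mfun_cst _ c)).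
  by rewrite (tilt_cst P (bexp s (tnth x)) c).
apply: (@le_trans _ _ (tilt P (tilt_exponent e s (tnth x)) (fun w => k0 +
    k1 * \sum_i (tnth x i + h * e i w - u i (s + h)) ^+ 2))).
  apply: tilt_norm_ler => //.
  - by apply: bounded_mfunB => //; exact: bounded_mfun_cst.
  - by apply: bounded_mfunD; [exact: bounded_mfun_cst|exact: bounded_mfunZ].
  - move=> w; have := IH (s + h) h (shift_tuple h x (E w)) (addr_ge0 s0 h0) h0 h1.
    have -> : s + h + h *+ m <= S by rewrite -addrA -mulrS.
    move=> /(_ isT) H; apply: le_trans H _; rewrite -/p.
    under eq_bigr do rewrite tnth_mktuple.
    rewrite /k0 /k1 le_eqVlt; apply/orP; left; apply/eqP; rewrite /e; field.
    by rewrite gt_eqF.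
have bk : bounded_mfun (fun w : Om => k0) by exact: bounded_mfun_cst.
rewrite (tiltD P (bexp s (tnth x)) bk (bounded_mfunZ k1 bS)) (tilt_cst P (bexp s (tnth x)) k0).
rewrite (tiltZ P (bexp s (tnth x)) k1 bS).
have H := ler_wpM2l k10 (HCB s h (tnth x) s0 h0 h1 shm).
rewrite -[X in X + _ <= _]/k0.
apply: (@le_trans _ _ (k0 + k1 * ((1 + C * h) * (\sum_i (tnth x i - u i s) ^+ 2) + B * h ^+ 2))).
  by rewrite lerD2l.
rewrite /k0 /k1 (exprS (1 + C * h) m) -/p.
set Q := \sum_i _.
have -> : L / 2 * (d%:R * eps + p * (m%:R * (B * h ^+ 2)) / eps) +
    L / 2 * (p / eps) * ((1 + C * h) * Q + B * h ^+ 2) =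
    L / 2 * (d%:R * eps + p * (m%:R * (B * h ^+ 2) + (1 + C * h) * Q + B * h ^+ 2) / eps).
  by field; rewrite gt_eqF.
rewrite ler_wpM2l ?divr_ge0// lerD2l ler_pM2r ?invr_gt0//.
rewrite [(1 + C * h) * p]mulrC -[leRHS]mulrA ler_wpM2l// -[m.+1%:R]natr1.
(* The slack from letting the factor 1 + C h multiply the accumulated B h^2 terms as well. *)
have t0 : 0 <= C * h * ((m%:R + 1) * (B * h ^+ 2)).
  by rewrite !mulr_ge0// ?exprn_ge0// addr_ge0.
lra.
Qed.

Lemma chain_cvg (u : 'I_d -> R -> R) (tau : R) (f : d.-tuple R -> R) (L : R) :
  (forall i (s : R), 0 <= s -> is_derive s 1 (u i) (velocity P e s (u ^~ s) i)) ->
  0 <= tau -> unit_mfun f -> 0 <= L ->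
  (forall x y, `|f x - f y| <= L * \sum_i `|tnth x i - tnth y i|) ->
  chain P E (tau / n.+1%:R) n.+1 0 f [tuple u i 0 | i < d] @[n --> \oo] -->
  f [tuple u i tau | i < d].
Proof.
move=> du tau0 uf L0 fL; have [C [B [C0 [B0 H]]]] := chain_bound du tau0.
apply/cvgrPdist_le => eta eta0.
(* Chosen so that L d eps / 2 <= eta / 2; the added 1 excludes a zero denominator. *)
pose eps := eta / (L * d%:R + 1).
have D0 : 0 < L * d%:R + 1 by rewrite ltr_wpDl// mulr_ge0.
have eps0 : 0 < eps by rewrite divr_gt0.
(* With N steps of length tau / N, (1 + C h)^N <= exp(C tau) and N B h^2 = B tau^2 / N, so the rest
   of the bound is at most M / N. *)
pose M := L / 2 * (expR (C * tau) * (B * tau ^+ 2) / eps).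
near=> n.
have N0 : 0 < n.+1%:R :> R by rewrite ltr0n.
have n1 : tau <= n.+1%:R.
  apply: (@le_trans _ _ n%:R); last by rewrite ler_nat.
  by near: n; exact: nbhs_infty_ger.
have n2 : M * 2 / eta <= n.+1%:R.
  apply: (@le_trans _ _ n%:R); last by rewrite ler_nat.
  by near: n; exact: nbhs_infty_ger.
set N := n.+1%:R in N0 n1 n2 *; pose h := tau / N.
have hN : 0 + h *+ n.+1 = tau.
  by rewrite add0r -mulr_natr -/N /h divfK// gt_eqF.
have h0 : 0 <= h by rewrite divr_ge0// ltW.
have h1 : h <= 1 by rewrite ler_pdivrMr// mul1r.
have := H f L eps uf L0 eps0 fL n.+1 0 h [tuple u i 0 | i < d] (lexx 0) h0 h1.
rewrite hN lexx -/h => /(_ isT); rewrite distrC => /le_trans; apply.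
rewrite big1 ?add0r; last by move=> i _; rewrite tnth_mktuple subrr expr0n.
have pE : (1 + C * h) ^+ n.+1 <= expR (C * tau).
  apply: (@le_trans _ _ (expR (C * h) ^+ n.+1)).
    rewrite lerXn2r ?nnegrE ?expR_ge0 ?expR_ge1Dx//.
    by rewrite addr_ge0// mulr_ge0.
  by rewrite -expRM_natl -/N /h mulrCA [N * _]mulrC divfK ?gt_eqF.
have hE : n.+1%:R * (B * h ^+ 2) = B * tau ^+ 2 / N.
  by rewrite -/N /h; field; rewrite gt_eqF.
rewrite hE mulrDr [leRHS](splitr eta); apply: lerD.
  have e1 : eps * (L * d%:R + 1) = eta by rewrite /eps divfK// gt_eqF.
  lra.
apply: (@le_trans _ _ (M / N)).
  have -> : M / N = L / 2 * (expR (C * tau) * (B * tau ^+ 2 / N / eps)).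
    by rewrite /M; field; rewrite !gt_eqF.
  rewrite -[X in L / 2 * X]mulrA ler_wpM2l ?divr_ge0// ler_wpM2r//.
  by rewrite !divr_ge0 ?mulr_ge0 ?exprn_ge0// ltW.
rewrite ler_pdivrMr//.
move: n2; rewrite ler_pdivrMr//; lra.
Unshelve. all: by end_near.
Qed.

Lemma bounded_cvg_integral (h_ : nat -> Om -> R) (h : Om -> R) :
  (forall n, measurable_fun setT (h_ n)) -> (forall n w, 0 <= h_ n w <= 1) ->
  (forall w, h_ n w @[n --> \oo] --> h w) ->
  (\int[P]_w (h_ n w)%:E @[n --> \oo] --> \int[P]_w (h w)%:E)%E.
Proof.
move=> mh h01 hc.
apply: (@dominated_cvg _ _ _ P setT measurableT (fun n w => (h_ n w)%:E)
  (fun w => (h w)%:E) (cst 1%E)) => //.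
- by move=> n; exact/measurable_EFinP.
- by move=> w _; apply: cvg_EFin => //; [exact: nearW|exact: hc].
- exact: (bounded_mfun_integrable P (bounded_mfun_cst _ 1)).
- by move=> n w _; rewrite lee_fin; have /andP[a b] := h01 n w; rewrite ger0_norm.
Qed.

Section Flow.
Variable u : Om -> 'I_d -> R -> R.
Hypothesis u0 : forall w i, u w i 0 = tnth (X w) i.
Hypothesis du : forall w i (s : R), 0 <= s ->
  is_derive s 1 (u w i) (velocity P e s (u w ^~ s) i).
Variable tau : R.
Hypothesis tau0 : 0 <= tau.

Let Y w := [tuple u w i tau | i < d].
Let Z w := shift_tuple tau (X w) (E w).

(** The chain applied to f is a measurable function of [X] whose mean is the mean of f(Z) for every
    number of steps. Its pointwise limit f(Y) is thus measurable, with the same mean by dominated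
    convergence. *)
Lemma flow_test (f : d.-tuple R -> R) (L : R) : unit_mfun f -> 0 <= L ->
  (forall x y, `|f x - f y| <= L * \sum_i `|tnth x i - tnth y i|) ->
  measurable_fun setT (fun w => f (Y w)) /\
  (\int[P]_w (f (Y w))%:E = \int[P]_w (f (Z w))%:E)%E.
Proof.
move=> uf L0 fL.
pose h_ n w := chain P E (tau / n.+1%:R) n.+1 0 f (X w).
have hc w : h_ n w @[n --> \oo] --> f (Y w).
  have := chain_cvg (du w) tau0 uf L0 fL.
  rewrite (_ : [tuple u w i 0 | i < d] = X w)//.
  by apply: eq_from_tnth => i; rewrite tnth_mktuple.
have uc n := unit_mfun_chain P mE eK (tau / n.+1%:R) n.+1 0 uf.
have mh n : measurable_fun setT (h_ n).
  by apply: (measurableT_comp _ mX); case: (uc n).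
split; first by apply: (measurable_fun_cvg mh) => w _; exact: hc.
have H := bounded_cvg_integral mh (fun n w => (uc n).2 (X w)) hc.
have cst n : (\int[P]_w (h_ n w)%:E = \int[P]_w (f (Z w))%:E)%E.
  have := integral_chain mX mE XE_indep eK (tau / n.+1%:R) n.+1 0 uf.
  have -> : 0 + tau / n.+1%:R *+ n.+1 = tau.
    by rewrite add0r -mulr_natr divfK// pnatr_eq0.
  move=> <-; apply: eq_integral => w _; congr (_%:E); congr chain.
  by apply: eq_from_tnth => i; rewrite tnth_mktuple mul0r addr0.
rewrite -(cvg_lim _ H)//.
by under eq_fun do rewrite cst; rewrite lim_cst.
Qed.

(* Lipschitz functions decreasing to the indicator of an upper box. *)
Let test (c : 'I_d -> R) (m : nat) (x : d.-tuple R) : R :=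
  Num.max 0 (1 - m%:R * \sum_i Num.max 0 (c i - tnth x i)).

Let sum_ge0 (c : 'I_d -> R) (x : d.-tuple R) : 0 <= \sum_i Num.max 0 (c i - tnth x i).
Proof. by apply: sumr_ge0 => i _; rewrite le_max lexx. Qed.

Let test_unit c m : unit_mfun (test c m).
Proof.
split.
  apply: measurable_maxr => //; apply: measurable_funB => //.
  apply: measurable_funM => //; apply: measurable_sum => i.
  apply: measurable_maxr => //; apply: measurable_funB => //.
  exact: measurable_tnth.
move=> x; rewrite /test le_max lexx /= ge_max ler01/= gerBl mulr_ge0//.
Qed.

Let max0_dist (a b : R) : `|Num.max 0 a - Num.max 0 b| <= `|a - b|.
Proof.
have h1 := ler_norm (a - b); have h2 := ler_norm (- (a - b)).
rewrite normrN in h2; rewrite /Order.max ler_norml.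
by case: (ltP 0 a) (ltP 0 b) => ? [] ?; apply/andP; split; lra.
Qed.

Let test_lip c m x y :
  `|test c m x - test c m y| <= m%:R * \sum_i `|tnth x i - tnth y i|.
Proof.
apply: le_trans (max0_dist _ _) _.
rewrite (_ : _ - _ - _ = m%:R * (\sum_i Num.max 0 (c i - tnth y i) -
  \sum_i Num.max 0 (c i - tnth x i))); last by ring.
rewrite normrM ger0_norm// ler_wpM2l// -sumrB.
apply: le_trans (ler_norm_sum _ _ _) _; apply: ler_sum => i _.
apply: le_trans (max0_dist _ _) _.
by rewrite (_ : _ - _ - _ = tnth x i - tnth y i)//; ring.
Qed.

Let test_cvg c x : test c m x @[m --> \oo] --> (\1_(upper_box c) x : R).
Proof.
rewrite indicE; have [/set_mem xc|/negP xc] := boolP (x \in upper_box c).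
  apply: cvg_near_cst; apply: nearW => m; rewrite /test big1 ?mulr0 ?subr0.
    by apply/max_idPr.
  by move=> i _; apply/max_idPl; rewrite subr_le0; exact: xc.
have S0 : 0 < \sum_i Num.max 0 (c i - tnth x i).
  rewrite lt0r sum_ge0 andbT; apply/negP => /eqP S0; apply: xc; apply/mem_set => i.
  have p0 j : true -> 0 <= Num.max 0 (c j - tnth x j) by rewrite le_max lexx.
  have := psumr_eq0P p0 S0 => /(_ i isT).
  by rewrite /Order.max; case: ltP => [/[swap] ->|]; rewrite ?ltxx// subr_le0.
apply: cvg_near_cst; near=> m.
rewrite /test; apply/max_idPl; rewrite subr_le0 -ler_pdivrMr//.
by near: m; exact: nbhs_infty_ger.
Unshelve. all: by end_near.
Qed.

(** Letting m tend to infinity in [test c m] carries both conclusions of [flow_test] over to the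
    indicator of the box. *)
Let Y_indic c : measurable (Y @^-1` upper_box c) /\
  P (Y @^-1` upper_box c) = P (Z @^-1` upper_box c).
Proof.
have F m := flow_test (test_unit c m) (ler0n _ m) (@test_lip c m).
have mI : measurable_fun setT (fun w => \1_(upper_box c) (Y w) : R).
  apply: (measurable_fun_cvg (fun m => (F m).1)) => w _; exact: test_cvg.
have mZ : measurable_fun setT Z by exact: measurable_shift_tuple.
have HY := bounded_cvg_integral (fun m => (F m).1) (fun m w => (test_unit c m).2 (Y w))
  (fun w => @test_cvg c (Y w)).
have HZ := bounded_cvg_integral (fun m => measurableT_comp (test_unit c m).1 mZ)
  (fun m w => (test_unit c m).2 (Z w)) (fun w => @test_cvg c (Z w)).
have mYb : measurable (Y @^-1` upper_box c).
  rewrite (_ : Y @^-1` _ = (fun w => \1_(upper_box c) (Y w) : R) @^-1` [set 1]).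
    by rewrite -[X in measurable X]setTI; apply: mI => //; exact: measurable_set1.
  apply/seteqP; split => w /=; rewrite indicE; first by move=> h; rewrite mem_set.
  by case: (boolP (Y w \in upper_box c)) => [/set_mem//|_ /eqP]; rewrite eq_sym oner_eq0.
have mZb : measurable (Z @^-1` upper_box c).
  rewrite -[X in measurable X]setTI; apply: mZ => //; exact: measurable_upper_box.
have IE (V : Om -> d.-tuple R) : measurable (V @^-1` upper_box c) ->
    (\int[P]_w (\1_(upper_box c) (V w))%:E = P (V @^-1` upper_box c))%E.
  move=> mV; rewrite -[LHS]/(\int[P]_w (\1_(V @^-1` upper_box c) w)%:E)%E.
  by rewrite integral_indic// setIT.
split => //; rewrite -(IE Y)// -(IE Z)//.
have limY := cvg_lim (@ereal_hausdorff R) HY; have limZ := cvg_lim (@ereal_hausdorff R) HZ.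
rewrite -[LHS]limY -[RHS]limZ; congr (limn _).
by apply/funext => m; exact: (F m).2.
Qed.

Lemma flow_measurable : measurable_fun setT Y.
Proof.
apply: (@measurability _ _ Om (d.-tuple R) setT Y _ (measurable_tuple_upper_boxes R d)).
by move=> _ [_ [c _ <-] <-]; rewrite setTI; exact: (Y_indic c).1.
Qed.

Lemma flow_law A : measurable A -> P (Y @^-1` A) = P (Z @^-1` A).
Proof.
have mZ : measurable_fun setT Z by exact: measurable_shift_tuple.
have := @tuple_measure_unique R d (pushforward P Y) (pushforward P Z).
move=> /(_ flow_measurable mZ); apply.
  by rewrite -[X in (X < _)%E]/(P setT) [X in (X < _)%E](probability_setT P) ltry.
by move=> c; exact: (Y_indic c).2.
Qed.

End Flow.

End FlowLaw.

(** * Norms *)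

Section Lqnorm.
Variable R : realType.

(** Young's inequality for x and 1 with exponents r and r / (r - 1), multiplied by r. The case r =
    1, where the conjugate exponent is infinite, is direct. *)
Lemma powR_bernoulli (r x : R) : 1 <= r -> 0 <= x -> r * x - (r - 1) <= x `^ r.
Proof.
rewrite le_eqVlt => /predU1P[<- x0|r1 x0]; first by rewrite powRr1//; lra.
have r0 : 0 < r by lra.
have rN : r != 0 by rewrite gt_eqF.
have r1' : 0 < r - 1 by rewrite subr_gt0.
have := @conjugate_powR R x 1 r (r / (r - 1)) x0 ler01 r0 (divr_gt0 r0 r1').
rewrite powR1 mulr1 => /(_ _) H.
have {}H : x <= x `^ r / r + 1 / (r / (r - 1)).
  by apply: H; field; rewrite rN gt_eqF.
have : x * r <= (x `^ r / r + 1 / (r / (r - 1))) * r by rewrite ler_pM2r.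
have -> : (x `^ r / r + 1 / (r / (r - 1))) * r = x `^ r + (r - 1).
  by field; rewrite rN gt_eqF.
lra.
Qed.

(** The graph of |t|^r lies above its tangent at m: dividing by |m| reduces this to Bernoulli's
    inequality at |t| / |m|, together with sg(m) t <= |t|. *)
Lemma powR_tangent (r m t : R) : 1 <= r ->
  `|m| `^ r + r * `|m| `^ (r - 1) * Num.sg m * (t - m) <= `|t| `^ r.
Proof.
move=> r1; have r0 : 0 < r by exact: lt_le_trans r1.
have [->|m0] := eqVneq m 0.
  by rewrite sgr0 mulr0 mul0r addr0 normr0 powR0 ?gt_eqF// powR_ge0.
have am : 0 < `|m| by rewrite normr_gt0.
have b := powR_bernoulli r1 (divr_ge0 (normr_ge0 t) (normr_ge0 m)).
have E1 : `|t| `^ r = `|m| `^ r * (`|t| / `|m|) `^ r.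
  by rewrite -powRM ?divr_ge0// mulrCA divff ?gt_eqF// mulr1.
have E2 : `|m| * `|m| `^ (r - 1) = `|m| `^ r by rewrite mulr_powRB1.
rewrite E1; apply: le_trans (ler_wpM2l (powR_ge0 _ _) b).
rewrite -E2; set p := `|m| `^ (r - 1).
have p0 : 0 <= p by exact: powR_ge0.
have E3 : `|m| * p * (r * (`|t| / `|m|) - (r - 1)) = `|m| * p + r * p * (`|t| - `|m|).
  by field; rewrite gt_eqF.
rewrite E3 lerD2l -[leLHS]mulrA ler_wpM2l ?mulr_ge0 ?(ltW r0)//.
rewrite mulrBr -normrEsg lerD2r; apply: le_trans (ler_norm _) _.
by rewrite normrM normr_sg m0 mul1r.
Qed.

Variable d : nat.
Implicit Types x y v m : 'rV[R]_d.

Lemma lqnorm_ge0 q x : 0 <= lqnorm q x.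
Proof.
case: q => [r||] //=; first exact: powR_ge0.
exact: bigmax_ge_id.
Qed.

(* A supporting hyperplane of the ball at [m]; it reduces Jensen's inequality and
   the mean value inequality for the norm to real-valued ones. *)
Lemma lqnorm_support q m : (1 <= q)%E -> exists a : 'I_d -> R, forall v,
  \sum_i a i * m ord0 i <= \sum_i a i * v ord0 i -> lqnorm q m <= lqnorm q v.
Proof.
case: q => [r||]//.
  (* For finite order the normal is the gradient at m of the sum of the |x_i|^r. *)
  rewrite lee_fin => r1; exists (fun i => r * `|m ord0 i| `^ (r - 1) * Num.sg (m ord0 i)) => v H.
  have r0 : 0 < r by exact: lt_le_trans r1.
  rewrite /= ge0_ler_powR ?invr_ge0 ?(ltW r0)// ?nnegrE ?sumr_ge0//; try by move=> i _; exact: powR_ge0.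
  have : \sum_i (`|m ord0 i| `^ r + r * `|m ord0 i| `^ (r - 1) * Num.sg (m ord0 i) *
      (v ord0 i - m ord0 i)) <= \sum_i `|v ord0 i| `^ r.
    by apply: ler_sum => i _; exact: powR_tangent.
  by rewrite big_split/=; under [X in _ + X]eq_bigr do rewrite mulrBr; rewrite sumrB; lra.
(* For the maximum norm the normal is a signed unit vector at a coordinate attaining the maximum; if
   the norm is 0, the zero vector serves. *)
move=> _; have := lexx (lqnorm +oo%E m); rewrite {2}/lqnorm => /bigmax_geP[m0|[i _ mi]].
  by exists (fun=> 0) => v _; apply: le_trans m0 _; exact: lqnorm_ge0.
exists (fun j => if j == i then Num.sg (m ord0 i) else 0) => v.
have S (w : 'rV[R]_d) : \sum_j (if j == i then Num.sg (m ord0 i) else 0) * w ord0 j =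
    Num.sg (m ord0 i) * w ord0 i.
  rewrite (bigD1 i)//= eqxx big1 ?addr0// => j /negbTE ->; exact: mul0r.
rewrite !S -normrEsg => H; apply: le_trans mi _; apply: le_trans H _.
apply: le_trans (ler_norm _) _; rewrite normrM normr_sg.
apply: (@le_trans _ _ `|v ord0 i|); first by case: eqP => _; rewrite ?mul0r ?mul1r.
exact: (le_bigmax _ (fun j => `|v ord0 j|)).
Qed.

Lemma lqnorm_coord q x i : (1 <= q)%E -> `|x ord0 i| <= lqnorm q x.
Proof.
case: q => [r||]//; last by move=> _; exact: (le_bigmax _ (fun j => `|x ord0 j|)).
rewrite lee_fin => r1; have r0 : 0 < r by exact: lt_le_trans r1.
have -> : `|x ord0 i| = (`|x ord0 i| `^ r) `^ r^-1.
  by rewrite -powRrM divff ?gt_eqF// powRr1.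
rewrite /= ge0_ler_powR ?invr_ge0 ?(ltW r0)// ?nnegrE ?powR_ge0//.
  by apply: sumr_ge0 => j _; exact: powR_ge0.
by rewrite (bigD1 i)//= lerDl sumr_ge0// => j _; exact: powR_ge0.
Qed.

Lemma lqnormZ q (c : R) x : (1 <= q)%E -> 0 <= c -> lqnorm q (c *: x) = c * lqnorm q x.
Proof.
case: q => [r||]//; last first.
  move=> _ c0; rewrite /= -[in RHS]/(lqnorm +oo%E x).
  apply/eqP; rewrite eq_le; apply/andP; split.
    apply: bigmax_le; first by rewrite mulr_ge0// lqnorm_ge0.
    move=> i _; rewrite mxE normrM (ger0_norm c0) ler_wpM2l//.
    by apply: (@lqnorm_coord +oo%E); exact: leey.
  have := lexx (lqnorm +oo%E x); rewrite {2}/lqnorm => /bigmax_geP[m0|[i _ mi]].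
    apply: (@le_trans _ _ 0); last exact: bigmax_ge_id.
    by rewrite mulr_ge0_le0.
  apply: (@le_trans _ _ (c * `|x ord0 i|)); first by rewrite ler_wpM2l.
  have := le_bigmax 0 (fun j => `|(c *: x) ord0 j|) i.
  by rewrite mxE normrM (ger0_norm c0).
rewrite lee_fin => r1 c0; have r0 : 0 < r by exact: lt_le_trans r1.
rewrite /=; under eq_bigr do rewrite mxE normrM (ger0_norm c0) powRM//.
rewrite -mulr_sumr powRM ?powR_ge0//; last by apply: sumr_ge0 => j _; exact: powR_ge0.
by rewrite -powRrM divff ?gt_eqF// powRr1.
Qed.

(** The functional supporting at the combination takes there a mean of its values at x and y, so one
    of the two points lies beyond the hyperplane and has the larger norm. *)
Lemma lqnorm_convex q x y (S t : R) : (1 <= q)%E -> 0 <= t <= 1 ->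
  lqnorm q x <= S -> lqnorm q y <= S -> lqnorm q (t *: x + (1 - t) *: y) <= S.
Proof.
move=> q1 /andP[t0 t1] xS yS.
have [a Ha] := lqnorm_support (t *: x + (1 - t) *: y) q1.
pose l (z : 'rV[R]_d) := \sum_i a i * z ord0 i.
have lE : l (t *: x + (1 - t) *: y) = t * l x + (1 - t) * l y.
  rewrite /l !mulr_sumr -big_split/=; apply: eq_bigr => i _; rewrite !mxE; ring.
have [lxy|lxy] := leP (l x) (l y).
  apply: le_trans yS; apply: Ha; rewrite -/(l _) -/(l _) lE; nra.
apply: le_trans xS; apply: Ha; rewrite -/(l _) -/(l _) lE; nra.
Qed.

Lemma lqnorm_eq0 q x : (1 <= q)%E -> lqnorm q x = 0 -> x = 0.
Proof.
move=> q1 x0; apply/rowP => i; rewrite mxE; apply/eqP.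
by rewrite -normr_le0 -x0; exact: lqnorm_coord.
Qed.

(** Divided by the sum of the norms, x + y is a convex combination of the normalised vectors, so
    convexity of the unit ball and homogeneity suffice. *)
Lemma ler_lqnormD q x y : (1 <= q)%E -> lqnorm q (x + y) <= lqnorm q x + lqnorm q y.
Proof.
move=> q1; set A := lqnorm q x; set B := lqnorm q y.
have [/eqP A0|A0] := boolP (A == 0).
  by rewrite (lqnorm_eq0 q1 A0) add0r lerDr lqnorm_ge0.
have [/eqP B0|B0] := boolP (B == 0).
  by rewrite (lqnorm_eq0 q1 B0) addr0 lerDl lqnorm_ge0.
have {}A0 : 0 < A by rewrite lt0r A0 lqnorm_ge0.
have {}B0 : 0 < B by rewrite lt0r B0 lqnorm_ge0.
have AB : 0 < A + B by exact: addr_gt0.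
have -> : x + y = (A + B) *: ((A / (A + B)) *: (A^-1 *: x) +
    (1 - A / (A + B)) *: (B^-1 *: y)).
  apply/rowP => i; rewrite !mxE; field; rewrite !gt_eqF//.
rewrite lqnormZ ?(ltW AB)// ler_piMr ?(ltW AB)//.
apply: lqnorm_convex => //.
- by rewrite divr_ge0 ?(ltW A0) ?(ltW AB)//= ler_pdivrMr// mul1r lerDl ltW.
- by rewrite lqnormZ ?invr_ge0 ?(ltW A0)// mulVf// gt_eqF.
- by rewrite lqnormZ ?invr_ge0 ?(ltW B0)// mulVf// gt_eqF.
Qed.

Lemma lqnormN q x : lqnorm q (- x) = lqnorm q x.
Proof.
case: q => [r||]; last by [].
  by congr (_ `^ _); apply: eq_bigr => i _; rewrite mxE normrN.
by apply: eq_bigr => i _; rewrite mxE normrN.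
Qed.

Lemma measurable_lqnorm q dT (T : measurableType dT) (V : T -> 'rV[R]_d) :
  (forall i, measurable_fun setT (fun w => V w ord0 i)) ->
  measurable_fun setT (fun w => lqnorm q (V w)).
Proof.
move=> mV; have mN i : measurable_fun setT (fun w => `|V w ord0 i| : R).
  exact: (measurableT_comp (@normr_measurable R setT) (mV i)).
case: q => [r||]/=.
- apply: (measurableT_comp (measurable_powR _)); apply: measurable_sum => i.
  exact: (measurableT_comp (measurable_powR _) (mN i)).
- elim: (index_enum _) => [|i s IH].
    by under [X in measurable_fun _ X]funext do rewrite big_nil; exact: measurable_cst.
  under [X in measurable_fun _ X]funext do rewrite big_cons.
  exact: (measurable_maxr (mN i) IH).
- exact: measurable_cst.
Qed.

End Lqnorm.

(** * Jensen and mean value bounds for the flow *)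

Section NormBound.
Context (R : realType) (dO : measure_display) (Om : measurableType dO).
Variables (P : probability Om R) (d : nat).

(** Take the functional supporting at the mean. By [tilt_witness] some outcome of the almost sure
    event has functional value at least that of the mean, hence at least its norm. *)
Lemma lqnorm_tilt_le (q : \bar R) (a : Om -> R) (V : Om -> 'rV[R]_d) (S : R) :
  (1 <= q)%E -> bounded_mfun a -> (forall i, bounded_mfun (fun w => V w ord0 i)) ->
  {ae P, forall w, lqnorm q (V w) <= S} ->
  lqnorm q (\row_i tilt P a (fun w => V w ord0 i)) <= S.
Proof.
move=> q1 ba bV aeS; set m := \row_i _.
have [c Hc] := lqnorm_support m q1.
have bcV i : bounded_mfun (fun w => c i * V w ord0 i) by exact: bounded_mfunZ.
have bf : bounded_mfun (fun w => \sum_i c i * V w ord0 i) by exact: bounded_mfun_sum.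
have tE : tilt P a (fun w => \sum_i c i * V w ord0 i) = \sum_i c i * m ord0 i.
  rewrite (tilt_sum P ba bcV); apply: eq_bigr => i _.
  by rewrite (tiltZ P ba (c i) (bV i)) mxE.
have [w [wS cw]] := tilt_witness ba bf (lexx _) aeS.
by apply: le_trans wS; apply: Hc; rewrite -tE.
Qed.

Variables (e : 'I_d -> Om -> R) (K : R).
Hypothesis me : forall i, measurable_fun setT (e i).
Hypothesis K0 : 0 <= K.
Hypothesis eK : forall i w, `|e i w| <= K.
Variable u : 'I_d -> R -> R.
Hypothesis du : forall i (s : R), 0 <= s -> is_derive s 1 (u i) (velocity P e s (u ^~ s) i).

(** The mean value theorem fails for vectors but holds for the functional supporting at m, the
    average velocity minus z. The function [F] takes the same value at 0 and tau, so at some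
    intermediate s the functional agrees on m and on velocity minus z; the latter has norm at most
    S. *)
Lemma lqnorm_flow_le (q : \bar R) (z : 'rV[R]_d) (S tau : R) : (1 <= q)%E -> 0 <= tau ->
  {ae P, forall w, lqnorm q ((\row_i e i w) - z) <= S} ->
  lqnorm q ((\row_i u i tau) - tau *: z) <= lqnorm q (\row_i u i 0) + tau * S.
Proof.
move=> q1; rewrite le_eqVlt => /predU1P[<- _|tau0 aeS].
  by rewrite scale0r subr0 mul0r addr0.
pose m : 'rV[R]_d := \row_i ((u i tau - u i 0) / tau - z ord0 i).
have -> : (\row_i u i tau) - tau *: z = (\row_i u i 0) + tau *: m.
  apply/rowP => i; rewrite !mxE; field; by rewrite gt_eqF.
apply: le_trans (ler_lqnormD _ _ q1) _; rewrite lerD2l lqnormZ ?(ltW tau0)// ler_wpM2l ?(ltW tau0)//.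
have [c Hc] := lqnorm_support m q1.
pose F := \sum_i (c i \*: (u i \- ( *%R (z ord0 i + m ord0 i)))) : R -> R.
pose dF (s : R) := \sum_i c i * (velocity P e s (u ^~ s) i - (z ord0 i + m ord0 i)).
have dFs (s : R) : 0 <= s -> is_derive s 1 F (dF s).
  move=> s0; apply: is_derive_sum => i; apply: is_deriveZ.
  by apply: is_deriveB; [exact: du|exact: is_derive_mull].
have FE (s : R) : F s = \sum_i c i * (u i s - (z ord0 i + m ord0 i) * s).
  by rewrite /F fct_sumE.
have dF' (s : R) : s \in `]0, tau[ -> is_derive s 1 F (dF s).
  by rewrite in_itv/= => /andP[s0 _]; exact: dFs (ltW s0).
have cF : {within `[0, tau], continuous F}.
  by apply: (@is_derive_within _ _ dF) => r /andP[r0 _]; exact: dFs.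
have [s] := MVT tau0 dF' cF.
rewrite in_itv/= => /andP[s0 _] H.
have {}H : dF s = 0.
  have : F tau - F 0 = 0.
    rewrite !FE -sumrB big1// => i _; rewrite mulr0 subr0 mxE.
    by field; rewrite gt_eqF.
  rewrite H subr0 => /eqP; rewrite mulf_eq0 (gt_eqF tau0) orbF => /eqP //.
pose V w := (\row_i e i w) - z.
have bV i : bounded_mfun (fun w => V w ord0 i).
  under [X in bounded_mfun X]funext do rewrite !mxE.
  by apply: bounded_mfunB; [exact: bounded_mfun_coord eK i|exact: bounded_mfun_cst].
have ba := bounded_mfun_exponent me eK s (u ^~ s).
apply: le_trans (lqnorm_tilt_le q1 ba bV aeS); apply: Hc.
set v := \row_i _; suff E : dF s = \sum_i c i * v ord0 i - \sum_i c i * m ord0 i.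
  by rewrite -subr_ge0 -E H.
rewrite -sumrB; apply: eq_bigr => i _; rewrite /v mxE /velocity.
have -> : (fun w => V w ord0 i) = (fun w => e i w - z ord0 i).
  by apply/funext => w; rewrite !mxE.
rewrite (tiltB P ba (bounded_mfun_coord me eK i) (bounded_mfun_cst _ (z ord0 i))).
by rewrite (tilt_cst P ba (z ord0 i)); ring.
Qed.

End NormBound.

(** * Gaussian tails in terms of erfc *)

Section Erfc.
Variable R : realType.
Local Notation mu := (@lebesgue_measure R).
Local Notation N01 := (normal_prob (0 : R) 1).

Lemma normal_prob_symm (M : R) : N01 `]-oo, - M] = N01 `[M, +oo[.
Proof.
pose p := normal_pdf (0 : R) 1.
have mp (A : set R) : measurable_fun A (fun x : R => (p x)%:E).
  by apply: measurable_funTS; apply/measurable_EFinP; exact: measurable_normal_pdf.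
rewrite /normal_prob -/p.
rewrite (_ : `]-oo, - M]%classic = (-%R : _ -> measurableTypeR R) @^-1` `[M, +oo[); last first.
  by apply/seteqP; split => x /=; rewrite !in_itv/= andbT lerNr.
have E (x : R) : p x = p (- x) by rewrite /p !std_normal_pdfE sqrrN.
under eq_integral do rewrite E.
rewrite -(@ge0_integral_pushforward _ _ (measurableTypeR R) (measurableTypeR R) R (-%R : R -> R) _ mu _
  (fun x => (p x)%:E))//; last first.
- by move=> x _; rewrite lee_fin normal_pdf_ge0.
- exact: mp.
rewrite [RHS](eq_measure_integral (pushforward mu (-%R : _ -> measurableTypeR R)))//.
by move=> A mA _; exact/esym/lebesgue_measureN.
Qed.

Lemma normal_tail_erfc (M : R) :
  ((2 : R)%:E * N01 `[M, +oo[%classic = (erfc (M / Num.sqrt 2))%:E)%E.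
Proof.
pose s : R := (Num.sqrt 2)^-1.
have s2 : 0 < Num.sqrt 2 :> R by rewrite sqrtr_gt0.
have s0 : 0 < s by rewrite invr_gt0.
pose f (x : R) : \bar R := ((expR (- x ^+ 2)) * \1_`[M * s, +oo[ x)%:E.
have mexp : measurable_fun setT (fun x : R => expR (- x ^+ 2)).
  exact: measurable_gauss_fun.
have mf : measurable_fun setT f.
  by apply/measurable_EFinP; apply: measurable_funM => //; exact: measurable_indic.
have f0 x : (0 <= f x)%E by rewrite lee_fin mulr_ge0 ?expR_ge0// indicE ler0n.
have := ge0_integral_affine 0 s0 mf f0; rewrite /s invrK => H.
have fE : (\int[mu]_x f x = \int[mu]_(x in `[(M / Num.sqrt 2)%R, +oo[) (expR (- x ^+ 2))%:E)%E.
  rewrite [RHS]integral_mkcond; apply: eq_integral => x _.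
  by rewrite /f patchE indicE /s; case: ifP => _; rewrite ?mulr1 ?mulr0.
have NE : N01 `[M, +oo[ = ((normal_peak (1 : R))%:E *
    \int[mu]_x f ((Num.sqrt 2)^-1 * x + 0)%R)%E.
  rewrite -ge0_integralZl//; last 2 first.
  - by apply: (measurableT_comp mf); apply: measurable_funD => //; exact: measurable_funM.
  - by rewrite lee_fin normal_peak_ge0.
  rewrite /normal_prob [LHS]integral_mkcond; apply: eq_integral => x _.
  rewrite addr0 patchE /f indicE -/s.
  have -> : (s * x \in `[(M * s)%R, +oo[%classic) = (x \in `[M, +oo[%classic).
    have Ms : (M * s <= s * x) = (M <= x) by rewrite [M * s]mulrC ler_pM2l.
    by apply/idP/idP => /set_mem xM; apply/mem_set; move: xM;
      rewrite /= !in_itv/= !andbT Ms.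
  case: ifP => _; last by rewrite mulr0 mule0.
  rewrite mulr1 -EFinM std_normal_pdfE; congr (_ * expR (- _))%:E.
  by rewrite /s exprMn exprVn sqr_sqrtr// mulrC.
rewrite NE H fE /erfc.
set I := (\int[mu]_(x in _) _)%E.
have I0 : (0 <= I)%E by apply: integral_ge0 => x _; rewrite lee_fin expR_ge0.
have Ifin : I \is a fin_num.
  rewrite ge0_fin_numE//; apply: (@le_lt_trans _ _ (\int[mu]_x (gauss_fun x)%:E)%E).
    apply: ge0_subset_integral => //.
      by apply/measurable_EFinP; exact: measurable_gauss_fun.
  by rewrite integralT_gauss ltry.
rewrite -(fineK Ifin) -!EFinM; congr EFin; rewrite !mulrA; congr (_ * _).
have -> : normal_peak (1 : R) = (Num.sqrt 2 * Num.sqrt pi)^-1.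
  by rewrite /normal_peak expr1n mul1r -[pi *+ 2]mulr_natl sqrtrM.
by field; rewrite !gt_eqF// sqrtr_gt0 pi_gt0.
Qed.

Lemma normal_prob_erfc (M : R) : 0 < M ->
  N01 `]- M, M[ = (1 - erfc (M / Num.sqrt 2))%:E.
Proof.
move=> M0.
have E : `]- M, M[%classic = ~` (`]-oo, - M]%classic `|` `[M, +oo[%classic).
  apply/seteqP; split => x /=; rewrite !in_itv/= andbT.
    by move=> /andP[a b] []; apply/negP; rewrite -ltNge.
  by move=> /not_orP[/negP + /negP]; rewrite -!ltNge => -> ->.
have m1 : measurable (`]-oo, - M]%classic : set R) by exact: measurable_itv.
have m2 : measurable (`[M, +oo[%classic : set R) by exact: measurable_itv.
rewrite E [LHS](@probability_setC _ _ _ N01); last exact: measurableU.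
rewrite measureU//; last first.
  apply/seteqP; split => x //= []; rewrite !in_itv/= andbT; lra.
rewrite EFinB -normal_tail_erfc mule_natl mule2n.
congr (_ - (_ + _))%E; exact: normal_prob_symm.
Qed.

End Erfc.

(** * Back to the original time *)

Section DerivWithin.
Variable R : realType.

(** With the denominator cleared, the excluded point s = t becomes harmless and the condition
    restricts to subsets of [A] at once. *)
Lemma has_deriv_withinP (V : normedModType R) (A : set R) (f : R -> V) (t : R) (l : V) :
  has_deriv_within A f t l <->
  forall eps : R, 0 < eps -> exists2 delta : R, 0 < delta &
    forall s, A s -> `|s - t| < delta -> `|f s - f t - (s - t) *: l| <= eps * `|s - t|.
Proof.
rewrite /has_deriv_within; split.
  move=> /cvgrPdist_le H eps eps0; have := H eps eps0.
  rewrite near_withinE => /nbhs_ballP[delta /= delta0 Hd].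
  exists delta => // s As st.
  have [->|st0] := eqVneq s t; first by rewrite !subrr scale0r subrr !normr0 mulr0.
  have st' : s - t != 0 by rewrite subr_eq0.
  have : ball 0 delta (s - t) by rewrite /ball/= sub0r normrN.
  move=> /Hd /(_ (conj st' _)); rewrite subrK => /(_ As) h.
  rewrite mulrC -ler_pdivrMl ?normr_gt0//.
  rewrite -normfV -normrZ scalerBr scalerA mulVf// scale1r -normrN opprB.
  exact: h.
move=> H; apply/cvgrPdist_le => eps eps0; have [delta d0 Hd] := H eps eps0.
rewrite near_withinE; apply/nbhs_ballP; exists delta => //= h.
rewrite /ball/= sub0r normrN => hd [h0 Ah].
have := Hd _ Ah; rewrite addrK => /(_ hd) hh.
rewrite -(@ler_pM2l _ `|h|) ?normr_gt0// -normrZ scalerBr scalerA divff// scale1r.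
by rewrite -normrN opprB mulrC.
Qed.

Lemma is_derive_eps (f : R -> R) (t l : R) : is_derive t 1 f l ->
  forall eps : R, 0 < eps -> exists2 delta : R, 0 < delta &
    forall s, `|s - t| < delta -> `|f s - f t - (s - t) * l| <= eps * `|s - t|.
Proof.
move=> df; suff : has_deriv_within setT f t l.
  by move=> /has_deriv_withinP H eps /H[delta d0 Hd]; exists delta => // s; exact: Hd.
case: df => dfx fl; move: dfx; rewrite /derivable => /cvg_ex [l' H].
have ll' : l = l' by rewrite -fl /derive; exact: (cvg_lim _ H).
move: H; rewrite -ll' /has_deriv_within /dnbhs => H.
move=> B /H; rewrite /= !near_simpl !near_withinE.
apply: filterS => h Hh [h0 _].
by have := Hh h0; rewrite [h *: 1]mulr1.
Qed.

Lemma is_derive_of_eps (f : R -> R) (t l : R) :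
  (forall eps : R, 0 < eps -> exists2 delta : R, 0 < delta &
    forall s, `|s - t| < delta -> `|f s - f t - (s - t) * l| <= eps * `|s - t|) ->
  is_derive t 1 f l.
Proof.
move=> H; have {}H : has_deriv_within setT f t l.
  by apply/has_deriv_withinP => eps /H[delta d0 Hd]; exists delta => // s _; exact: Hd.
have C : (fun h => h^-1 *: (f (h *: 1 + t) - f t)) @ 0^' --> l.
  move: H; rewrite /has_deriv_within /dnbhs => H.
  move=> B /H; rewrite /= !near_simpl !near_withinE.
  by apply: filterS => h Hh h0; have := Hh (conj h0 I); rewrite [h *: 1]mulr1.
by apply: DeriveDef; [apply/cvg_ex; exists l|exact: (cvg_lim _ C)].
Qed.

(** The error splits into that of [g], estimated through |s r - s t| <= (|l| + 1) |r - t|, and g'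
    times that of [s]; each receives half of eps. *)
Lemma has_deriv_within_comp (A : set R) (g s : R -> R) (t l g' : R) :
  is_derive (s t) 1 g g' -> has_deriv_within A s t l ->
  has_deriv_within A (g \o s) t (g' * l).
Proof.
move=> dg /has_deriv_withinP ds; apply/has_deriv_withinP => eps eps0.
have L0 : 0 < `|l| + 1 by rewrite ltr_wpDl.
have e1 : 0 < eps / 2 / (`|l| + 1) by rewrite !divr_gt0.
have e2 : 0 < Num.min 1 (eps / 2 / (`|g'| + 1)).
  by rewrite lt_min ltr01 !divr_gt0// ltr_wpDl.
have [d1 d10 H1] := is_derive_eps dg e1.
have [d2 d20 H2] := ds _ e2.
exists (Num.min d2 (d1 / (`|l| + 1))) => [|r Ar].
  by rewrite lt_min d20 divr_gt0.
rewrite lt_min => /andP[r2 r1].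
have h2 := H2 r Ar r2.
have e21 : Num.min 1 (eps / 2 / (`|g'| + 1)) <= 1 by rewrite ge_min lexx.
have e22 : Num.min 1 (eps / 2 / (`|g'| + 1)) <= eps / 2 / (`|g'| + 1).
  by rewrite ge_min lexx orbT.
have h3 : `|s r - s t| <= (`|l| + 1) * `|r - t|.
  have := ler_normD (s r - s t - (r - t) *: l) ((r - t) *: l).
  rewrite subrK normrZ => h; apply: le_trans h _.
  have := ler_wpM2r (normr_ge0 (r - t)) e21; rewrite mul1r => h4.
  lra.
have h5 : `|s r - s t| < d1.
  apply: le_lt_trans h3 _; by rewrite mulrC -ltr_pdivlMr.
have h6 := H1 _ h5.
have -> : (g \o s) r - (g \o s) t - (r - t) *: (g' * l) =
    (g (s r) - g (s t) - (s r - s t) * g') + g' * (s r - s t - (r - t) *: l).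
  by rewrite /= /GRing.scale/=; ring.
apply: le_trans (ler_normD _ _) _.
have -> : eps * `|r - t| = eps / 2 * `|r - t| + eps / 2 * `|r - t|.
  by rewrite -mulrDl -splitr.
apply: lerD.
  apply: le_trans h6 _; apply: le_trans (ler_wpM2l (ltW e1) h3) _.
  by rewrite mulrA divfK// gt_eqF.
rewrite normrM; apply: le_trans (ler_wpM2l (normr_ge0 g') h2) _.
rewrite mulrA ler_wpM2r//; apply: le_trans (ler_wpM2l (normr_ge0 g') e22) _.
have G0 : 0 < `|g'| + 1 by rewrite ltr_wpDl.
rewrite mulrA ler_pdivrMr// mulrC ler_wpM2l ?divr_ge0 ?(ltW eps0)//.
by rewrite lerDl.
Qed.

Lemma rV_norm_le d (x : 'rV[R]_d) (c : R) : 0 <= c ->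
  (`|x| <= c) = [forall i, `|x ord0 i| <= c].
Proof.
move=> c0; rewrite [X in (X <= _) = _]/Num.norm /= mx_normrE; apply/idP/forallP => [xc i|H].
  apply: le_trans xc.
  exact: (le_bigmax _ (fun ij : 'I_1 * 'I_d => `|x ij.1 ij.2|) (ord0, i)).
by apply: bigmax_le => // -[i j] _ /=; rewrite (ord1 i); exact: H.
Qed.

Lemma has_deriv_within_rV d (A : set R) (f : R -> 'rV[R]_d) (t : R) (l : 'rV[R]_d) :
  has_deriv_within A f t l <->
  forall i, has_deriv_within A (fun s => f s ord0 i) t (l ord0 i).
Proof.
split=> [/has_deriv_withinP H i|H]; apply/has_deriv_withinP => eps eps0.
  have [delta d0 Hd] := H eps eps0; exists delta => // s As st.
  have e0 : 0 <= eps * `|s - t| by rewrite mulr_ge0// ltW.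
  have := Hd s As st; rewrite rV_norm_le// => /forallP/(_ i).
  by rewrite !mxE.
have {}H i := (has_deriv_withinP _ _ _ _).1 (H i) eps eps0.
pose del i := projT1 (cid2 (H i)).
have del0 i : 0 < del i by rewrite /del; case: cid2.
exists (\big[Num.min/1]_i del i).
  by apply: (big_ind (fun x => 0 < x)) => // x y x0 y0; rewrite lt_min x0.
move=> s As st; have e0 : 0 <= eps * `|s - t| by rewrite mulr_ge0// ltW.
rewrite rV_norm_le//; apply/forallP => i; rewrite !mxE.
have : `|s - t| < del i.
  by apply: lt_le_trans st _; exact: bigmin_le.
by rewrite /del; case: cid2 => /= delta _ Hd; exact: Hd.
Qed.

Lemma has_deriv_within_continuous (A : set R) (f : R -> R) (t l : R) :
  has_deriv_within A f t l -> forall eps : R, 0 < eps -> exists2 delta : R, 0 < delta &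
  forall s, A s -> `|s - t| < delta -> `|f s - f t| <= eps.
Proof.
move=> /has_deriv_withinP H eps eps0; have [d1 d10 H1] := H 1 ltr01.
have L0 : 0 < `|l| + 1 by rewrite ltr_wpDl.
exists (Num.min d1 (eps / (`|l| + 1))); first by rewrite lt_min d10 divr_gt0.
move=> s As; rewrite lt_min => /andP[s1 s2].
have h1 := H1 s As s1; rewrite mul1r in h1.
have := ler_normD (f s - f t - (s - t) *: l) ((s - t) *: l).
rewrite subrK normrZ => h; apply: le_trans h _.
move: s2; rewrite ltr_pdivlMr// => s2.
lra.
Qed.

End DerivWithin.

(** Here D is the squared l^1 distance of two solutions, Q the squared Euclidean one and n the
    dimension; the premise is Cauchy-Schwarz. *)
Lemma gronwall_rate (R : realFieldType) (A L D n Q : R) :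
  A * L * D <= A * L * (n * Q) -> 2 * (A * (Q + L * D)) <= 2 * (A * (1 + L * n)) * Q.
Proof. lra. Qed.

(** * The drift in rescaled variables, solution and uniqueness *)

Section ODE.
Context (R : realType) (d : nat) (T : \bar R) (sigma sigma' : R -> R).
Context (dO : measure_display) (Om : measurableType dO).
Variables (P : probability Om R) (eta : Om -> 'rV[R]_d).
Variables (e : 'I_d -> Om -> R) (K : R).
Hypothesis me : forall i, measurable_fun setT (e i).
Hypothesis meta : forall i, measurable_fun setT (fun w => eta w ord0 i).
Hypothesis K0 : 0 <= K.
Hypothesis eK : forall i w, `|e i w| <= K.
Hypothesis ae_e : {ae P, forall w, forall i, eta w ord0 i = e i w}.
Hypothesis T0 : (0 < T)%E.
Hypothesis HH : assumption_H T sigma sigma'.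

Lemma I0T0 : I0T T 0. Proof. by split. Qed.

Lemma sigma_gt0 t : I0T T t -> 0 < sigma t.
Proof. by case: HH => _ [+ _]; exact. Qed.

Lemma sigma_le1 t : I0T T t -> sigma t <= 1.
Proof.
case: HH => _ [_ [H [_ [_ [s0 _]]]]] It; have [->|t0] := eqVneq t 0; first by rewrite s0.
rewrite -s0 ltW//; apply: (H 0 t I0T0 It).
by rewrite lt0r t0; case: It.
Qed.

Lemma sigma_deriv t : I0T T t -> has_deriv_within (I0T T) sigma t (sigma' t).
Proof. by case: HH => _ [_ [_ [H _]]]; exact: H. Qed.

Lemma sigma0 : sigma 0 = 1.
Proof. by case: HH => _ [_ [_ [_ [_ [+ _]]]]]. Qed.

Lemma I0T_le s t : 0 <= s -> s <= t -> I0T T t -> I0T T s.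
Proof. by move=> s0 st [t0 tT]; split => //; apply: le_lt_trans tT; rewrite lee_fin. Qed.

Lemma sigma_ler s t : 0 <= s -> s <= t -> I0T T t -> sigma t <= sigma s.
Proof.
case: HH => _ [_ [H _]] s0; rewrite le_eqVlt => /predU1P[->//|st] It.
by rewrite ltW//; exact: (H s t (I0T_le s0 (ltW st) It) It st).
Qed.

(** Expanding the square isolates a term in x alone, which cancels in the quotient defining
    [Dmu]. *)
Lemma Gamma_tilt_exponent t (x y : 'rV[R]_d) (w : Om) : sigma t != 0 ->
  (forall i, y ord0 i = e i w) ->
  - Gamma sigma t x y = - (sqnorm2 x / (2 * sigma t ^+ 2)) +
    tilt_exponent e (beta sigma t / sigma t) (fun i => x ord0 i / sigma t) w.
Proof.
move=> s0 ye; rewrite /Gamma /tilt_exponent /sqnorm2.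
rewrite !mulr_suml !mulr_sumr -!sumrN -!big_split/=; apply: eq_bigr => i _.
by rewrite !mxE ye; field.
Qed.

Lemma Dmu_velocity t x : sigma t != 0 ->
  Dmu P eta sigma t x = \row_i velocity P e (beta sigma t / sigma t)
    (fun i => x ord0 i / sigma t) i.
Proof.
move=> s0; pose a := tilt_exponent e (beta sigma t / sigma t) (fun i => x ord0 i / sigma t).
have ba : bounded_mfun a by exact: bounded_mfun_exponent eK _ _.
have be := bounded_mfun_exp ba.
pose c := expR (- (sqnorm2 x / (2 * sigma t ^+ 2))).
have mG : measurable_fun setT (fun w => Gamma sigma t x (eta w)).
  rewrite /Gamma /sqnorm2; apply: measurable_funM => //.
  apply: measurable_sum => i; apply: measurable_funX.
  under [X in measurable_fun _ X]funext do rewrite !mxE.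
  by apply: measurable_funB => //; exact: measurable_funM.
have mexp : measurable_fun setT (fun w => expR (- Gamma sigma t x (eta w))).
  by apply: measurableT_comp => //; exact: measurableT_comp.
have aeG : {ae P, forall w, expR (- Gamma sigma t x (eta w)) = c * expR (a w)}.
  by apply: filterS ae_e => w H; rewrite /c -expRD (Gamma_tilt_exponent x s0 H).
have key (f g : Om -> R) : measurable_fun setT f -> bounded_mfun g ->
    {ae P, forall w, f w = g w} ->
    Rintegral P setT (fun w => f w * expR (- Gamma sigma t x (eta w))) =
    c * Rintegral P setT (fun w => g w * expR (a w)).
  move=> mf bg aefg; rewrite -RintegralZl//; last first.
    by apply: bounded_mfun_integrable; exact: bounded_mfunM.
  congr fine; apply: ae_eq_integral => //.
  - by apply/measurable_EFinP; exact: measurable_funM.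
  - by apply/measurable_EFinP; apply: measurable_funM => //; apply: measurable_funM; [case: bg|case: be].
  - apply: filterS2 aefg aeG => w fg G _ /=.
    by rewrite fg G mulrCA.
apply/rowP => i; rewrite !mxE /velocity /tilt -/a.
rewrite (key _ _ (meta i) (bounded_mfun_coord me eK i)); last first.
  by apply: filterS ae_e => w; exact.
have -> : Rintegral P setT (fun w => expR (- Gamma sigma t x (eta w))) = c * tilt_mass P a.
  transitivity (Rintegral P setT (fun w => (cst 1 w : R) * expR (- Gamma sigma t x (eta w)))).
    by apply: eq_Rintegral => w _; rewrite mul1r.
  rewrite (key _ _ (measurable_cst _) (bounded_mfun_cst _ 1)); last exact: aeW.
  by congr (_ * _); apply: eq_Rintegral => w _; rewrite mul1r.
by rewrite -mulf_div divff ?mul1r// gt_eqF// expR_gt0.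
Qed.

Lemma beta_sigma t : sigma t != 0 -> beta sigma t / sigma t = (sigma t)^-1 - 1.
Proof. by move=> s0; rewrite /beta; field. Qed.

Lemma beta_sigma_ge0 t : I0T T t -> 0 <= beta sigma t / sigma t.
Proof.
move=> It; rewrite divr_ge0 ?(ltW (sigma_gt0 It))// subr_ge0; exact: sigma_le1.
Qed.

Lemma drift_velocity t (x : 'rV[R]_d) i : I0T T t ->
  drift P eta sigma sigma' t x ord0 i = sigma' t / sigma t *
    (x ord0 i - velocity P e (beta sigma t / sigma t) (fun i => x ord0 i / sigma t) i).
Proof.
by move=> It; rewrite /drift Dmu_velocity ?gt_eqF ?sigma_gt0// !mxE.
Qed.

(** Each coordinate is G(sigma_t) with G(s) = s u(1/s - 1). At t = 0 only sigma is differentiated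
    from one side: u has a two-sided derivative at 0, so G has one at 1. *)
Lemma rescaled_flow_solution (u : 'I_d -> R -> R) t : I0T T t ->
  (forall i (s : R), 0 <= s -> is_derive s 1 (u i) (velocity P e s (u ^~ s) i)) ->
  let Y s := \row_i (sigma s * u i (beta sigma s / sigma s)) in
  has_deriv_within (I0T T) Y t (drift P eta sigma sigma' t (Y t)).
Proof.
move=> It du Y; have s0 := sigma_gt0 It; have sN0 : sigma t != 0 by rewrite gt_eqF.
apply/has_deriv_within_rV => i; rewrite drift_velocity//.
pose G (s : R) := s * u i (s^-1 - 1).
pose tau := (sigma t)^-1 - 1.
have tau0 : 0 <= tau by rewrite /tau -beta_sigma// beta_sigma_ge0.
have dG : is_derive (sigma t) 1 G (u i tau - velocity P e tau (u ^~ tau) i / sigma t).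
  pose g (s : R) : R := s^-1 - 1.
  have dinv : is_derive (sigma t) 1 g (- (sigma t) ^- 2).
    have d1 : is_derive (sigma t) 1 (fun s : R => s^-1) (- (sigma t) ^- 2).
      apply: DeriveDef; first by apply: derivableV => //; exact: derivable_id.
      by rewrite deriveV// derive_id [_ *: 1]mulr1.
    have := is_deriveB d1 (is_derive_cst (1 : R) (sigma t) 1).
    by rewrite subr0.
  have dui : is_derive (g (sigma t)) 1 (u i) (velocity P e tau (u ^~ tau) i) by exact: du.
  have dc := is_derive1_comp dui dinv.
  have := is_deriveM (is_derive_id (sigma t) 1) dc.
  have -> : sigma t *: (velocity P e tau (u ^~ tau) i * - (sigma t) ^- 2) +
      (u i \o g) (sigma t) *: 1 = u i tau - velocity P e tau (u ^~ tau) i / sigma t.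
    by rewrite /GRing.scale/= -/tau; field.
  by [].
have := has_deriv_within_comp dG (sigma_deriv It).
have -> : (u i tau - velocity P e tau (u ^~ tau) i / sigma t) * sigma' t =
   sigma' t / sigma t * (Y t ord0 i - velocity P e (beta sigma t / sigma t)
     (fun i => Y t ord0 i / sigma t) i).
  have -> : (fun i => Y t ord0 i / sigma t) = u ^~ tau.
    by apply/funext => j; rewrite mxE beta_sigma// -/tau; field.
  by rewrite mxE beta_sigma// -/tau; field.
move=> /has_deriv_withinP H; apply/has_deriv_withinP => eps /H[delta d0 Hd].
exists delta => // s Is st; have := Hd s Is st.
by rewrite /G /= !mxE !beta_sigma ?gt_eqF// sigma_gt0.
Qed.

(** The squared distance times exp(- C s) does not increase on [0, t]: there [sigma] stays above
    sigma_t > 0 and [sigma'] is bounded, so the drift is uniformly Lipschitz in space. *)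
Lemma ode_unique (Y Z : R -> 'rV[R]_d) :
  (forall t, I0T T t -> has_deriv_within (I0T T) Y t (drift P eta sigma sigma' t (Y t))) ->
  (forall t, I0T T t -> has_deriv_within (I0T T) Z t (drift P eta sigma sigma' t (Z t))) ->
  Y 0 = Z 0 -> forall t, I0T T t -> Z t = Y t.
Proof.
move=> dY dZ YZ0 t It.
have [t0 _] := It.
have [H HB] : exists H : R, forall s, 0 <= s <= t -> `|sigma' s| <= H.
  by case: HH => _ [_ [_ [_ [+ _]]]]; exact.
have H0 : 0 <= H by apply: le_trans (HB 0 _); rewrite // lexx t0.
have st0 := sigma_gt0 It.
pose A := H / sigma t.
have A0 : 0 <= A by rewrite divr_ge0// ltW.
(* One factor 1 / sigma_t bounds the rescaled time beta / sigma, the other comes from the rescaled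
   argument x / sigma. *)
pose L := 4 * K ^+ 2 * (sigma t)^-1 * (sigma t)^-1.
have L0 : 0 <= L by rewrite /L !mulr_ge0 ?exprn_ge0// invr_ge0 ltW.
pose C := 2 * (A * (1 + L * d%:R)).
pose dl i (s : R) : R := Z s ord0 i - Y s ord0 i.
pose b (X : R -> 'rV[R]_d) i s := drift P eta sigma sigma' s (X s) ord0 i.
have inner (s : R) (X : R -> 'rV[R]_d) i :
    (forall t, I0T T t -> has_deriv_within (I0T T) X t (drift P eta sigma sigma' t (X t))) ->
    0 < s < t -> is_derive s 1 (fun r => X r ord0 i) (b X i s).
  move=> dX /andP[s0 st]; have Is : I0T T s by exact: I0T_le (ltW s0) (ltW st) It.
  have := (has_deriv_within_rV _ _ _ _).1 (dX s Is) i.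
  move=> /has_deriv_withinP h; apply: is_derive_of_eps => eps /h[delta d0 Hd].
  exists (Num.min delta (Num.min s (t - s))) => [|r].
    by rewrite !lt_min d0 s0 subr_gt0 st.
  rewrite !lt_min => /and3P[r1 r2 r3]; apply: Hd => //.
  have := ler_norm (r - s); have := ler_norm (- (r - s)); rewrite normrN => h1 h2.
  by apply: (@I0T_le r t _ _ It); lra.
have cont (X : R -> 'rV[R]_d) i :
    (forall t, I0T T t -> has_deriv_within (I0T T) X t (drift P eta sigma sigma' t (X t))) ->
    forall s, s \in `[0, t] -> X r ord0 i @[r --> within `[0, t]%classic (nbhs s)] --> X s ord0 i.
  move=> dX s /=; rewrite in_itv/= => /andP[s0 st].
  have Is : I0T T s by exact: I0T_le It.
  have := (has_deriv_within_rV _ _ _ _).1 (dX s Is) i.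
  move=> /has_deriv_within_continuous h.
  apply/cvgrPdist_le => eps /h[delta d0 Hd].
  rewrite near_withinE; apply/nbhs_ballP; exists delta => //= r.
  rewrite /ball/= distrC => rs; rewrite in_itv/= => /andP[r0 rt].
  by rewrite distrC; apply: Hd => //; exact: I0T_le It.
pose Ef : R -> R := expR \o ( *%R (- C)).
pose Sf : R -> R := \sum_i (dl i * dl i).
have SfE s : Sf s = \sum_i dl i s ^+ 2 by rewrite /Sf fct_sumE.
pose W : R -> R := Ef * Sf.
pose dS (s : R) := \sum_i (dl i s * (b Z i s - b Y i s) + dl i s * (b Z i s - b Y i s)).
pose dW (s : R) := Ef s * dS s + Sf s * (Ef s * - C).
have dWs (s : R) : 0 < s < t -> is_derive s 1 W (dW s).
  move=> s0t.
  have dE : is_derive s 1 Ef (Ef s * - C).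
    by apply: is_derive1_comp; exact: is_derive_mull.
  have dSf : is_derive s 1 Sf (dS s).
    apply: is_derive_sum => i.
    have ddl : is_derive s 1 (dl i) (b Z i s - b Y i s).
      by apply: is_deriveB; apply: inner.
    exact: (is_deriveM ddl ddl).
  exact: (is_deriveM dE dSf).
have cW : {within `[0, t], continuous W}.
  apply/subspace_continuousP => s /= s0t.
  apply: cvgM.
    apply: cvg_within_filter; apply: (cvg_comp ( *%R (- C)) expR); last exact: continuous_expR.
    by apply: cvgM; [exact: cvg_cst|exact: cvg_id].
  have -> : Sf = fun r => \sum_i dl i r * dl i r.
    by apply/funext => r; rewrite SfE; apply: eq_bigr => i _; rewrite expr2.
  apply: cvg_sumr => i.
  by apply: cvgM; apply: cvgB; apply: cont.
have dW0 s : 0 < s < t -> dW s <= 0.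
  move=> /andP[s0 st].
  have -> : dW s = Ef s * (dS s - C * Sf s) by rewrite /dW; ring.
  rewrite pmulr_rle0 ?expR_gt0// subr_le0 SfE.
  have Is : I0T T s by exact: I0T_le (ltW s0) (ltW st) It.
  have ss0 := sigma_gt0 Is; have sst := sigma_ler (ltW s0) (ltW st) It.
  have inv_le : (sigma s)^-1 <= (sigma t)^-1 by rewrite lef_pV2 ?posrE.
  pose D := \sum_j `|dl j s|.
  have key i : dl i s * (b Z i s - b Y i s) <= A * (dl i s ^+ 2 + L * (`|dl i s| * D)).
    have bE X : b X i s = sigma' s / sigma s * (X s ord0 i -
        velocity P e (beta sigma s / sigma s) (fun i => X s ord0 i / sigma s) i).
      exact: drift_velocity.
    rewrite !bE.
    set k := sigma' s / sigma s.
    have kA : `|k| <= A.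
      rewrite /k /A normrM normfV (gtr0_norm ss0) ler_pM ?invr_ge0 ?(ltW ss0)//.
      by apply: HB; rewrite !ltW.
    set vz := velocity _ _ _ _ _; set vy := velocity _ _ _ _ _.
    have vL : `|vz - vy| <= L * D.
      apply: le_trans (velocity_lipschitz P me K0 eK _ _ _ _) _.
      rewrite ger0_norm ?beta_sigma_ge0// beta_sigma ?gt_eqF//.
      have -> : \sum_i `|Z s ord0 i / sigma s - Y s ord0 i / sigma s| = (sigma s)^-1 * D.
        rewrite /D mulr_sumr; apply: eq_bigr => j _.
        by rewrite -mulrBl normrM normfV (gtr0_norm ss0) mulrC.
      rewrite mulrA ler_wpM2r ?sumr_ge0// /L -!mulrA; apply: ler_wpM2l => //.
      have ts0 : 0 <= (sigma s)^-1 - 1 by rewrite -beta_sigma ?gt_eqF// beta_sigma_ge0.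
      have is0 : 0 <= (sigma s)^-1 by rewrite invr_ge0 ltW.
      do 2 apply: (ler_wpM2l K0); apply: ler_pM => //.
      by apply: le_trans inv_le; rewrite lerBlDr lerDl.
    have -> : dl i s * (k * (Z s ord0 i - vz) - k * (Y s ord0 i - vy)) =
      k * (dl i s ^+ 2) + k * (dl i s * - (vz - vy)) by rewrite /dl; ring.
    rewrite mulrDr; apply: lerD.
      by rewrite ler_wpM2r ?sqr_ge0//; apply: le_trans kA; exact: ler_norm.
    apply: le_trans (ler_norm _) _; rewrite normrM [`|dl i s * _|]normrM normrN.
    have dvL : `|dl i s| * `|vz - vy| <= L * (`|dl i s| * D).
      by rewrite mulrCA; apply: ler_wpM2l.
    apply: (ler_pM _ _ kA dvL) => //.
  apply: (@le_trans _ _ (2 * \sum_i (A * (dl i s ^+ 2 + L * (`|dl i s| * D))))).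
    by rewrite mulr_sumr; apply: ler_sum => i _; rewrite [leRHS]mulr_natl mulr2n; apply: lerD.
  rewrite -mulr_sumr big_split/= -mulr_sumr -mulr_suml -/D.
  have D2 : D * D <= d%:R * \sum_i dl i s ^+ 2.
    have := sqr_sum_le (fun i => `|dl i s|); rewrite -/D expr2.
    by under eq_bigr do rewrite real_normK ?num_real//.
  have AL : 0 <= A * L by exact: mulr_ge0.
  exact: gronwall_rate (ler_wpM2l AL D2).
have W0 : W t <= W 0.
  rewrite -subr_ge0.
  have := @derive_ge0_le _ (- W) (- dW) 0 t t0; rewrite lerN2 subr_ge0; apply.
  - by move=> s s0t; apply: is_deriveN; exact: dWs.
  - by move=> s; apply: continuousN; exact: cW.
  - by move=> s /dW0; rewrite [(- dW) s]/(- (dW s)) oppr_ge0.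
apply/rowP => i.
have : \sum_i dl i t ^+ 2 <= 0.
  have S00 : Sf 0 = 0 by rewrite SfE big1// => j _; rewrite /dl YZ0 subrr expr0n.
  move: W0; rewrite -SfE -[W t]/(Ef t * Sf t) -[W 0]/(Ef 0 * Sf 0) S00.
  by rewrite mulr0 pmulr_rle0// expR_gt0.
rewrite (bigD1 i)//= => S0.
have : dl i t ^+ 2 <= 0.
  apply: le_trans S0; rewrite lerDl; apply: sumr_ge0 => j _; exact: sqr_ge0.
by rewrite le_eqVlt ltNge sqr_ge0 orbF sqrf_eq0 subr_eq0 => /eqP.
Qed.

End ODE.

Section Density.
Context (R : realType) (dO : measure_display) (Om : measurableType dO).
Variables (P : probability Om R) (d : nat) (X E : Om -> d.-tuple R).
Variables (eta : Om -> 'rV[R]_d) (sigma : R -> R).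
Hypothesis mX : measurable_fun setT X.
Hypothesis mE : measurable_fun setT E.
Hypothesis meta : forall i, measurable_fun setT (fun w => eta w ord0 i).
Hypothesis XE_indep : forall (A : 'I_d -> set R) (B : set (d.-tuple R)),
  (forall i, measurable (A i)) -> measurable B ->
  P ([set w | forall i, A i (tnth (X w) i)] `&` E @^-1` B) =
  ((\prod_(i < d) normal_prob 0 1 (A i)) * P (E @^-1` B))%E.
Let e (i : 'I_d) (w : Om) : R := tnth (E w) i.
Hypothesis ae_e : {ae P, forall w, forall i, eta w ord0 i = e i w}.

Let me i : measurable_fun setT (e i).
Proof. exact: (measurableT_comp (measurable_tnth i) mE). Qed.

Lemma prod_normal_pdf_rho (s : R) (x : 'I_d -> R) : 0 < s ->
  \prod_i (s^-1 * normal_pdf 0 1 (x i / s)) = rho s (\row_i x i).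
Proof.
move=> s0; have sN0 : s != 0 by rewrite gt_eqF.
have c0 : 0 <= 2 * pi * s ^+ 2 by rewrite mulr_ge0 ?sqr_ge0 ?mulr_ge0 ?pi_ge0.
under eq_bigr do rewrite std_normal_pdfE mulrA.
rewrite big_split/= prodr_const card_ord -expR_sum /rho; congr (_ * expR _).
  rewrite powRN [d%:R / 2]mulrC powRrM powR12_sqrt// powR_mulrn ?sqrtr_ge0// -exprVn; congr (_ ^+ _).
  rewrite /normal_peak expr1n mul1r sqrtrM ?mulr_ge0 ?pi_ge0// sqrtr_sqr gtr0_norm//.
  by rewrite invfM mulrC -mulr_natl.
rewrite /sqnorm2 sumrN mulNr mulr_suml; congr (- _); apply: eq_bigr => i _.
by rewrite mxE; field.
Qed.

Lemma phi_tilt (t : R) (x : 'I_d -> R) : 0 < sigma t ->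
  phi P eta sigma t (\row_i x i) =
  ((rho (sigma t) (\row_i x i))%:E *
   \int[P]_w (expR (tilt_exponent e (beta sigma t / sigma t) (fun i => x i / sigma t) w))%:E)%E.
Proof.
move=> s0; have sN0 : sigma t != 0 by rewrite gt_eqF.
have mtilt : measurable_fun setT (fun w => (expR (tilt_exponent e (beta sigma t / sigma t)
    (fun i => x i / sigma t) w))%:E).
  apply/measurable_EFinP; apply: measurableT_comp => //.
  have xE : (fun i => x i / sigma t) = tnth [tuple x i / sigma t | i < d].
    by apply/funext => i; rewrite tnth_mktuple.
  rewrite xE; exact: (measurable_fun_pair2 [tuple x i / sigma t | i < d]
    (measurable_tilt_exponent mE (beta sigma t / sigma t))).
have r0 (y : 'rV[R]_d) : 0 <= rho (sigma t) y by rewrite mulr_ge0 ?powR_ge0 ?expR_ge0.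
rewrite -(ge0_integralZl P measurableT mtilt); last 2 first.
- by move=> w _; rewrite lee_fin expR_ge0.
- by rewrite lee_fin.
apply: ae_eq_integral => //.
- apply/measurable_EFinP; apply: measurable_funM => //; apply: measurableT_comp => //.
  apply: measurable_funM => //; apply: measurableT_comp => //.
  apply: measurable_sum => i; apply: measurable_funX.
  under [X in measurable_fun _ X]funext do rewrite !mxE.
  by apply: measurable_funB => //; exact: measurable_funM.
- exact: emeasurable_funM.
apply: filterS ae_e => w H _ /=.
rewrite -EFinM; congr EFin; rewrite /rho -[RHS]mulrA -expRD; congr (_ * expR _).
have := Gamma_tilt_exponent (\row_i x i) sN0 H; rewrite /Gamma !mulNr => ->.
by congr (_ + tilt_exponent _ _ _ _); apply/funext => i; rewrite mxE.
Qed.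

(** X + tau E has the tilt mass as density against the Gaussian law, and scaling by sigma_t turns
    that law into [rho] times Lebesgue measure; [phi_tilt] recognises the product as [phi]. *)
Lemma shift_law_density (t : R) (A : set (d.-tuple R)) : 0 < sigma t -> measurable A ->
  P [set w | A [tuple sigma t * tnth (shift_tuple (beta sigma t / sigma t) (X w) (E w)) i | i < d]] =
  iint (fun x => ((\1_A x)%:E * phi P eta sigma t (t2rv x))%E).
Proof.
move=> s0 mA; set tau := beta sigma t / sigma t.
pose sc (x : d.-tuple R) := [tuple sigma t * tnth x i | i < d].
have msc : measurable_fun setT sc.
  apply: measurable_tuple_map => i; apply: measurable_funM => //; exact: measurable_tnth.
pose F x : \bar R := (\1_A (sc x))%:E.
have mF : measurable_fun setT F.
  apply/measurable_EFinP; apply: (measurableT_comp _ msc); exact: measurable_indic.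
have F0 x : (0 <= F x)%E by rewrite lee_fin.
transitivity (\int[P]_w F (shift_tuple tau (X w) (E w)))%E.
  have mS : measurable ((fun w => sc (shift_tuple tau (X w) (E w))) @^-1` A).
    rewrite -[X in measurable X]setTI.
    exact: (measurableT_comp msc (measurable_shift_tuple tau mX mE)).
  have := integral_indic P measurableT mS; rewrite setIT => /esym h.
  by rewrite [LHS]h; apply: eq_integral => w _; rewrite /F !indicE.
rewrite (ge0_integral_shift mX mE XE_indep)//.
pose L (x : d.-tuple R) : \bar R := (\int[P]_w (expR (tilt_exponent e tau (tnth x) w))%:E)%E.
(* The integrand as a function of the scaled point, the form [gauss_scale] requires. *)
pose G (x : d.-tuple R) : \bar R := ((\1_A x)%:E * L [tuple (tnth x i / sigma t)%R | i < d])%E.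
have mL : measurable_fun setT L.
  apply: (measurable_fun_fubini_tonelli_F (m2 := P)
    (fun z : d.-tuple R * Om => (expR (tilt_exponent e tau (tnth z.1) z.2))%:E)).
  - by apply/measurable_EFinP; apply: measurableT_comp => //; exact: measurable_tilt_exponent.
  - by move=> z; rewrite lee_fin expR_ge0.
transitivity (\int[gauss R d]_x G (sc x))%E.
  apply: eq_integral => x _; rewrite /G; congr (_ * L _)%E.
  by apply: eq_from_tnth => i; rewrite !tnth_mktuple mulrAC mulfV ?mul1r// gt_eqF.
rewrite gauss_scale//; last 2 first.
- apply: emeasurable_funM.
    by apply/measurable_EFinP; exact: measurable_indic.
  apply: (measurableT_comp mL); apply: measurable_tuple_map => i.
  by apply: measurable_funM => //; exact: measurable_tnth.
- move=> x; rewrite mule_ge0 ?lee_fin//; apply: integral_ge0 => w _.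
  by rewrite lee_fin expR_ge0.
congr iint; apply/funext => x.
have LE : tnth [tuple (tnth x i / sigma t)%R | i < d] = (fun i => tnth x i / sigma t).
  by apply/funext => i; rewrite tnth_mktuple.
by rewrite prod_normal_pdf_rho// /t2rv phi_tilt// /G /L LE -muleA [X in (_ * X)%E = _]muleC.
Qed.

End Density.

(** * Transport cost of an explicit coupling *)

Section Wasserstein.
Context (R : realType) (dO : measure_display) (Om : measurableType dO).
Variables (P : probability Om R) (d : nat) (q : \bar R) (p : R).

Lemma wasserstein_le (mu nu : set (d.-tuple R) -> \bar R) (V W : Om -> d.-tuple R) :
  measurable_fun setT V -> measurable_fun setT W ->
  (forall A, measurable A -> P (V @^-1` A) = mu A) ->
  (forall A, measurable A -> P (W @^-1` A) = nu A) ->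
  (wasserstein q p mu nu <=
   (\int[P]_w (lqnorm q (t2rv (V w) - t2rv (W w)) `^ p)%:E) `^ p^-1)%E.
Proof.
move=> mV mW lV lW.
have mVW : measurable_fun setT (fun w => (V w, W w)) by exact: measurable_fun_pair.
pose VW : {mfun Om >-> (d.-tuple R * d.-tuple R)%type} :=
  HB.pack (fun w => (V w, W w)) (isMeasurableFun.Build _ _ _ _ _ mVW).
apply: ereal_inf_lbound; exists (distribution P VW).
  split => A mA.
    rewrite -lV//; congr (P _); apply/seteqP; split => w; first by case.
    by [].
  rewrite -lW//; congr (P _); apply/seteqP; split => w; first by case.
  by [].
rewrite ge0_integral_distribution//.
  apply/measurable_EFinP; apply: (measurableT_comp (measurable_powR p)).
  apply: measurable_lqnorm => i.
  under [X in measurable_fun _ X]funext do rewrite !mxE.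
  apply: measurable_funB.
    exact: (measurableT_comp (measurable_tnth i) measurable_fst).
  exact: (measurableT_comp (measurable_tnth i) measurable_snd).
by move=> z; rewrite lee_fin powR_ge0.
Qed.

(** Monotonicity reduces to s (K + f), and Minkowski's inequality applies with the constant K, whose
    L^p norm is K under a probability. *)
Lemma minkowski_cst (f g : Om -> R) (K s : R) : 0 <= K -> 0 <= s -> 1 <= p ->
  measurable_fun setT f -> measurable_fun setT g ->
  (forall w, 0 <= f w) -> (forall w, 0 <= g w) ->
  {ae P, forall w, g w <= s * (K + f w)} ->
  ((\int[P]_w (g w `^ p)%:E) `^ p^-1 <=
   (K%:E + (\int[P]_w (f w `^ p)%:E) `^ p^-1) * s%:E)%E.
Proof.
move=> K0 s0 p1 mf mg f0 g0 gf.
have p0 : 0 < p by apply: lt_le_trans p1.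
have mp (h : Om -> R) : measurable_fun setT h -> measurable_fun setT (fun w => (h w `^ p)%:E).
  by move=> mh; apply/measurable_EFinP; exact: (measurableT_comp (measurable_powR p)).
have mKf : measurable_fun setT (fun w => K + f w) by exact: measurable_funD.
have I0 : (0 <= \int[P]_w ((K + f w) `^ p)%:E)%E.
  by apply: integral_ge0 => w _; rewrite lee_fin powR_ge0.
apply: (@le_trans _ _ ((s%:E `^ p * \int[P]_w ((K + f w) `^ p)%:E) `^ p^-1)%E).
  have J0 : (0 <= \int[P]_w (g w `^ p)%:E)%E.
    by apply: integral_ge0 => w _; rewrite lee_fin powR_ge0.
  have sI0 := mule_ge0 (poweR_ge0 s%:E p) I0.
  apply: gt0_ler_poweR; rewrite ?invr_ge0 ?(ltW p0)// ?in_itv/= ?leey ?andbT ?J0 ?sI0//.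
  rewrite -ge0_integralZl//; last 3 first.
  - exact: mp.
  - by move=> w _; rewrite lee_fin powR_ge0.
  - by rewrite lee_fin powR_ge0.
  apply: ae_ge0_le_integral => //.
  - by move=> w _; rewrite lee_fin powR_ge0.
  - exact: mp.
  - by move=> w _; rewrite -EFinM lee_fin mulr_ge0 ?powR_ge0.
  - by apply: emeasurable_funM => //; exact: mp.
  apply: filterS gf => w gfw _.
  rewrite -EFinM lee_fin -powRM// ?addr_ge0//.
  by apply: ge0_ler_powR; rewrite ?nnegrE ?(ltW p0)// mulr_ge0// addr_ge0.
rewrite poweRM ?poweR_ge0// -poweRrM mulfV ?gt_eqF// poweRe1 ?lee_fin// muleC.
apply: lee_wpmul2r; first by rewrite lee_fin.
have := @minkowski_EFin _ _ _ P (cst K) f p (measurable_cst _) mf p1.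
rewrite !Lnorm.unlock.
have E1 (h : Om -> R) : (forall w, 0 <= h w) ->
    (\int[P]_w (`|(EFin \o h) w| `^ p))%E = (\int[P]_w (h w `^ p)%:E)%E.
  by move=> h0; apply: eq_integral => w _ /=; rewrite ger0_norm.
rewrite (E1 _ f0) (E1 (cst K \+ f)) => [|w]; last by rewrite addr_ge0.
move=> /le_trans; apply; rewrite leeD2r// (E1 (cst K))//.
rewrite (_ : (fun _ => _) = cst (K `^ p)%:E)// integral_cst//= [X in (_ * X)%E](probability_setT P).
by rewrite mule1 poweR_EFin -powRrM mulfV ?gt_eqF// powRr1.
Qed.

End Wasserstein.

(** * Pointwise bound and tail of the maximum *)

Section Bounds.
Context (R : realType) (dO : measure_display) (Om : measurableType dO).
Variables (P : probability Om R) (d : nat).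

Lemma lqnorm_pinfty_lt (x : 'rV[R]_d) M : 0 < M ->
  (lqnorm +oo%E x < M) = [forall i, `|x ord0 i| < M].
Proof.
move=> M0; apply/idP/forallP => [xM i|H].
  by apply: le_lt_trans xM; apply: (@lqnorm_coord _ _ +oo%E); exact: leey.
by apply/bigmax_ltP; split.
Qed.

Lemma gauss_max_tail (X : Om -> 'rV[R]_d) M : 0 < M ->
  measurable_fun setT (fun w => lqnorm +oo%E (X w)) ->
  (forall A : 'I_d -> set R, (forall i, measurable (A i)) ->
    P [set w | forall i, A i (X w ord0 i)] = (\prod_(i < d) normal_prob (0 : R) 1 (A i))%E) ->
  P [set w | M <= lqnorm +oo%E (X w)] = (1 - (1 - erfc (M / Num.sqrt 2)) ^+ d)%:E.
Proof.
move=> M0 mN HX; pose A (i : 'I_d) : set R := `]-M, M[%classic.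
have -> : [set w | M <= lqnorm +oo%E (X w)] = ~` [set w | forall i, A i (X w ord0 i)].
  apply/seteqP; split => w /=.
    move=> MX H; move: MX; rewrite leNgt lqnorm_pinfty_lt// => /negP; apply.
    by apply/forallP => i; have := H i; rewrite /A /= in_itv/= ltr_norml.
  move=> H; rewrite leNgt; apply/negP; rewrite lqnorm_pinfty_lt// => /forallP H'; apply: H => i.
  by rewrite /A /= in_itv/= -ltr_norml.
have mA : measurable [set w | forall i, A i (X w ord0 i)].
  have -> : [set w | forall i, A i (X w ord0 i)] =
      setT `&` (fun w => lqnorm +oo%E (X w)) @^-1` `]-oo, M[%classic.
    rewrite setTI; apply/seteqP; split => w /=.
      by move=> H; rewrite in_itv/= lqnorm_pinfty_lt//; apply/forallP => i;
        have := H i; rewrite /A /= in_itv/= ltr_norml.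
    by rewrite in_itv/= lqnorm_pinfty_lt// => /forallP H i; rewrite /A /= in_itv/= -ltr_norml.
  by apply: mN => //; exact: measurable_itv.
rewrite probability_setC// HX; last by move=> i; exact: measurable_itv.
under eq_bigr do rewrite /A normal_prob_erfc//.
by rewrite prodEFin prodr_const card_ord.
Qed.

Context (e : 'I_d -> Om -> R) (K : R) (eta : Om -> 'rV[R]_d).
Hypothesis me : forall i, measurable_fun setT (e i).
Hypothesis eK : forall i w, `|e i w| <= K.
Hypothesis ae_e : {ae P, forall w, forall i, eta w ord0 i = e i w}.

Lemma lqnorm_rescaled_flow_le (q : \bar R) (u : 'I_d -> R -> R) (s : R) (z : 'rV[R]_d) :
  (1 <= q)%E -> 0 < s -> s <= 1 ->
  (forall i (r : R), 0 <= r -> is_derive r 1 (u i) (velocity P e r (u ^~ r) i)) ->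
  ((lqnorm q (\row_i (s * u i ((1 - s) / s)) - (1 - s) *: z))%:E <=
   (s * lqnorm q (\row_i u i 0))%:E +
   (1 - s)%:E * ess_sup P (fun w => (lqnorm q (eta w - z))%:E))%E.
Proof.
move=> q1 s0 s1 du; set S := ess_sup _ _.
have sN0 : s != 0 by rewrite gt_eqF.
have S0 : (0 <= S)%E.
  apply: ess_sup_gee; first by rewrite [X in (_ < X)%E](probability_setT P).
  by apply: aeW => w; rewrite lee_fin lqnorm_ge0.
(* Settled before an infinite [S]: here the coefficient 1 - s vanishes and 0 times +oo is 0, whereas
   for s < 1 an infinite [S] makes the bound trivial. *)
have [->|sN1] := eqVneq s 1.
  rewrite subrr mul0r mul0e adde0 mul1r scale0r subr0 lee_fin.
  by under eq_mx do rewrite mul1r.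
have s1' : 0 < 1 - s by rewrite subr_gt0 lt_neqAle sN1.
have [Soo|SNoo] := eqVneq S +oo%E.
  by rewrite Soo gt0_muley ?lte_fin// addey ?leey.
have Sfin : S \is a fin_num by rewrite ge0_fin_numE// ltey.
have tau0 : 0 <= (1 - s) / s by rewrite divr_ge0// ltW.
have aeS : {ae P, forall w, lqnorm q ((\row_i e i w) - z) <= fine S}.
  apply: filterS2 ae_e (ess_sup_ge P (fun w => (lqnorm q (eta w - z))%:E)) => w ew.
  rewrite -/S -lee_fin fineK// => wS.
  have -> : \row_i e i w = eta w by apply/rowP => i; rewrite mxE ew.
  exact: wS.
have := lqnorm_flow_le me eK du q1 tau0 aeS.
rewrite -(ler_pM2l s0) -(lqnormZ (\row_i u i ((1 - s) / s) - _) q1 (ltW s0)).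
rewrite scalerBr scalerA mulrDr [s * (_ * fine S)]mulrA.
have -> : s * ((1 - s) / s) = 1 - s by field.
have -> : s *: \row_i u i ((1 - s) / s) = \row_i (s * u i ((1 - s) / s)).
  by apply/rowP => i; rewrite !mxE.
by move=> h; rewrite -[X in (_ * X)%E](fineK Sfin) -EFinM -EFinD lee_fin.
Qed.

End Bounds.

(* [eta] is bounded only almost surely; clamping its coordinates gives an almost
   surely equal version that is bounded everywhere. *)
Definition clamp_tuple (R : realType) (d : nat) (K : R) (x : d.-tuple R) : d.-tuple R :=
  [tuple Num.max (- K) (Num.min K (tnth x i)) | i < d].

Lemma clamp_tuple_id (R : realType) (d : nat) (K : R) (x : d.-tuple R) i :
  `|tnth x i| <= K -> tnth (clamp_tuple K x) i = tnth x i.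
Proof.
by rewrite tnth_mktuple ler_norml => /andP[Kx xK]; rewrite (min_idPr xK) (max_idPr Kx).
Qed.

Lemma clamp_tuple_le (R : realType) (d : nat) (K : R) (x : d.-tuple R) i :
  0 <= K -> `|tnth (clamp_tuple K x) i| <= K.
Proof.
move=> K0; rewrite tnth_mktuple ler_norml le_max lexx/= ge_max ge_min lexx andbT.
by rewrite (le_trans _ K0) ?oppr_le0.
Qed.

Lemma measurable_clamp_tuple (R : realType) (d : nat) (K : R) :
  measurable_fun setT (@clamp_tuple R d K).
Proof.
apply: measurable_tuple_map => i; apply: measurable_maxr => //.
by apply: measurable_minr => //; exact: measurable_tnth.
Qed.

Theorem theorem2p8 (R : realType) (d : nat) (T : \bar R) (sigma sigma' : R -> R)
  (dO : measure_display) (Om : measurableType dO) (P : probability Om R)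
  (Y0 eta : Om -> 'rV[R]_d) (q : \bar R) (K : R) :
  (0 < T)%E ->
  assumption_H T sigma sigma' ->
  measurable_fun setT (@rv2t R d \o Y0) ->
  measurable_fun setT (@rv2t R d \o eta) ->
  (* the Y_0^i are i.i.d. N(0,1) and eta is independent of Y_0 *)
  (forall (A : 'I_d -> set R) (B : set (d.-tuple R)),
      (forall i, measurable (A i)) -> measurable B ->
      P ([set w | forall i, A i (Y0 w ord0 i)] `&` (@rv2t R d \o eta) @^-1` B)
      = ((\prod_(i < d) normal_prob 0 1 (A i)) * P ((@rv2t R d \o eta) @^-1` B))%E) ->
  (1 <= q)%E ->
  (ess_sup P (fun w => (lqnorm q (eta w))%:E) <= K%:E)%E ->
  exists Y : R -> Om -> 'rV[R]_d,
    ode_solution T (drift P eta sigma sigma') Y0 Y /\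
        (forall Z : R -> Om -> 'rV[R]_d,
            ode_solution T (drift P eta sigma sigma') Y0 Z ->
            forall t w, I0T T t -> Z t w = Y t w) /\
        (forall t, I0T T t ->
            measurable_fun setT (@rv2t R d \o Y t) /\
            forall A : set (d.-tuple R), measurable A ->
              law P (Y t) A
              = iint (fun x => ((\1_A x)%:E * phi P eta sigma t (t2rv x))%E)) /\
        (* (i) *)
        (forall p : R, 1 <= p -> forall t, I0T T t ->
            (wasserstein q p (law P (Y t)) (law P eta)
             <= (K%:E + (\int[P]_w ((lqnorm q (Y0 w)) `^ p)%:E) `^ p^-1)
                * (sigma t)%:E)%E) /\
        (* (ii) *)
        (forall t (z : 'rV[R]_d), I0T T t -> forall w,
            ((lqnorm q (Y t w - beta sigma t *: z))%:E
             <= (sigma t * lqnorm q (Y0 w))%:E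
                + (beta sigma t)%:E * ess_sup P (fun w' => (lqnorm q (eta w' - z))%:E))%E) /\
        (* (iii) *)
        (forall M : R, 0 < M -> forall t, I0T T t ->
            (P [set w | ((beta sigma t)%:E
                           * ess_sup P (fun w' => (lqnorm +oo%E (eta w'))%:E)
                         + (sigma t * M)%:E <= (lqnorm +oo%E (Y t w))%:E)%E]
             <= (1 - (1 - erfc (M / Num.sqrt 2)) ^+ d)%:E)%E).
Proof.
move=> T0 HH mY0 meta indep q1 etaK.
have PT : (0 < P setT)%E by rewrite [X in (_ < X)%E](probability_setT P).
have K0 : 0 <= K.
  rewrite -lee_fin; apply: le_trans etaK; apply: ess_sup_gee => //.
  by apply: aeW => w; rewrite lee_fin lqnorm_ge0.
have aeK : {ae P, forall w, lqnorm q (eta w) <= K}.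
  by move/ess_supP: etaK; apply: filterS => w; rewrite lee_fin.
pose X w := rv2t (Y0 w); pose E w := clamp_tuple K (rv2t (eta w)).
pose e i w := tnth (E w) i.
have mE : measurable_fun setT E.
  exact: (measurableT_comp (@measurable_clamp_tuple R d K) meta).
have me i : measurable_fun setT (e i).
  exact: (measurableT_comp (measurable_tnth i) mE).
have coordE (Z : Om -> 'rV[R]_d) i : (fun w => Z w ord0 i) = (fun w => tnth (rv2t (Z w)) i).
  by apply/funext => w; rewrite tnth_mktuple.
have mcoord (Z : Om -> 'rV[R]_d) : measurable_fun setT (@rv2t R d \o Z) ->
    forall i, measurable_fun setT (fun w => Z w ord0 i).
  by move=> mZ i; rewrite coordE; exact: (measurableT_comp (measurable_tnth i) mZ).
have metac := mcoord eta meta.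
have eK i w : `|e i w| <= K by exact: clamp_tuple_le.
have ae_e : {ae P, forall w, forall i, eta w ord0 i = e i w}.
  apply: filterS aeK => w etaw i; rewrite /e clamp_tuple_id tnth_mktuple//.
  exact: le_trans (lqnorm_coord _ i q1) etaw.
have XE_indep (A : 'I_d -> set R) (B : set (d.-tuple R)) :
    (forall i, measurable (A i)) -> measurable B ->
    P ([set w | forall i, A i (tnth (X w) i)] `&` E @^-1` B) =
    ((\prod_(i < d) normal_prob (0 : R) 1 (A i)) * P (E @^-1` B))%E.
  (* Clamping is a measurable function of eta alone, so independence from Y_0 survives. *)
  move=> mA mB; have mcB : measurable (@clamp_tuple R d K @^-1` B).
    by rewrite -[X in measurable X]setTI; exact: measurable_clamp_tuple.
  rewrite -[RHS](indep A _ mA mcB); congr (P (_ `&` _)).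
  by apply/seteqP; split => w H i; have := H i; rewrite tnth_mktuple.
have /choice[u Hu] (w : Om) := velocity_flow P me K0 eK (fun i => Y0 w ord0 i).
have u0 w i : u w i 0 = tnth (X w) i by rewrite tnth_mktuple; case: (Hu w).
have du w : forall i (s : R), 0 <= s -> is_derive s 1 (u w i) (velocity P e s ((u w) ^~ s) i).
  by case: (Hu w).
pose tau t := beta sigma t / sigma t.
pose Y t w : 'rV[R]_d := \row_i (sigma t * u w i (tau t)).
pose sc t (x : d.-tuple R) := [tuple sigma t * tnth x i | i < d].
have msc t : measurable_fun setT (sc t).
  apply: measurable_tuple_map => i; apply: measurable_funM => //; exact: measurable_tnth.
have YE t : @rv2t R d \o Y t = sc t \o (fun w => [tuple u w i (tau t) | i < d]).
  by apply/funext => w; apply: eq_from_tnth => i; rewrite !tnth_mktuple mxE.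
have mY t : I0T T t -> measurable_fun setT (@rv2t R d \o Y t).
  move=> It; rewrite YE; apply: (measurableT_comp (msc t)).
  exact: (flow_measurable mY0 mE K0 XE_indep eK u0 du (beta_sigma_ge0 T0 HH It)).
have lawY t A : I0T T t -> measurable A -> law P (Y t) A =
    P ((fun w => sc t (shift_tuple (tau t) (X w) (E w))) @^-1` A).
  move=> It mA; rewrite /law YE.
  have mscA : measurable (sc t @^-1` A).
    by rewrite -[X in measurable X]setTI; exact: msc.
  exact: (flow_law mY0 mE K0 XE_indep eK u0 du (beta_sigma_ge0 T0 HH It) mscA).
have Y00 w : Y 0 w = Y0 w.
  apply/rowP => i; rewrite mxE (sigma0 HH) mul1r /tau /beta (sigma0 HH) subrr mul0r u0.
  by rewrite tnth_mktuple.
have Ysol t w : I0T T t -> has_deriv_within (I0T T) (fun s => Y s w) t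
    (drift P eta sigma sigma' t (Y t w)).
  by move=> It; exact: (rescaled_flow_solution me metac eK ae_e T0 HH It (du w)).
have Ybound (r : \bar R) t (z : 'rV[R]_d) w : (1 <= r)%E -> I0T T t ->
    ((lqnorm r (Y t w - beta sigma t *: z))%:E
     <= (sigma t * lqnorm r (Y0 w))%:E
        + (beta sigma t)%:E * ess_sup P (fun w' => (lqnorm r (eta w' - z))%:E))%E.
  move=> r1 It.
  have := lqnorm_rescaled_flow_le me eK ae_e z r1 (sigma_gt0 HH It) (sigma_le1 T0 HH It) (du w).
  have -> // : \row_i u w i 0 = Y0 w.
  by apply/rowP => i; rewrite mxE u0 tnth_mktuple.
exists Y; split; [|split; [|split; [|split; [|split]]]].
- by move=> w; split => // t It; exact: Ysol.
- move=> Z Zsol t w It; have [Z0 dZ] := Zsol w.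
  have dY s : I0T T s -> has_deriv_within (I0T T) (Y^~ w) s
      (drift P eta sigma sigma' s ((Y^~ w) s)) by exact: Ysol.
  have YZ0 : (Y^~ w) 0 = (Z^~ w) 0 by rewrite Y00 Z0.
  exact: (@ode_unique _ _ _ _ _ _ _ _ _ _ _ me metac K0 eK ae_e T0 HH (Y^~ w) (Z^~ w) dY dZ YZ0 t It).
- move=> t It; split; first exact: mY.
  move=> A mA; rewrite lawY//.
  exact: (shift_law_density mY0 mE metac XE_indep ae_e (sigma_gt0 HH It) mA).
- move=> p p1 t It.
  (* [V] has the law of Y_t, and V - eta = sigma_t (Y_0 - eta) almost surely because 1 - beta_t =
     sigma_t. *)
  pose V w := sc t (shift_tuple (tau t) (X w) (E w)).
  have mV : measurable_fun setT V.
    exact: (measurableT_comp (msc t) (measurable_shift_tuple (tau t) mY0 mE)).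
  apply: le_trans (wasserstein_le q p mV meta (mu := law P (Y t)) (nu := law P eta) _ _) _ => //.
    by move=> A mA; rewrite lawY.
  apply: minkowski_cst => //.
  - exact: ltW (sigma_gt0 HH It).
  - exact: measurable_lqnorm (mcoord _ mY0).
  - apply: measurable_lqnorm => i.
    under [X in measurable_fun _ X]funext do rewrite !mxE.
    apply: measurable_funB; exact: (measurableT_comp (measurable_tnth i)).
  - by move=> w; exact: lqnorm_ge0.
  - by move=> w; exact: lqnorm_ge0.
  apply: filterS2 ae_e aeK => w ew etaw.
  have -> : t2rv (V w) - t2rv ((@rv2t R d \o eta) w) = sigma t *: (Y0 w - eta w).
    apply/rowP => i; rewrite !mxE.
    have -> : tnth (V w) i = sigma t * (Y0 w ord0 i + tau t * eta w ord0 i).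
      by rewrite /V tnth_mktuple [tnth (shift_tuple _ _ _) i]tnth_mktuple [tnth (X w) i]tnth_mktuple ew.
    rewrite tnth_mktuple /tau /beta.
    by field; rewrite gt_eqF// (sigma_gt0 HH It).
  rewrite lqnormZ ?(ltW (sigma_gt0 HH It))// ler_pM2l ?(sigma_gt0 HH It)//.
  by apply: le_trans (ler_lqnormD _ _ q1) _; rewrite lqnormN addrC lerD2r.
- by move=> t z It w; exact: Ybound.
- move=> M M0 t It; set S := ess_sup _ _.
  have st0 := sigma_gt0 HH It.
  have mNY0 : measurable_fun setT (fun w => lqnorm +oo%E (Y0 w)).
    exact: measurable_lqnorm (mcoord _ mY0).
  (* Reading the right side as the probability that the maximum norm of Y_0 is at least M leaves an
     inclusion of events. *)
  rewrite -(@gauss_max_tail _ _ _ P d Y0)//; last first.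
    move=> A mA; have := indep A setT mA measurableT.
    by rewrite preimage_setT setIT [X in (_ * X)%E](probability_setT P) mule1.
  have mNY : measurable_fun setT (fun w => (lqnorm +oo%E (Y t w))%:E).
    by apply/measurable_EFinP; exact: measurable_lqnorm (mcoord _ (mY t It)).
  apply: le_measure; rewrite ?inE.
  - set c := (_ + _)%E.
    have -> : [set w | (c <= (lqnorm +oo%E (Y t w))%:E)%E] =
        setT `&` (fun w => (lqnorm +oo%E (Y t w))%:E) @^-1` `[c, +oo[%classic.
      by rewrite setTI; apply/seteqP; split => w /=; rewrite in_itv/= andbT.
    by apply: mNY => //; exact: emeasurable_itv.
  - have -> : [set w | M <= lqnorm +oo%E (Y0 w)] =
        setT `&` (fun w => lqnorm +oo%E (Y0 w)) @^-1` `[M, +oo[%classic.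
      by rewrite setTI; apply/seteqP; split => w /=; rewrite in_itv/= andbT.
    by apply: mNY0 => //; exact: measurable_itv.
  move=> w /= h.
  have S0 : (0 <= S)%E.
    apply: ess_sup_gee => //; by apply: aeW => w'; rewrite lee_fin lqnorm_ge0.
  have b0 : (0 <= (beta sigma t)%:E)%E by rewrite lee_fin subr_ge0 (sigma_le1 T0 HH It).
  have := Ybound +oo%E t 0 w (leey _) It.
  have -> : (fun w' => (lqnorm +oo%E (eta w' - 0))%:E) = (fun w' => (lqnorm +oo%E (eta w'))%:E).
    by apply/funext => w'; rewrite subr0.
  rewrite scaler0 subr0 -/S => /(le_trans h).
  have bS0 := mule_ge0 b0 S0.
  (* On the event this term lies below a finite norm, so it is finite and can be cancelled. *)
  have bSfin : ((beta sigma t)%:E * S)%E \is a fin_num.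
    rewrite ge0_fin_numE//; apply: le_lt_trans (ltry (lqnorm +oo%E (Y t w))).
    by apply: le_trans h; rewrite leeDl// lee_fin mulr_ge0// ltW.
  by rewrite addeC leeD2rE// lee_fin ler_pM2l.
Qed.
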